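(* Let $\mathcal G$ be a locally finite, connected metric graph with finite volume $|\mathcal G|>0$, diameter $\mathrm{Diam}(\mathcal G)>0$ and finite Betti number $\beta\in\mathbb N_0$. Then the second eigenvalue $\mu_2(\mathcal G)$ of the Neumann realisation of the Laplacian on $\mathcal G$ satisfies $$\mu_2(\mathcal G)\le\frac{\pi^2}{\mathrm{Diam}(\mathcal G)^2}\cdot\frac{4|\mathcal G|-3\,\mathrm{Diam}(\mathcal G)}{\mathrm{Diam}(\mathcal G)}.$$
   Context: A metric graph $\mathcal G$ is given by finite or countably infinite sets $V$ of vertices and $E$ of edges, each edge $e$ having a length $\ell_e\in(0,\infty)$; it is obtained from the disjoint union of intervals $[0,\ell_e]$ by gluing endpoints at the vertices (loops and parallel edges allowed). It carries the shortest-path metric $\mathrm{dist}_{\mathcal G}$ and the sum of the Lebesgue measures on the edges; its volume is $|\mathcal G|=\sum_e\ell_e$, its diameter is $\mathrm{Diam}(\mathcal G)=\sup_{x,y\in\mathcal G}\mathrm{dist}_{\mathcal G}(x,y)$. It is locally finite if every vertex has finite degree. The (first) Betti number is the number of independent cycles of $\mathcal G$; it is finite if and only if some compact subgraph contains all cycles of $\mathcal G$. $H^1(\mathcal G)$ is the space of continuous $f$ on $\mathcal G$ with $f_e\in H^1(0,\ell_e)$ for every edge and $\sum_e\|f_e\|^2_{H^1(0,\ell_e)}<\infty$. The Neumann realisation is the self-adjoint operator on $L^2(\mathcal G)$ associated with $f\mapsto\int_{\mathcal G}|f'|^2dx$ on $H^1(\mathcal G)$. For finite volume it has compact resolvent,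 with eigenvalues $0=\mu_1<\mu_2\le\cdots$ counted with multiplicity. *)

(* Defs.v *)
From HB Require Import structures.
From mathcomp Require Import all_boot all_order all_algebra.
From mathcomp Require Import all_classical all_reals all_analysis.
From Stdlib Require Import Relation_Operators.
Set Implicit Arguments.
Unset Strict Implicit.
Unset Printing Implicit Defensive.
Import Order.TTheory GRing.Theory Num.Theory.
Import numFieldNormedType.Exports.
Local Open Scope classical_set_scope.
Local Open Scope ring_scope.

Definition lin_indep (K : fieldType) (T : Type) (A : set T) (k : nat)
    (u : 'I_k -> T -> K) : Prop :=
  forall c : 'I_k -> K,
    (forall t, A t -> \sum_(i < k) c i * u i t = 0) -> forall i, c i = 0.

(* The edge [e] is the interval [0, len e], with 0 attached to [src e] and
   [len e] attached to [tgt e].  The orientation is only bookkeeping. *)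
Record metric_graph (R : realType) := MetricGraph {
  vertex : countType;
  edge : countType;
  src : edge -> vertex;
  tgt : edge -> vertex;
  len : edge -> R;
  len_gt0 : forall e, 0 < len e }.

Section Graph.
Context {R : realType}.
Variable G : metric_graph R.
Implicit Types (p q : edge G * R) (e : edge G) (v : vertex G).

Definition locally_finite : Prop :=
  forall v, finite_set [set e | src e = v \/ tgt e = v].

Definition graph_connected : Prop :=
  forall v w,
    clos_refl_sym_trans (vertex G) (fun a b => exists e, src e = a /\ tgt e = b)
      v w.

Definition volume : \bar R := \esum_(e in [set: edge G]) (len e)%:E.

(* Simplicial 1-cycles with rational coefficients; the sums below are finite
   because the support of [c] is. *)
Definition is_cycle (c : edge G -> rat) : Prop :=
  finite_set [set e | c e != 0] /\
  forall v, \sum_(e \in [set e | tgt e = v]) c e =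
            \sum_(e \in [set e | src e = v]) c e.

Definition has_betti_number (beta : nat) : Prop :=
  (exists c : 'I_beta -> edge G -> rat,
     (forall i, is_cycle (c i)) /\ lin_indep [set: edge G] c) /\
  (forall n (c : 'I_n -> edge G -> rat),
     (forall i, is_cycle (c i)) -> lin_indep [set: edge G] c -> (n <= beta)%N).

(* The metric space is the quotient of the set [points] of pairs (e, x) with
   x in [0, len e] by [glued].  It is handled through these representatives:
   [dist] below is the pseudo-metric they inherit, and two of them represent
   the same point of a locally finite graph iff their distance is 0. *)
Definition points : set (edge G * R) := [set p | 0 <= p.2 <= len p.1].

Definition at_vertex p v : Prop :=
  (p.2 = 0 /\ src p.1 = v) \/ (p.2 = len p.1 /\ tgt p.1 = v).

Definition glued p q : Prop := exists v, at_vertex p v /\ at_vertex q v.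

(* [graph_path p q L]: some path made of finitely many segments of edges leads
   from [p] to [q] and has length [L]. *)
Inductive graph_path p : edge G * R -> R -> Prop :=
| graph_path_refl : graph_path p p 0
| graph_path_edge e x y L : graph_path p (e, x) L -> points (e, y) ->
    graph_path p (e, y) (L + `|y - x|)
| graph_path_glue q r L : graph_path p q L -> glued q r -> graph_path p r L.

Definition dist p q : \bar R := ereal_inf [set L%:E | L in graph_path p q].

Definition diameter : \bar R :=
  ereal_sup [set d | exists p q, [/\ points p, points q & d = dist p q]].

Definition continuous_on_graph (f : edge G * R -> R) : Prop :=
  forall p, points p -> forall eps : R, 0 < eps ->
    exists2 delta : R, 0 < delta &
      forall q, points q -> (dist p q < delta%:E)%E -> `|f q - f p| < eps.

Definition edge_fun (f : edge G * R -> R) (e : edge G) : R -> R :=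
  fun x => f (e, x).

Local Notation leb := (@lebesgue_measure R).
Local Notation itv l := ([set` `]0, l[%R] : set R).

(* Lebesgue integral for the sum of the Lebesgue measures on the edges, as the
   difference of the integrals of the positive and negative parts. *)
Definition graph_integral (h : edge G * R -> R) : \bar R :=
  (\esum_(e in [set: edge G])
     \int[leb]_(x in itv (len e)) ((EFin \o edge_fun h e)^\+ x) -
   \esum_(e in [set: edge G])
     \int[leb]_(x in itv (len e)) ((EFin \o edge_fun h e)^\- x))%E.

Definition L2_interval (l : R) (u : R -> R) : Prop :=
  measurable_fun (itv l) u /\ (\int[leb]_(x in itv l) ((u x) ^+ 2)%:E < +oo)%E.

Definition L2_graph (f : edge G * R -> R) : Prop :=
  (forall e, L2_interval (len e) (edge_fun f e)) /\
  (graph_integral (fun p => (f p) ^+ 2)%R < +oo)%E.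

(* Smooth functions with compact support in ]0, l[. *)
Definition test_function (l : R) (phi : R -> R) : Prop :=
  (forall n x, derivable (derive1n n phi) x 1) /\
  exists a b : R, [/\ 0 < a, b < l & forall x, ~~ (a <= x <= b) -> phi x = 0].

(* [u] belongs to H^1(0, l) and has weak derivative [u']. *)
Definition H1_interval (l : R) (u u' : R -> R) : Prop :=
  [/\ L2_interval l u, L2_interval l u' &
    forall phi, test_function l phi ->
      (\int[leb]_(x in itv l) (u x * derive1 phi x)%:E =
       - \int[leb]_(x in itv l) (u' x * phi x)%:E)%E].

(* [f] belongs to H^1(G) and has edgewise weak derivative [f'], which is
   determined up to null sets only. *)
Definition H1_graph (f f' : edge G * R -> R) : Prop :=
  [/\ continuous_on_graph f,
      (forall e, H1_interval (len e) (edge_fun f e) (edge_fun f' e)) &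
      (graph_integral (fun p => (f p) ^+ 2 + (f' p) ^+ 2)%R < +oo)%E].

(* The graph of the operator associated with the form
   f |-> \int_G |f'|^2 on H^1(G): [u] is in the domain and is mapped to [h]. *)
Definition neumann_laplacian (u h : edge G * R -> R) : Prop :=
  L2_graph h /\
  exists u', H1_graph u u' /\
    forall g g', H1_graph g g' ->
      graph_integral (fun p => u' p * g' p) =
      graph_integral (fun p => h p * g p).

(* The [k]-th eigenvalue counted with multiplicity, k >= 1: the least [lam]
   such that the eigenvalues at most [lam] have total multiplicity at least
   [k].  Elements of the domain are continuous, so they vanish in L^2 iff they
   vanish at every point. *)
Definition neumann_eigenvalue (k : nat) : \bar R :=
  ereal_inf [set lam%:E | lam in [set lam : R |
    exists (u : 'I_k -> edge G * R -> R) (nu : 'I_k -> R),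
      [/\ (forall i, neumann_laplacian (u i) (fun p => nu i * u i p)),
          (forall i, nu i <= lam) & lin_indep points u]]].

End Graph.

(* Main.v *)
From HB Require Import structures.
Require Import Defs.
From mathcomp Require Import all_boot all_order all_algebra.
From mathcomp Require Import all_classical all_reals all_analysis.
From mathcomp Require Import measurable_realfun ring lra.
Set Implicit Arguments.
Unset Strict Implicit.
Unset Printing Implicit Defensive.
Import Order.TTheory GRing.Theory Num.Theory.
Import numFieldNormedType.Exports.
Local Open Scope classical_set_scope.
Local Open Scope ring_scope.

(* The form f |-> \int |f'|^2 has a minimizer of the Rayleigh quotient among the
   functions of mean zero: |f q - f p|^2 <= 4 |G| \int |f'|^2, so that a minimizing
   sequence is bounded and equicontinuous.  The minimizer and the constants are
   eigenfunctions, hence mu_2 is at most the Rayleigh quotient of every function of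
   mean zero.  Given two points at distance T, let Phi be the distance to the first
   one, made piecewise affine on the edges, and f = cos (pi Phi / T).  Then
   |f'|^2 <= (pi / T)^2 (1 - f^2).  The path joining the points shows that the
   images of the edges under the 1-Lipschitz function Phi cover [0, T], hence
   \int_G h (Phi) >= \int_0^T h for every h >= 0, and so f minus its mean has a
   squared norm of at least T / 2 while \int |f'|^2 <= (pi / T)^2 (|G| - T / 2).
   Letting T tend to D = Diam G gives mu_2 <= pi^2 (2 |G| - D) / D^3, which is
   smaller than the bound claimed since D <= |G|. *)

(** * Square integrable functions *)

(** Two obstacles shape the proof. Membership in H^1 is tested against smooth functions of compact
    support, so every pointwise bound on u by its weak derivative has to be extracted by
    mollification; a smooth step built from exp (-1/t) serves that purpose. The distance to a point
    is merely Lipschitz on an edge. Linear interpolation keeps its values at the vertices, so that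
    gluing is respected, and at the two chosen points, keeps its slopes within [-1, 1], and reduces
    the chain rule and integration by parts to the affine case. The constants come from one
    identity: for every c, the integral of (cos (pi z / T) - c)^2 over [0, T] is (1/2 + c^2) T. With
    c the mean of f it bounds the norm from below by T / 2; with c = 0 it bounds the energy from
    above, through |G| - T / 2. No spectral theorem enters: the eigenvalue is an infimum, so two
    independent eigenfunctions bound it from above. T only tends to D because the supremum of the
    distances need not be attained. *)

(** Evaluate at the minimum -b / c; if c = 0, a nonzero b would let the affine function take the
    value -1. It serves for Cauchy-Schwarz and, with a = 0, for the Euler-Lagrange equation. *)
Lemma quadratic_ge0_discr (R : realFieldType) (a b c : R) : 0 <= c ->
  (forall t, 0 <= a + 2 * t * b + t ^+ 2 * c) -> b ^+ 2 <= a * c.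
Proof.
move=> c0 H; have [c_eq0|c_neq0] := eqVneq c 0; last first.
  have := H (- b / c).
  have -> : a + 2 * (- b / c) * b + (- b / c) ^+ 2 * c = (a * c - b ^+ 2) / c.
    by field.
  by rewrite pmulr_lge0 ?invr_gt0 ?lt0r ?c_neq0// subr_ge0.
rewrite c_eq0 mulr0; have [->|b0] := eqVneq b 0; first by rewrite expr0n.
have := H (- (a + 1) / (2 * b)).
have -> : a + 2 * (- (a + 1) / (2 * b)) * b + (- (a + 1) / (2 * b)) ^+ 2 * c = -1.
  by rewrite c_eq0; field.
by rewrite lerNr oppr0 ler10.
Qed.

Section SquareIntegrable.
Context d (T : measurableType d) (R : realType).
Variables (mu : {measure set T -> \bar R}) (D : set T) (mD : measurable D).
Implicit Types (f g h : T -> R).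

(** Functions rather than classes modulo null sets, because elements of H^1(G) have a value at every
    point. Accordingly [ip] is only a semi-inner product. *)
Definition sq_int f :=
  measurable_fun D f /\ mu.-integrable D (EFin \o (fun x => f x ^+ 2)).

Definition ip f g : R := \int[mu]_(x in D) (f x * g x).

Lemma sq_intP f : measurable_fun D f ->
  (\int[mu]_(x in D) (f x ^+ 2)%:E < +oo)%E -> sq_int f.
Proof.
move=> mf fi; split=> //; apply/integrableP; split.
  by apply/measurable_EFinP; exact: measurable_funX.
by under eq_integral do rewrite gee0_abs ?lee_fin ?sqr_ge0//.
Qed.

Lemma sq_int_mul f g : sq_int f -> sq_int g ->
  mu.-integrable D (EFin \o (fun x => f x * g x)).
Proof.
move=> [mf fi] [mg gi].
apply: (le_integrable mD _ _ (integrableD mD fi gi)).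
  by apply/measurable_EFinP; exact: measurable_funM.
move=> x Dx; rewrite /= lee_fin [leRHS]ger0_norm ?addr_ge0 ?sqr_ge0//.
rewrite normrM -[f x ^+ 2](real_normK (num_real _)) -[g x ^+ 2](real_normK (num_real _)).
have := sqr_ge0 (`|f x| - `|g x|); have := normr_ge0 (f x); have := normr_ge0 (g x).
nra.
Qed.

Lemma sq_int_lin f g (a b : R) : sq_int f -> sq_int g ->
  sq_int (fun x => a * f x + b * g x).
Proof.
move=> [mf fi] [mg gi]; split.
  by apply: measurable_funD; exact: measurable_funM.
have := integrableD mD (integrableD mD (integrableZl mD (a ^+ 2) fi)
  (integrableZl mD (b ^+ 2) gi))
  (integrableZl mD (2 * a * b) (sq_int_mul (conj mf fi) (conj mg gi))).
by apply: eq_integrable => // x _ /=; congr EFin; ring.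
Qed.

Lemma eq_sq_int f g : {in D, f =1 g} -> sq_int f -> sq_int g.
Proof.
move=> fg [mf fi]; split; first exact: eq_measurable_fun mf.
by apply: eq_integrable fi => // x Dx /=; rewrite fg.
Qed.

Lemma sq_intD f g : sq_int f -> sq_int g -> sq_int (fun x => f x + g x).
Proof.
move=> fi gi; have := sq_int_lin 1 1 fi gi.
by apply: eq_sq_int => x _; rewrite !mul1r.
Qed.

Lemma sq_intB f g : sq_int f -> sq_int g -> sq_int (fun x => f x - g x).
Proof.
move=> fi gi; have := sq_int_lin 1 (-1) fi gi.
by apply: eq_sq_int => x _; rewrite mul1r mulN1r.
Qed.

Lemma sq_intZ f (a : R) : sq_int f -> sq_int (fun x => a * f x).
Proof.
move=> fi; have := sq_int_lin a 0 fi fi.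
by apply: eq_sq_int => x _; rewrite mul0r addr0.
Qed.

Lemma ipC f g : ip f g = ip g f.
Proof. by apply: eq_Rintegral => x _; rewrite mulrC. Qed.

Lemma ip_ge0 f : 0 <= ip f f.
Proof. by apply: Rintegral_ge0 => x _; rewrite -expr2 sqr_ge0. Qed.

Lemma ipE f g : sq_int f -> sq_int g ->
  (\int[mu]_(x in D) (f x * g x)%:E)%E = (ip f g)%:E.
Proof.
move=> fi gi; rewrite /ip fineK//.
exact/integrable_fin_num/(sq_int_mul fi gi).
Qed.

Lemma eq_ip f f' g g' : {in D, f =1 f'} -> {in D, g =1 g'} -> ip f g = ip f' g'.
Proof. by move=> ff gg; apply: eq_Rintegral => x Dx; rewrite ff// gg. Qed.

Lemma ip_linl f g h (a b : R) : sq_int f -> sq_int g -> sq_int h ->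
  ip (fun x => a * f x + b * g x) h = a * ip f h + b * ip g h.
Proof.
move=> fi gi hi; have fh := sq_int_mul fi hi; have gh := sq_int_mul gi hi.
rewrite /ip -(RintegralZl a mD fh) -(RintegralZl b mD gh) -RintegralD//;
  last 2 first.
- exact: (integrableZl mD a fh).
- exact: (integrableZl mD b gh).
by apply: eq_Rintegral => x _; ring.
Qed.

Lemma ipBl f g h : sq_int f -> sq_int g -> sq_int h ->
  ip (fun x => f x - g x) h = ip f h - ip g h.
Proof.
move=> fi gi hi; have := ip_linl 1 (-1) fi gi hi; rewrite mul1r mulN1r => <-.
by apply: eq_ip => // x _; rewrite mul1r mulN1r.
Qed.

Lemma ip_lin_sq f g (a b : R) : sq_int f -> sq_int g ->
  ip (fun x => a * f x + b * g x) (fun x => a * f x + b * g x) =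
  a ^+ 2 * ip f f + 2 * a * b * ip f g + b ^+ 2 * ip g g.
Proof.
move=> fi gi; rewrite ip_linl//; last exact: sq_int_lin.
rewrite (ipC f) (ipC g) !ip_linl// (ipC g f); ring.
Qed.

Lemma ipB_sq f g : sq_int f -> sq_int g ->
  ip (fun x => f x - g x) (fun x => f x - g x) =
  ip f f - 2 * ip f g + ip g g.
Proof.
move=> fi gi; have E : {in D, (fun x => f x - g x) =1 (fun x => 1 * f x + -1 * g x)}.
  by move=> x _; ring.
rewrite (eq_ip E E) ip_lin_sq//; ring.
Qed.

Lemma ipD_sq f g : sq_int f -> sq_int g ->
  ip (fun x => f x + g x) (fun x => f x + g x) =
  ip f f + 2 * ip f g + ip g g.
Proof.
move=> fi gi; have E : {in D, (fun x => f x + g x) =1 (fun x => 1 * f x + 1 * g x)}.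
  by move=> x _; ring.
rewrite (eq_ip E E) ip_lin_sq//; ring.
Qed.

Lemma ip_cauchy_schwarz f g : sq_int f -> sq_int g ->
  (ip f g) ^+ 2 <= ip f f * ip g g.
Proof.
move=> fi gi; apply: quadratic_ge0_discr; first exact: ip_ge0.
move=> t; have := ip_ge0 (fun x => 1 * f x + t * g x).
by rewrite ip_lin_sq// expr1n mul1r mulr1.
Qed.

(* A subsequence g_k with \|g_(k+1) - g_k\|^2 <= 4^-k converges almost everywhere,
   since |g_(k+1) - g_k| <= 2^-k + 2^k (g_(k+1) - g_k)^2. *)
Lemma sq_int_complete (f : (T -> R)^nat) :
  (forall n, sq_int (f n)) ->
  (forall eps : R, 0 < eps -> exists N, forall m n, (N <= m)%N -> (N <= n)%N ->
     ip (fun x => f m x - f n x) (fun x => f m x - f n x) < eps) ->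
  exists2 g, sq_int g &
    forall eps : R, 0 < eps -> exists N, forall n, (N <= n)%N ->
     ip (fun x => f n x - g x) (fun x => f n x - g x) <= eps.
Proof.
move=> fi fC.
pose e k : R := (4^-1) ^+ k.
have e0 k : 0 < e k by rewrite exprn_gt0// invr_gt0.
have [N NP] : {N : nat -> nat | forall k m n, (N k <= m)%N -> (N k <= n)%N ->
    ip (fun x => f m x - f n x) (fun x => f m x - f n x) < e k}.
  have /choice[N NP] : forall k, exists N, forall m n, (N <= m)%N -> (N <= n)%N ->
    ip (fun x => f m x - f n x) (fun x => f m x - f n x) < e k.
    by move=> k; exact: fC.
  by exists N.
(* Partial sums make the indices nondecreasing while [M k] stays at least [N k]. *)
pose M k := (\sum_(i < k.+1) N i)%N.
have NM k : (N k <= M k)%N by rewrite /M big_ord_recr/= leq_addl.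
have Mnd k : (M k <= M k.+1)%N by rewrite /M [leqRHS]big_ord_recr/= leq_addr.
have NMge k m : (k <= m)%N -> (N k <= M m)%N.
  move=> /subnK <-; elim: (m - k)%N => [|n IH]//.
  by rewrite addSn (leq_trans IH).
pose g k := f (M k).
pose dg k x := g k.+1 x - g k x.
have gi k : sq_int (g k) by exact: fi.
have dgi k : sq_int (dg k) by exact: sq_intB.
(* The k-th term has integral at most 2^k 4^-k, so S has integral at most 2 and is finite almost
   everywhere. *)
pose S x : \bar R := (\sum_(k <oo) (2 ^+ k * (dg k x) ^+ 2)%:E)%E.
have mS : measurable_fun D S.
  apply: ge0_emeasurable_sum => [k x Dx _|k _].
    by rewrite lee_fin mulr_ge0 ?sqr_ge0 ?exprn_ge0.
  apply/measurable_EFinP; apply: measurable_funM => //.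
  by apply: measurable_funX; exact: (dgi k).1.
have iS : (\int[mu]_(x in D) S x < +oo)%E.
  rewrite integral_nneseries//; last 2 first.
  - move=> k; apply/measurable_EFinP; apply: measurable_funM => //.
    by apply: measurable_funX; exact: (dgi k).1.
  - by move=> k x _; rewrite lee_fin mulr_ge0 ?sqr_ge0 ?exprn_ge0.
  apply: (@le_lt_trans _ _ (\sum_(k <oo) ((2^-1) ^+ k)%:E)%E).
    apply: lee_nneseries => k _.
      by move=> _; apply: integral_ge0 => x _; rewrite lee_fin mulr_ge0 ?sqr_ge0 ?exprn_ge0.
    under eq_integral do rewrite EFinM.
    rewrite ge0_integralZl_EFin ?exprn_ge0//; last 2 first.
    - by move=> x _; rewrite lee_fin sqr_ge0.
    - by apply/measurable_EFinP; apply: measurable_funX; exact: (dgi k).1.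
    have -> : (\int[mu]_(x in D) (dg k x ^+ 2)%:E)%E = (ip (dg k) (dg k))%:E.
      by rewrite -ipE//; apply: eq_integral => x _; rewrite expr2.
    rewrite -EFinM lee_fin.
    have -> : (2^-1 : R) ^+ k = 2 ^+ k * e k.
      by rewrite /e -exprMn; congr (_ ^+ _); field.
    rewrite ler_wpM2l ?exprn_ge0//; apply/ltW/NP => //.
    by rewrite (leq_trans (NM k)).
  have /cvg_lim : (fun n => \sum_(0 <= k < n) ((2^-1 : R) ^+ k)%:E)%E @ \oo --> (2%:E : \bar R).
    have -> : (fun n => \sum_(0 <= k < n) ((2^-1 : R) ^+ k)%:E)%E =
      EFin \o series (geometric 1 (2^-1 : R)).
      apply/funext => n /=; rewrite /series/= sumEFin; congr EFin.
      by apply: eq_bigr => i _; rewrite mul1r.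
    apply: cvg_EFin; first by exists 0%N.
    have := @cvg_geometric_series R 1 (2^-1).
    have -> : 1 / (1 - 2^-1) = 2 :> R by field.
    by apply; rewrite ger0_norm ?invr_ge0// invf_lt1// ltr1n.
  by move=> -> //; rewrite ltry.
pose A := D `&` [set x | (S x < +oo)%E].
have mA : measurable A by exact: emeasurable_fun_infty_o.
have S0 x : (0 <= S x)%E.
  by apply: nneseries_ge0 => k _ _; rewrite lee_fin mulr_ge0 ?sqr_ge0 ?exprn_ge0.
have gcvg x : (S x < +oo)%E -> cvgn (g ^~ x).
  move=> Sx.
  have -> : g ^~ x = (fun n => g 0%N x + series (dg ^~ x) n).
    by apply/funext => n; rewrite /series/= telescope_sumr// addrC subrK.
  apply: is_cvgD; first exact: is_cvg_cst.
  apply: normed_cvg.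
  have Sx1 : cvgn (series (fun k => 2 ^+ k * dg k x ^+ 2)).
    apply: nondecreasing_is_cvgn.
      by apply/nondecreasing_series => k _ _; rewrite mulr_ge0 ?sqr_ge0 ?exprn_ge0.
    exists (fine (S x)) => _ [n _ <-].
    rewrite -lee_fin fineK ?ge0_fin_numE//.
    rewrite /series/= -sumEFin.
    apply: (@nneseries_lim_ge R (fun k => (2 ^+ k * dg k x ^+ 2)%:E) xpredT) => k _ _.
    by rewrite lee_fin mulr_ge0 ?sqr_ge0 ?exprn_ge0.
  apply: (@series_le_cvg _ _ (fun k => (2^-1) ^+ k + 2 ^+ k * dg k x ^+ 2)).
  - by move=> k; rewrite normr_ge0.
  - move=> k; apply: addr_ge0; first by rewrite exprn_ge0 ?invr_ge0.
    by rewrite mulr_ge0 ?sqr_ge0 ?exprn_ge0.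
  - move=> k /=.
    have p0 : 0 < 2 ^+ k :> R by rewrite exprn_gt0.
    rewrite -[dg k x ^+ 2](real_normK (num_real _)) exprVn.
    have := normr_ge0 (dg k x); move: p0; move: (2 ^+ k) `|dg k x| => b a b0 a0.
    have : 0 <= (1 - b * a) ^+ 2 / b by rewrite mulr_ge0 ?sqr_ge0 ?invr_ge0 ?ltW.
    have -> : (1 - b * a) ^+ 2 / b = b^-1 - 2 * a + b * a ^+ 2.
      by field; rewrite gt_eqF.
    by lra.
  have -> : series (fun k => (2^-1) ^+ k + 2 ^+ k * dg k x ^+ 2) =
    series (geometric 1 (2^-1 : R)) \+ series (fun k => 2 ^+ k * dg k x ^+ 2).
    apply/funext => n; rewrite /series/= -big_split/=.
    by apply: eq_bigr => i _; rewrite mul1r.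
  apply: is_cvgD => //.
  by apply: is_cvg_geometric_series; rewrite ger0_norm ?invr_ge0// invf_lt1// ltr1n.
(* Putting 0 where S is infinite makes the sequence converge everywhere on D, so that its limit is
   measurable. *)
pose h k x := if (S x < +oo)%E then g k x else 0.
pose w x := limn (h ^~ x).
have hw x : D x -> h ^~ x @ \oo --> w x.
  move=> Dx; rewrite /w /h; case: (boolP (S x < +oo)%E) => Sx; last exact: is_cvg_cst.
  exact: gcvg.
have mh k : measurable_fun D (h k).
  have -> : h k = (fun x => if (S x < +oo)%E then g k x else cst 0 x) by [].
  apply: measurable_fun_if => //=.
  - exact: measurable_fun_lte.
  - apply: measurable_funS (gi k).1 => //.
have mw : measurable_fun D w by exact: (measurable_fun_cvg mh hw).
have aeA : {ae mu, forall x, D x -> (S x < +oo)%E}.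
  have := @integrable_ae _ _ _ mu D mD S.
  have Si : mu.-integrable D S.
    apply/integrableP; split=> //.
    by under eq_integral do rewrite gee0_abs//.
  move=> /(_ Si); apply: filterS => x H Dx.
  by have := H Dx; rewrite ge0_fin_numE.
(* Fatou along the subsequence: the squared norm of f n - g k is below 4^-K as soon as k is at least
   K. *)
have key K n : (N K <= n)%N ->
    (\int[mu]_(x in D) ((f n x - w x) ^+ 2)%:E <= (e K)%:E)%E.
  move=> Kn.
  have mfh k : measurable_fun D (EFin \o (fun x => (f n x - h k x) ^+ 2)).
    by apply/measurable_EFinP/measurable_funX/measurable_funB => //; exact: (fi n).1.
  have <- : (\int[mu]_(x in D)
      limn_einf (fun k => ((f n x - h k x) ^+ 2)%:E) =
      \int[mu]_(x in D) ((f n x - w x) ^+ 2)%:E)%E.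
    apply: eq_integral => x; rewrite inE => Dx.
    have : (fun k => ((f n x - h k x) ^+ 2)%:E) @ \oo --> ((f n x - w x) ^+ 2)%:E.
      apply: cvg_EFin; first by exists 0%N.
      under eq_fun do rewrite expr2.
      by rewrite expr2; apply: cvgM; apply: cvgB; (try exact: cvg_cst); exact: hw.
    move=> C; rewrite is_cvg_limn_einfE; last by apply/cvg_ex; eexists; exact: C.
    exact/cvg_lim.
  apply: (le_trans (fatou mu mD mfh _)).
    by move=> k x _ /=; rewrite lee_fin sqr_ge0.
  rewrite limn_einf_lim; apply: lime_le; first exact: is_cvg_einfs.
  near=> k.
  apply: (@le_trans _ _ (\int[mu]_(x in D) (((f n x - h k x) ^+ 2)%:E))%E).
    by apply: ereal_inf_lbound; exists k => /=.
  have -> : (\int[mu]_(x in D) (((f n x - h k x) ^+ 2)%:E))%E =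
            (\int[mu]_(x in D) (((f n x - g k x) * (f n x - g k x))%:E))%E.
    apply: ae_eq_integral => //.
    - exact: mfh.
    - apply/measurable_EFinP; apply: measurable_funM; apply: measurable_funB;
        by [exact: (fi n).1|exact: (gi k).1].
    - by apply: filterS aeA => x H Dx /=; rewrite /h H// expr2.
  rewrite ipE; [|exact: sq_intB..].
  rewrite lee_fin; apply/ltW/NP => //.
  by apply: NMge; near: k; exact: nbhs_infty_ge.
have wi : sq_int w.
  have : sq_int (fun x => f (N 0%N) x - w x).
    apply: sq_intP; first by apply: measurable_funB => //; exact: (fi _).1.
    by apply: (le_lt_trans (key 0%N _ _)) => //; rewrite ltry.
  move=> /(sq_intB (fi (N 0%N))); apply: eq_sq_int => x _; lra.
exists w => // eps eps0.
have [K Ke] : exists K, e K <= eps.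
  have : geometric 1 (4^-1 : R) @ \oo --> (0:R).
    by apply: cvg_geometric; rewrite ger0_norm ?invr_ge0// invf_lt1// ltr1n.
  move=> /cvgrPdist_le/(_ _ eps0)[K _ /(_ K (leqnn K))]/=.
  by rewrite sub0r normrN mul1r ger0_norm ?exprn_ge0 ?invr_ge0// => H; exists K.
exists (N K) => n Kn; apply: le_trans Ke.
have := key K n Kn; under eq_integral do rewrite expr2.
by rewrite ipE ?lee_fin//; exact: sq_intB.
Unshelve. all: by end_near. Qed.

End SquareIntegrable.

(** * A smooth step function *)

Section SmoothStep.
Context {R : realType}.
Implicit Types (f g : R -> R) (n : nat) (p : {poly R}).

(** Each of the n successive derivatives is supplied as a function, so that closure under products,
    inverses and affine substitution is an induction in which no higher derivative is written
    down. *)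
Fixpoint Cn n f : Prop :=
  if n is m.+1 then exists2 f' : R -> R, (forall x : R, is_derive x 1 f (f' x)) & Cn m f'
  else True.

Lemma CnS n f : Cn n.+1 f -> Cn n f.
Proof.
elim: n f => [//|n IH] f [f' ff' Cf']; exists f' => //; exact: IH.
Qed.

Lemma CnD n f g : Cn n f -> Cn n g -> Cn n (fun x => f x + g x).
Proof.
elim: n f g => [//|n IH] f g [f' ff' Cf'] [g' gg' Cg'].
exists (fun x => f' x + g' x); last exact: IH.
by move=> x; have := is_deriveD (ff' x) (gg' x).
Qed.

Lemma CnM n f g : Cn n f -> Cn n g -> Cn n (fun x => f x * g x).
Proof.
elim: n f g => [//|n IH] f g Cf Cg.
case: (Cf) (Cg) => [f' ff' Cf'] [g' gg' Cg'].
exists (fun x => f x * g' x + g x * f' x).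
  by move=> x; have := is_deriveM (ff' x) (gg' x).
by apply: CnD; apply: IH => //; exact: CnS.
Qed.

Lemma Cn_cst n (a : R) : Cn n (fun=> a).
Proof.
elim: n a => [//|n IH] a; exists (fun=> 0) => // x.
exact: is_derive_cst.
Qed.

Lemma Cn_affine n f (a b : R) : Cn n f -> Cn n (fun x => f (a * x + b)).
Proof.
elim: n f => [//|n IH] f [f' ff' Cf'].
exists (fun x => a * f' (a * x + b)); last first.
  by apply: CnM; [exact: Cn_cst|exact: IH].
move=> x.
have dg : is_derive x 1 (fun x => a * x + b) a.
  have : is_derive x 1 (fun x => a *: (x : R) + b) (a *: 1 + 0) by exact: is_deriveD.
  by rewrite addr0 /GRing.scale/= mulr1.
have H := @is_derive1_comp _ f (fun x => a * x + b) x _ _ (ff' _) dg.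
by apply: (is_derive_eq H); rewrite mulrC.
Qed.

Lemma CnV n f : (forall x, f x != 0) -> Cn n f -> Cn n (fun x => (f x)^-1).
Proof.
move=> f0; elim: n => [//|n IH] Cf; case: (Cf) => [f' ff' Cf'].
exists (fun x => (- 1 * f' x) * ((f x)^-1 * (f x)^-1)).
  move=> x; apply: (is_derive_eq (is_deriveV (f0 x) (ff' x))).
  by rewrite /GRing.scale/= -exprVn; ring.
apply: CnM; first by apply: CnM => //; exact: Cn_cst.
by apply: CnM; apply: IH; exact: CnS.
Qed.

Lemma Cn_derivable f : (forall n, Cn n f) -> forall n x, derivable (derive1n n f) x 1.
Proof.
move=> Cf n; have {Cf} := Cf n.+1.
elim: n f => [|n IH] f [f' ff' Cf'] x; first exact: ex_derive.
have -> : derive1n n.+1 f = derive1n n (f^`())%classic by rewrite /derive1n iterSr.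
have -> : (f^`())%classic = f'; last exact: IH.
by apply/funext => y; rewrite derive1E; apply: derive_val.
Qed.

Lemma expRN_le_pow n (s : R) : 0 < s -> s ^+ n * expR (- s) <= n.+1`!%:R.
Proof.
move=> s0; rewrite expRN ler_pdivrMr ?expR_gt0//.
case: n => [|n]; first by rewrite expr0 mul1r ltW// expR_gt1.
have := expR_ge1Dxn n (ltW s0) => H.
have F0 : 0 < n.+1`!%:R :> R by rewrite ltr0n fact_gt0.
have H1 : s ^+ n.+1 <= n.+1`!%:R * expR s.
  by rewrite -ler_pdivrMl// mulrC; apply: le_trans H; rewrite lerDr.
apply: (le_trans H1); rewrite ler_wpM2r ?expR_ge0// ler_nat.
by rewrite [leqRHS]factS leq_pmull.
Qed.

(** The polynomial factor makes the family stable under differentiation: p becomes X^2 (p - p'). The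
    case p = 1 is the classical flat function exp (-1/t). *)
Definition flat p (t : R) : R := if 0 < t then p.[t^-1] * expR (- t^-1) else 0.

Lemma flat_le0 p t : t <= 0 -> flat p t = 0.
Proof. by rewrite /flat ltNge => ->. Qed.

(** With s = 1/t, the monomial s^i gains the factor t^2 from the bound on s^(i+2) exp (-s). A
    quadratic bound is what differentiability at 0 requires. *)
Lemma flat_bound p : exists C : R, forall t, `|flat p t| <= C * t ^+ 2.
Proof.
exists (\sum_(i < size p) `|p`_i| * (i.+2.+1)`!%:R) => t.
have [t0|t0] := leP t 0.
  rewrite flat_le0// normr0 mulr_ge0 ?sqr_ge0//; apply: sumr_ge0 => i _.
  by rewrite mulr_ge0.
rewrite /flat t0 horner_coef normrM (ger0_norm (expR_ge0 _)).
apply: (@le_trans _ _ (\sum_(i < size p) `|p`_i| * (t^-1 ^+ i * expR (- t^-1)))).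
  rewrite (le_trans (ler_wpM2r (expR_ge0 _) (ler_norm_sum _ _ _)))//.
  rewrite mulr_suml ler_sum// => i _.
  by rewrite normrM normrX (@gtr0_norm _ t^-1) ?invr_gt0// mulrA.
rewrite mulr_suml ler_sum// => i _; rewrite -mulrA ler_wpM2l//.
have := @expRN_le_pow i.+2 t^-1; rewrite invr_gt0 => /(_ t0).
rewrite -addn2 exprD -ler_pdivrMr ?exprn_gt0//.
by rewrite (exprVn t 2) mulrAC.
Qed.

Lemma is_derive_flat p (x : R) :
  is_derive x 1 (flat p) (flat ('X^2 * (p - p^`())) x).
Proof.
have [x0|x0|->] := ltrgtP x 0.
- rewrite flat_le0 ?ltW//; apply: (@near_eq_is_derive _ _ _ (cst (0 : R))).
    near=> y; rewrite /= flat_le0//; near: y.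
    by apply: filterS (lt_nbhsl x0) => y /ltW.
- have -> : flat ('X^2 * (p - p^`())) x = ('X^2 * (p - p^`())).[x^-1] * expR (- x^-1).
    by rewrite /flat x0.
  have near_pos : \forall y \near x, 0 < y :> R by exact: lt_nbhsr.
  apply: (@near_eq_is_derive R R R (fun y => p.[y^-1] * expR (- y^-1))).
    by apply: filterS near_pos => y y0 /=; rewrite /flat y0.
  have dV : is_derive x 1 (fun y => y^-1) (- x ^- 2).
    have := @is_deriveV _ id x 1 1.
    by rewrite gt_eqF// /GRing.scale/= mulr1; apply => //; exact: is_derive_id.
  have dp : is_derive x 1 (fun y => p.[y^-1]) ((p^`()).[x^-1] * (- x ^- 2)).
    have H := @is_derive_poly _ p x^-1.
    by apply: (is_derive_eq (@is_derive1_comp _ (horner p) (fun y => y^-1) x _ _ H dV)).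
  have dN : is_derive x 1 (fun y => - y^-1) (x ^- 2).
    by have := is_deriveN dV; rewrite opprK.
  have de : is_derive x 1 (fun y => expR (- y^-1)) (x ^- 2 * expR (- x^-1)).
    have H := @is_derive1_comp _ expR (fun y => - y^-1) x _ _ (is_derive_expR _) dN.
    by apply: (is_derive_eq H); rewrite mulrC.
  have := is_deriveM dp de.
  rewrite /GRing.scale/= => /is_derive_eq; apply.
  by rewrite hornerM hornerXn hornerD hornerN exprVn; ring.
- have [C flatC] := flat_bound p.
  rewrite (@flat_le0 _ 0)//.
  (* The quotient is at most C |t|, hence continuous at 0, where it takes the value 0 because 0^-1 =
     0. *)
  apply/is_derive1_caratheodory; exists (fun t => flat p t / t); split.
  + move=> z; rewrite (@flat_le0 _ 0)// !subr0.
    have [->|z0] := eqVneq z 0; first by rewrite flat_le0// !mul0r.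
    by rewrite divfK.
  + apply/cvgrPdist_le => e e0; rewrite (@flat_le0 _ 0)// mul0r.
    have C0 : 0 <= C.
      by have := flatC 1; rewrite expr1n mulr1; apply: le_trans.
    have N : \forall t \near (0 : R), `|t| <= e / (C + 1).
      apply/nbhs_normP; exists (e / (C + 1)) => /=.
        by rewrite divr_gt0// ltr_wpDl.
      by move=> t /=; rewrite sub0r normrN => /ltW.
    near=> t; rewrite sub0r normrN.
    have [->|t0] := eqVneq t 0; first by rewrite flat_le0// mul0r normr0 ltW.
    rewrite normrM normfV ler_pdivrMr ?normr_gt0//.
    apply: (le_trans (flatC t)).
    rewrite -(real_normK (num_real t)) expr2 mulrA ler_wpM2r//.
    rewrite (@le_trans _ _ ((C + 1) * `|t|))//; first by rewrite ler_wpM2r// lerDl.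
    rewrite mulrC -ler_pdivlMr ?ltr_wpDl//.
    by near: t; exact: N.
  + by rewrite invr0 mulr0.
Unshelve. all: by end_near. Qed.

Lemma Cn_flat n p : Cn n (flat p).
Proof.
elim: n p => [//|n IH] p; exists (flat ('X^2 * (p - p^`()))) => //.
exact: is_derive_flat.
Qed.

Lemma flat1_gt0 t : 0 < t -> 0 < flat 1 t.
Proof. by rewrite /flat => ->; rewrite hornerC mul1r expR_gt0. Qed.

Lemma flat1_ge0 t : 0 <= flat 1 t.
Proof.
by have [/flat_le0->//|/flat1_gt0/ltW] := leP t 0.
Qed.

Definition step (t : R) : R := flat 1 t / (flat 1 t + flat 1 (1 - t)).

Let den_gt0 t : 0 < flat 1 t + flat 1 (1 - t).
Proof.
have [t0|t0] := leP t 0; last by rewrite ltr_pwDl ?flat1_gt0 ?flat1_ge0.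
by rewrite ltr_wpDl ?flat1_gt0 ?flat1_ge0// subr_gt0 (le_lt_trans t0).
Qed.

Lemma Cn_step n : Cn n step.
Proof.
apply: CnM; first exact: Cn_flat.
apply: CnV; first by move=> x; rewrite gt_eqF.
apply: CnD; first exact: Cn_flat.
have -> : (fun x => flat 1 (1 - x)) = (fun x => flat 1 (-1 * x + 1)).
  by apply/funext => x; rewrite mulN1r addrC.
by apply: Cn_affine; exact: Cn_flat.
Qed.

Lemma step0 t : t <= 0 -> step t = 0.
Proof. by move=> t0; rewrite /step flat_le0// mul0r. Qed.

Lemma step1 t : 1 <= t -> step t = 1.
Proof.
move=> t1; rewrite /step [flat _ (1 - t)]flat_le0 ?subr_le0// addr0 divff//.
by rewrite gt_eqF// flat1_gt0// (lt_le_trans _ t1).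
Qed.

Lemma step_itv t : 0 <= step t <= 1.
Proof.
rewrite /step divr_ge0 ?flat1_ge0//=; last exact: ltW.
by rewrite ler_pdivrMr// mul1r lerDl flat1_ge0.
Qed.

(** The derivative is bounded on [0, 1] by continuity and vanishes outside, where [step] is locally
    constant; adding 1 makes the bound positive. *)
Lemma step_deriv : exists2 ds : R -> R, (forall x : R, is_derive x 1 step (ds x)) &
  continuous ds /\ exists2 M, 0 < M & forall x, `|ds x| <= M.
Proof.
have [ds dsP [dds ddsP _]] := Cn_step 2; exists ds => //.
have cds : continuous ds.
  move=> x; apply/differentiable_continuous/derivable1_diffP.
  exact: ex_derive.
split=> //.
have cN : {within `[0, 1 : R], continuous (fun x => `|ds x|)}.
  apply: continuous_subspaceT => x; apply: continuous_comp; first exact: cds.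
  exact: norm_continuous.
have [c _ cP] := EVT_max ler01 cN.
exists (`|ds c| + 1); first by rewrite ltr_wpDl.
move=> x; have [x0|x0] := ltP x 0.
  have -> : ds x = 0.
    have <- := @derive_val _ _ _ _ _ _ _ (dsP x).
    rewrite (@near_eq_derive _ _ _ _ (cst (0 : R))) ?derive_cst//.
    by apply: filterS (lt_nbhsl x0) => y /ltW/step0.
  by rewrite normr0 addr_ge0.
have [x1|x1] := ltP 1 x.
  have -> : ds x = 0.
    have <- := @derive_val _ _ _ _ _ _ _ (dsP x).
    rewrite (@near_eq_derive _ _ _ _ (cst (1 : R))) ?derive_cst//.
    by apply: filterS (lt_nbhsr x1) => y /ltW/step1.
  by rewrite normr0 addr_ge0.
by rewrite (le_trans (cP x _)) ?in_itv/= ?x0// lerDl.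
Qed.

End SmoothStep.

(** * Weak derivatives on an interval *)

Section BoundedMeasurable.
Context d (T : measurableType d) (R : realType).
Variables (mu : {measure set T -> \bar R}) (D : set T) (mD : measurable D).
Hypothesis finD : (mu D < +oo)%E.
Implicit Types f g : T -> R.

Lemma integrable_bounded f (M : R) : measurable_fun D f ->
  (forall x, D x -> `|f x| <= M) -> mu.-integrable D (EFin \o f).
Proof.
move=> mf fM; apply: (@le_integrable _ _ _ mu D mD _ (cst (`|M|)%:E)).
- exact/measurable_EFinP.
- move=> x Dx /=; rewrite lee_fin normr_id.
  by rewrite (le_trans (fM x Dx))// ler_norm.
- apply/integrableP; split; first exact: measurable_cst.
  by rewrite integral_cst//= normr_id lte_mul_pinfty ?lee_fin.
Qed.

Lemma sq_int_bounded f (M : R) : measurable_fun D f ->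
  (forall x, D x -> `|f x| <= M) -> sq_int mu D f.
Proof.
move=> mf fM; split=> //; apply: (@integrable_bounded _ (M ^+ 2)).
  exact: measurable_funX.
by move=> x Dx; rewrite normrX lerXn2r ?nnegrE ?(le_trans _ (fM x Dx))//.
Qed.

Lemma sq_int_cst (a : R) : sq_int mu D (cst a).
Proof. by apply: (@sq_int_bounded _ `|a|). Qed.

Lemma sq_int_integrable f : sq_int mu D f -> mu.-integrable D (EFin \o f).
Proof.
move=> fi; have := sq_int_mul mD fi (sq_int_cst 1).
by apply: eq_integrable => // x _ /=; rewrite mulr1.
Qed.

End BoundedMeasurable.

Lemma sq_int_subset d (T : measurableType d) (R : realType)
    (mu : {measure set T -> \bar R}) (A B : set T) (f : T -> R) :
  measurable A -> measurable B -> A `<=` B -> sq_int mu B f -> sq_int mu A f.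
Proof.
move=> mA mB AB [mf fi]; split; first exact: measurable_funS mf.
exact: integrableS fi.
Qed.

Section WeakDerivative.
Context {R : realType}.
Local Notation leb := (@lebesgue_measure R).
Implicit Types (u v f F : R -> R) (a b l x y z c e d t : R).

Let mI a b : measurable (`]a, b[%classic : set (measurableTypeR R)).
Proof. exact: measurable_itv. Qed.

Lemma lebesgue_itvoo_lty a b : (leb `]a, b[%classic < +oo)%E.
Proof. by rewrite lebesgue_measure_itv; case: ifP => // _; rewrite -EFinB ltry. Qed.

Lemma L2_interval_sq_int l u : L2_interval l u -> sq_int leb `]0, l[ u.
Proof. by move=> [mu ui]; apply: sq_intP. Qed.

Lemma sq_int_continuous a b f : continuous f -> sq_int leb `]a, b[ f.
Proof.
move=> cf; split.
  apply: measurable_funTS; exact: continuous_measurable_fun.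
apply: (@integrableS _ _ _ leb `[a, b]) => //.
  exact: subset_itv_oo_cc.
apply: continuous_compact_integrable; first exact: segment_compact.
apply: continuous_subspaceT => x.
by rewrite /=; under eq_fun do rewrite expr2; apply: continuousM; exact: cf.
Qed.

Lemma Rintegral_derive F f a b : a <= b -> (forall x : R, is_derive x 1 F (f x)) ->
  continuous f -> \int[leb]_(x in `]a, b[) f x = F b - F a.
Proof.
rewrite le_eqVlt => /predU1P[->|ab] dF cf.
  by rewrite set_itvoo0 Rintegral_set0 subrr.
have cF : continuous F.
  by move=> x; apply/differentiable_continuous/derivable1_diffP; exact: ex_derive.
have := @continuous_FTC2 R f F a b ab.
rewrite /Rintegral => H.
rewrite -(@integral_itv_bndoo _ a b _ true false); last first.
  apply/measurable_EFinP/measurable_funTS; exact: continuous_measurable_fun.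
rewrite H//.
- exact: continuous_subspaceT.
- split.
  + by move=> x _; exact: ex_derive.
  + by apply: cvg_at_right_filter; exact: cF.
  + by apply: cvg_at_left_filter; exact: cF.
- by move=> x _; rewrite derive1E; apply: derive_val.
Qed.

Lemma Rintegral_oo_cst a b (c : R) : a <= b ->
  \int[leb]_(x in `]a, b[) (cst c) x = c * (b - a).
Proof.
move=> ab; rewrite Rintegral_cst//; congr (_ * _).
have := @lebesgue_measure_itv R `]a, b[; rewrite /= lte_fin => ->.
have [ab'|] := ltP a b; first by rewrite -EFinB.
by move=> ba; have -> : a = b by [apply: le_anti; rewrite ab ba]; rewrite subrr.
Qed.

(** * Mollification against the derivative of a steep step *)

Section Bump.
Variables (ds : R -> R) (M : R).
Hypotheses (dsP : forall x : R, is_derive x 1 step (ds x)) (cds : continuous ds).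
Hypotheses (M0 : 0 < M) (dsM : forall x, `|ds x| <= M).

(** The step rescaled to rise on [c, c + e]; its derivative [bump c e] approximates a unit mass just
    to the right of c. The argument is (x - c) / e, written in the shape that [Cn_affine]
    handles. *)
Let ramp (c e x : R) := step (e^-1 * x + - (c / e)).
Let bump (c e x : R) := e^-1 * ds (e^-1 * x + - (c / e)).

Let rampE c e x : e^-1 * x + - (c / e) = (x - c) / e.
Proof. by rewrite mulrBl mulrC. Qed.

Let ramp0 c e x : 0 < e -> x <= c -> ramp c e x = 0.
Proof.
move=> e0 xc; rewrite /ramp rampE step0// -oppr_ge0 -mulNr opprB.
by rewrite divr_ge0 ?subr_ge0// ltW.
Qed.

Let ramp1 c e x : 0 < e -> c + e <= x -> ramp c e x = 1.
Proof.
move=> e0 xc; rewrite /ramp rampE step1// ler_pdivlMr// mul1r.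
by rewrite lerBrDr addrC.
Qed.

Let ds0 x : ~~ (0 <= x <= 1) -> ds x = 0.
Proof.
rewrite negb_and -!ltNge => /orP[x0|x1].
  have <- := @derive_val _ _ _ _ _ _ _ (dsP x).
  rewrite (@near_eq_derive _ _ _ _ (cst (0 : R))) ?derive_cst//.
  by apply: filterS (lt_nbhsl x0) => y /ltW/step0.
have <- := @derive_val _ _ _ _ _ _ _ (dsP x).
rewrite (@near_eq_derive _ _ _ _ (cst (1 : R))) ?derive_cst//.
by apply: filterS (lt_nbhsr x1) => y /ltW/step1.
Qed.

Let is_derive_ramp c e x : is_derive x 1 (ramp c e) (bump c e x).
Proof.
rewrite /ramp /bump.
have dg : is_derive x 1 (fun x => e^-1 * x + - (c / e)) e^-1.
  have : is_derive x 1 (fun x => e^-1 *: (x : R) + - (c / e)) (e^-1 *: 1 + 0)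
    by exact: is_deriveD.
  by rewrite addr0 /GRing.scale/= mulr1.
have H := @is_derive1_comp _ step (fun x => e^-1 * x + - (c / e)) x _ _ (dsP _) dg.
by apply: (is_derive_eq H); rewrite mulrC.
Qed.

Let continuous_bump c e : continuous (bump c e).
Proof.
move=> x; apply: (@continuousM _ _ (cst e^-1)); first exact: cst_continuous.
apply: (@continuous_comp _ _ _ (fun x => e^-1 * x + - (c / e)) ds); last exact: cds.
apply: continuousD; last exact: cst_continuous.
by apply: continuousM => //; exact: cst_continuous.
Qed.

Let bump_out c e x : 0 < e -> ~~ (c <= x <= c + e) -> bump c e x = 0.
Proof.
move=> e0 xc; rewrite /bump rampE ds0 ?mulr0//.
apply: contra xc; rewrite pmulr_lge0 ?invr_gt0// subr_ge0 => /andP[->].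
by rewrite ler_pdivrMr// mul1r lerBlDr addrC.
Qed.

Let bump_norm c e x : 0 < e -> `|bump c e x| <= M / e.
Proof.
by move=> e0; rewrite normrM gtr0_norm ?invr_gt0// mulrC ler_wpM2r// invr_ge0 ltW.
Qed.

(** As [bump c e] has integral 1, the difference is the integral of (u - u c) [bump c e]. For small
    e the three factors are d / M for the oscillation of u, M / e for the bump and e for the length
    of its support. *)
Let mollify u l c : sq_int leb `]0, l[ u -> 0 < c < l -> {for c, continuous u} ->
  forall d, 0 < d -> exists2 e0, 0 < e0 & forall e, 0 < e -> e < e0 ->
  `|\int[leb]_(x in `]0, l[) (u x * bump c e x) - u c| <= d.
Proof.
move=> ui /andP[c0 cl] cu d d0.
have dM0 : 0 < d / M by rewrite divr_gt0.
move/cvgrPdist_le : (cu) => /(_ _ dM0)/nbhs_normP[e1 /= e10 e1P].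
exists (Num.min e1 (l - c)); first by rewrite lt_min e10 subr_gt0.
move=> e e0; rewrite lt_min => /andP[ee1]; rewrite ltrBrDl => cel.
have bi : sq_int leb `]0, l[ (bump c e) by exact: sq_int_continuous.
have ubi := sq_int_mul (mI 0 l) ui bi.
have l0 : 0 <= l by rewrite ltW// (lt_trans c0).
have b1 : \int[leb]_(x in `]0, l[) bump c e x = 1.
  rewrite (@Rintegral_derive (ramp c e) (bump c e) 0 l l0 (@is_derive_ramp c e) (@continuous_bump c e)).
  by rewrite ramp1 1?ltW// ramp0 1?ltW// subr0.
have fin := lebesgue_itvoo_lty 0 l.
have ci := sq_int_cst (mI 0 l) fin (u c).
have dbi := sq_int_mul (mI 0 l) (sq_intB (mI 0 l) ui ci) bi.
have -> : \int[leb]_(x in `]0, l[) (u x * bump c e x) - u c =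
          \int[leb]_(x in `]0, l[) ((u x - cst (u c) x) * bump c e x).
  rewrite -[X in _ - X]mulr1 -b1 -RintegralZl//; last first.
    exact: (sq_int_integrable (mI 0 l) fin bi).
  rewrite -RintegralB//; last first.
    exact: (integrableZl (mI 0 l) (u c) (sq_int_integrable (mI 0 l) fin bi)).
  by apply: eq_Rintegral => x _; rewrite mulrBl.
apply: (le_trans (le_normr_Rintegral (mI 0 l) dbi)) => {ubi}.
have PD : `]0, l[ `&` `[c, c + e] = `[c, c + e]%classic :> set R.
  apply/setIidr => x /=; rewrite !in_itv/= => /andP[cx xce].
  by rewrite (lt_le_trans c0)//= (le_lt_trans xce).
have -> : d = \int[leb]_(x in `]0, l[) ((cst (d / e)) \_ `[c, c + e]) x.
  rewrite -Rintegral_mkcondr PD Rintegral_cst//.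
  have := @lebesgue_measure_itv R `[c, c + e]; rewrite /= lte_fin ltrDl e0 => ->.
  by rewrite -EFinB /= (addrC c) addrK divfK// gt_eqF.
apply: le_Rintegral => //.
- have := integrable_norm dbi; exact.
- rewrite -restrict_EFin; apply/integrable_restrict => //; rewrite PD.
  by apply: continuous_compact_integrable; [exact: segment_compact|exact: cst_continuous].
- move=> x _; rewrite patchE; case: ifPn => [|xP].
    rewrite inE/= in_itv/= => /andP[cx xce].
    have -> : d / e = (d / M) * (M / e) by rewrite mulrA divfK// gt_eqF.
    rewrite normrM.
    apply: ler_pM => //; last exact: bump_norm.
    rewrite distrC; apply: e1P => /=.
    rewrite distrC ger0_norm ?subr_ge0//.
    by rewrite (le_lt_trans _ ee1)// lerBlDl.
  rewrite bump_out ?mulr0 ?normr0//.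
  by apply: contra xP; rewrite inE/= in_itv.
Qed.

Let dist_le_approx (A B C I a b d : R) : `|A - a| <= d / 2 -> `|B - b| <= d / 2 ->
  `|C| <= I -> A - B = - C -> `|b - a| <= I + d.
Proof.
rewrite !ler_norml => /andP[? ?] /andP[? ?] /andP[? ?] ?.
by apply/andP; split; lra.
Qed.

(** The test function is [ramp x e] minus [ramp y e]. Pairing u with its derivative approximates u x
    - u y, while pairing v with it costs at most the integral of |v| over ]x, z[, since it is
    bounded by 1 and vanishes elsewhere. *)
Lemma weak_derivative_osc_subproof u v l x y z : H1_interval l u v ->
  0 < x -> x < y -> y < z -> z < l -> {for x, continuous u} -> {for y, continuous u} ->
  `|u y - u x| <= \int[leb]_(t in `]x, z[) `|v t|.
Proof.
move=> [/L2_interval_sq_int ui /L2_interval_sq_int vi uv] x0 xy yz zl cx cy.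
have l0 : 0 < l by lra.
have fin := lebesgue_itvoo_lty 0 l.
apply/ler_addgt0Pr => d d0.
have d20 : 0 < d / 2 by rewrite divr_gt0.
have xl : 0 < x < l by apply/andP; split; lra.
have yl : 0 < y < l by apply/andP; split; lra.
have [e1 e10 e1P] := mollify ui xl cx d20.
have [e2 e20 e2P] := mollify ui yl cy d20.
(* The bound by z - y makes the second ramp reach 1 before z, so that the two cancel from z on. *)
pose e := Num.min (Num.min e1 e2) (z - y) / 2.
have m0 : 0 < Num.min (Num.min e1 e2) (z - y) by rewrite !lt_min e10 e20 subr_gt0.
have e0 : 0 < e by rewrite divr_gt0.
have [ee1 ee2 eyz] : [/\ e < e1, e < e2 & e < z - y].
  have em : e < Num.min (Num.min e1 e2) (z - y) by rewrite /e; lra.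
  by move: em; rewrite !lt_min -andbA => /and3P[].
have {e1P}X := e1P e e0 ee1; have {e2P}Y := e2P e e0 ee2.
pose phi t := ramp x e t + -1 * ramp y e t.
have dphi t : is_derive t 1 phi (bump x e t + -1 * bump y e t).
  have H1 := is_derive_ramp x e t; have H2 := is_derive_ramp y e t.
  have -> : phi = (ramp x e - ramp y e)%R.
    by apply/funext => s; rewrite /phi mulN1r.
  by rewrite mulN1r; exact: is_deriveB.
have phi_out t : t \notin `]x, z[ -> phi t = 0.
  rewrite in_itv/= negb_and -!leNgt /phi => /orP[tx|zt].
    by rewrite !ramp0//; lra.
  by rewrite !ramp1//; lra.
have phi_le1 t : `|phi t| <= 1.
  rewrite /phi /ramp.
  have := step_itv (e^-1 * t + - (x / e)); have := step_itv (e^-1 * t + - (y / e)).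
  by move=> /andP[? ?] /andP[? ?]; rewrite ler_norml; apply/andP; split; lra.
have tphi : test_function l phi.
  split; last first.
    exists x, z; split=> // t; apply: contraNeq => /eqP H.
    have : t \in `]x, z[ by apply/negPn/negP => /phi_out.
    by rewrite in_itv/= => /andP[? ?]; apply/andP; split; exact: ltW.
  apply: Cn_derivable => n; apply: CnD; first exact/Cn_affine/Cn_step.
  by apply: CnM; [exact: Cn_cst|exact/Cn_affine/Cn_step].
have dphiE : (phi^`())%classic = (fun t => bump x e t + -1 * bump y e t).
  by apply/funext => t; rewrite derive1E; apply: derive_val.
have cphi : continuous phi.
  by move=> t; apply/differentiable_continuous/derivable1_diffP; exact: ex_derive.
have phii := sq_int_continuous 0 l cphi.
have bxi : sq_int leb `]0, l[ (bump x e) by apply: sq_int_continuous; exact: continuous_bump.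
have byi : sq_int leb `]0, l[ (bump y e) by apply: sq_int_continuous; exact: continuous_bump.
have := uv _ tphi; rewrite dphiE.
rewrite (ipE (mI 0 l) ui (sq_intD (mI 0 l) bxi (sq_intZ (mI 0 l) (-1) byi))).
rewrite (ipE (mI 0 l) vi phii) -EFinN => -[] H.
have {}H : ip leb `]0, l[ (bump x e) u - ip leb `]0, l[ (bump y e) u = - ip leb `]0, l[ v phi.
  rewrite -H [RHS]ipC; have := ip_linl (mI 0 l) 1 (-1) bxi byi ui.
  rewrite mul1r mulN1r => <-; apply: eq_ip => // t _.
  by rewrite mul1r.
rewrite ipC [X in _ - X]ipC in H.
have vphi : `|ip leb `]0, l[ v phi| <= \int[leb]_(t in `]x, z[) `|v t|.
  have vphii := sq_int_mul (mI 0 l) vi phii.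
  apply: (le_trans (le_normr_Rintegral (mI 0 l) vphii)).
  have PD : `]0, l[ `&` `]x, z[ = `]x, z[%classic :> set R.
    apply/setIidr => t /=; rewrite !in_itv/= => /andP[xt tz].
    by rewrite (lt_trans x0 xt) (lt_trans tz zl).
  rewrite -PD Rintegral_mkcondr; apply: le_Rintegral => //.
  - exact: (integrable_norm vphii).
  - rewrite -restrict_EFin; apply/integrable_restrict => //; rewrite PD.
    apply: (integrableS (mI 0 l)) => //; first by rewrite -PD; exact: subIsetl.
    have := sq_int_integrable (mI 0 l) fin vi.
    exact: integrable_norm.
  - move=> t _; rewrite patchE normrM; case: ifPn => [_|tP].
      by rewrite ler_piMr.
    by rewrite phi_out ?normr0 ?mulr0//; apply: contra tP; rewrite inE.
exact: (dist_le_approx X Y vphi H).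
Qed.

End Bump.

(* The inequality between the values at x and y only needs a smooth function
   that is 1 on [x + eps, y] and vanishes outside of ]x, z[. *)
Lemma weak_derivative_osc u v l x y z : H1_interval l u v ->
  0 < x -> x < y -> y < z -> z < l -> {for x, continuous u} -> {for y, continuous u} ->
  `|u y - u x| <= \int[leb]_(t in `]x, z[) `|v t|.
Proof.
have [ds dsP [cds [M M0 dsM]]] := @step_deriv R.
exact: (weak_derivative_osc_subproof dsP cds M0 dsM).
Qed.

End WeakDerivative.

(** * The measure of a metric graph *)

Lemma lebesgue_itvoo (R : realType) (a b : R) : a <= b ->
  (@lebesgue_measure R) `]a, b[%classic = (b - a)%:E.
Proof.
move=> ab; have := @lebesgue_measure_itv R `]a, b[; rewrite /= lte_fin => ->.
have [ab'|ba] := ltP a b; first by rewrite -EFinB.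
by have -> : a = b by [apply: le_anti; rewrite ab ba]; rewrite subrr.
Qed.

Lemma lebesgue_itvcc (R : realType) (a b : R) : a <= b ->
  (@lebesgue_measure R) `[a, b]%classic = (b - a)%:E.
Proof.
move=> ab; have := @lebesgue_measure_itv R `[a, b]; rewrite /= lte_fin => ->.
have [ab'|ba] := ltP a b; first by rewrite -EFinB.
by have -> : a = b by [apply: le_anti; rewrite ab ba]; rewrite subrr.
Qed.

(** Links sums over the edges with series over nat, for which termwise integration is available;
    numbers that code no edge contribute 0. *)
Lemma nneseries_pickle (R : realType) (E : countType) (F : E -> \bar R) :
  (forall e, 0 <= F e)%E ->
  (\sum_(n <oo) (if pickle_inv n is Some e then F e else 0) =
   \esum_(e in [set: E]) F e)%E.
Proof.
move=> F0; rewrite nneseries_esumT; last by move=> n; case: pickle_inv.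
transitivity (\esum_(n in range (@pickle E))
    (if pickle_inv n is Some e then F e else 0))%E.
  rewrite [RHS]esum_mkcond; apply: eq_esum => n _.
  case: ifPn => // /negP nr.
  case: (pickle_inv n) (@pickle_invK E n) => [e|//] en.
  by exfalso; apply: nr; rewrite inE; exists e.
rewrite esum_image; last by move=> x y _ _; exact: (pcan_inj (@pickleK _)).
by apply: eq_esum => e _; rewrite pickleK_inv.
Qed.

(** The indicator of A is at most the sum of those of the [J e], and a series of nonnegative
    functions is integrated termwise. In the applications [J e] contains the image of the edge e
    under a real function on the graph. *)
Lemma le_integral_cover d (T : measurableType d) (R : realType)
    (mu : {measure set T -> \bar R}) (E : countType) (A : set T) (J : E -> set T)
    (h : T -> \bar R) :
  measurable A -> (forall e, measurable (J e)) -> measurable_fun [set: T] h ->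
  (forall x, 0 <= h x)%E -> A `<=` \bigcup_e J e ->
  (\int[mu]_(x in A) h x <= \esum_(e in [set: E]) \int[mu]_(x in J e) h x)%E.
Proof.
move=> mA mJ mh h0 AJ.
pose hA (n : nat) := if pickle_inv n is Some e then h \_ (J e) else cst 0%E : T -> \bar R.
have hA0 n x : (0 <= hA n x)%E.
  by rewrite /hA; case: pickle_inv => // e; exact: erestrict_ge0.
have mhA n : measurable_fun [set: T] (hA n).
  rewrite /hA; case: pickle_inv => // e.
  by apply/(measurable_restrict h) => //; exact: measurable_funS mh.
rewrite -nneseries_pickle; last by move=> e; exact: integral_ge0.
have -> : (\sum_(n <oo) (if pickle_inv n is Some e then \int[mu]_(x in J e) h x else 0) =
    \int[mu]_x \sum_(n <oo) hA n x)%E.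
  rewrite integral_nneseries//; apply: eq_eseriesr => n _; rewrite /hA.
  by case: pickle_inv => [e|]; rewrite ?integral0// -integral_mkcond.
rewrite integral_mkcond; apply: ge0_le_integral => //.
- by move=> x _; exact: erestrict_ge0.
- by apply/(measurable_restrict h) => //; exact: measurable_funS mh.
- by apply: ge0_emeasurable_sum.
- move=> x _; rewrite patchE; case: ifPn => [|_]; last exact: nneseries_ge0.
  rewrite inE => /AJ[e _ Jx].
  have -> : h x = hA (pickle e) x by rewrite /hA pickleK_inv patchE mem_set.
  rewrite (@nneseriesD1 R (hA ^~ x) (pickle e) xpredT)//.
  by rewrite leeDl// nneseries_ge0.
Qed.

Section GraphMeasure.
Context {R : realType} (G : metric_graph R).
Local Notation leb := (@lebesgue_measure R).

(* The edge [e0] only serves to make the type pointed, as measurable types are. *)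
Definition graph_space (e0 : edge G) : Type := (edge G * R)%type.

Section Space.
Variable e0 : edge G.
Local Notation X := (graph_space e0).

HB.instance Definition _ := Choice.on X.
HB.instance Definition _ := isPointed.Build X (e0, 0).

Definition edge_section (A : set X) (e : edge G) : set R := [set x | A (e, x)].

(** The sigma-algebra of a disjoint union of copies of the whole real line, one for each edge; the
    graph itself is cut out afterwards by [open_edges]. *)
Definition graph_measurable : set (set X) :=
  [set A | forall e, measurable (edge_section A e : set (measurableTypeR R))].

Let graph_measurable0 : graph_measurable set0.
Proof. by move=> e; exact: measurable0. Qed.

Let graph_measurableC A : graph_measurable A -> graph_measurable (~` A).
Proof. by move=> mA e; exact: measurableC (mA e). Qed.

Let graph_measurable_bigcup (F : (set X)^nat) :
  (forall i, graph_measurable (F i)) -> graph_measurable (\bigcup_i F i).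
Proof.
move=> mF e.
rewrite (_ : edge_section _ e = \bigcup_i edge_section (F i) e).
  by apply: bigcupT_measurable => i; exact: mF.
by apply/seteqP; split=> x [i _ Fi]; exists i.
Qed.

HB.instance Definition _ := isMeasurable.Build default_measure_display X
  graph_measurable0 graph_measurableC graph_measurable_bigcup.

Definition edge_measure (e : edge G) (A : set X) : \bar R :=
  leb (edge_section A e).

Let edge_measure0 e : edge_measure e set0 = 0%E.
Proof. exact: measure0. Qed.

Let edge_measure_ge0 e A : (0 <= edge_measure e A)%E.
Proof. exact: measure_ge0. Qed.

Let edge_measure_sigma_additive e : semi_sigma_additive (edge_measure e).
Proof.
move=> F mF tF mUF; rewrite /edge_measure.
have -> : edge_section (\bigcup_i F i) e = \bigcup_i edge_section (F i) e.
  by apply/seteqP; split=> x [i _ Fi]; exists i.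
apply: measure_semi_sigma_additive.
- by move=> i; exact: mF.
- apply/trivIsetP => i j _ _ ij.
  move/trivIsetP : tF => /(_ _ _ I I ij) Fij.
  apply/seteqP; split=> // x [Fi Fj].
  by have : (F i `&` F j) (e, x) by []; rewrite Fij.
- by apply: bigcupT_measurable => i; exact: mF.
Qed.

HB.instance Definition _ e := isMeasure.Build _ X R (edge_measure e)
  (edge_measure0 e) (edge_measure_ge0 e) (@edge_measure_sigma_additive e).

Definition indexed_edge_measure (n : nat) : {measure set X -> \bar R} :=
  if pickle_inv n is Some e then edge_measure e else mzero.

Definition graph_measure : {measure set X -> \bar R} :=
  mseries indexed_edge_measure 0.

(** The same open intervals as in [graph_integral]: endpoints are left out, and no vertex is
    represented in this set. *)
Definition open_edges : set X := [set p | 0 < p.2 < len p.1].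

Lemma measurable_graph_fun (Y : set X) d' (T : measurableType d') (h : X -> T) :
  measurable Y ->
  (forall e, measurable_fun (edge_section Y e : set (measurableTypeR R)) (fun x => h (e, x))) ->
  measurable_fun Y h.
Proof.
move=> mY mh _ A mA; have H : graph_measurable (Y `&` h @^-1` A); last exact: H.
by move=> e; exact: (mh e (mY e) _ mA).
Qed.

Lemma measurable_graph_section (Y : set X) d' (T : measurableType d') (h : X -> T) e :
  measurable Y -> measurable_fun Y h ->
  measurable_fun (edge_section Y e : set (measurableTypeR R)) (fun x => h (e, x)).
Proof. by move=> mY mh _ A mA; exact: (mh mY A mA e). Qed.

Lemma measurable_open_edges : measurable open_edges.
Proof.
move=> e; rewrite (_ : edge_section _ _ = `]0, len e[%classic); last first.
  by apply/seteqP; split=> x; rewrite /edge_section/= in_itv.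
exact: measurable_itv.
Qed.

Lemma edge_section_open_edges e : edge_section open_edges e = `]0, len e[%classic.
Proof. by apply/seteqP; split=> x; rewrite /edge_section/= in_itv. Qed.

Lemma measurable_pair_edge e :
  measurable_fun [set: measurableTypeR R] (fun x => (e, x) : X).
Proof. by move=> _ A mA; rewrite setTI; exact: mA. Qed.

Lemma ge0_integral_graph (h : X -> \bar R) :
  measurable_fun open_edges h -> (forall p, open_edges p -> 0 <= h p)%E ->
  (\int[graph_measure]_(p in open_edges) h p =
   \esum_(e in [set: edge G]) \int[leb]_(x in `]0%R, len e[) h (e, x))%E.
Proof.
move=> mh h0; rewrite ge0_integral_measure_series//; last exact: measurable_open_edges.
rewrite -nneseries_pickle; last first.
  by move=> e; apply: integral_ge0 => x /=; rewrite in_itv/= => xe; exact: h0.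
apply: eq_eseriesr => n _; rewrite /indexed_edge_measure.
case: pickle_inv => [e|]; last by rewrite integral_measure_zero.
rewrite (_ : edge_measure e = pushforward leb (fun x => (e, x) : X))//.
rewrite ge0_integral_pushforward//.
- exact: measurable_pair_edge.
- exact: measurable_open_edges.
- by move=> p; rewrite inE; exact: h0.
Qed.

Lemma graph_integralE (h : edge G * R -> R) : measurable_fun open_edges (h : X -> R) ->
  graph_integral h = (\int[graph_measure]_(p in open_edges) (h p)%:E)%E.
Proof.
move=> mh; rewrite /graph_integral integralE.
have meh : measurable_fun open_edges (EFin \o h : X -> \bar R) by exact/measurable_EFinP.
have P := ge0_integral_graph (measurable_funepos meh) (fun p _ => funepos_ge0 _ p).
have N := ge0_integral_graph (measurable_funeneg meh) (fun p _ => funeneg_ge0 _ p).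
congr (_ - _)%E.
  by rewrite -[RHS]/(\int[graph_measure]_(p in open_edges) (EFin \o h)^\+ p)%E P;
    apply: eq_esum => e _; apply: eq_integral => x _; rewrite !funeposE.
by rewrite -[RHS]/(\int[graph_measure]_(p in open_edges) (EFin \o h)^\- p)%E N;
  apply: eq_esum => e _; apply: eq_integral => x _; rewrite !funenegE.
Qed.

Lemma volumeE : volume G = graph_measure open_edges.
Proof.
rewrite -[graph_measure _]mul1e -integral_cst; last exact: measurable_open_edges.
rewrite ge0_integral_graph//.
apply: eq_esum => e _; rewrite (integral_cst leb (measurable_itv _)) mul1e.
by have := lebesgue_itvoo (ltW (len_gt0 e)); rewrite subr0 => H; exact: (esym H).
Qed.

End Space.
End GraphMeasure.

(** * Paths and distances *)

Section GraphPaths.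
Context {R : realType} (G : metric_graph R).
Implicit Types (p q r : edge G * R) (e : edge G) (L M : R) (u : edge G * R -> R).

Lemma at_vertex_points p v : at_vertex p v -> points p.
Proof.
rewrite /points/= => -[[-> _]|[-> _]]; by rewrite lexx ltW// len_gt0.
Qed.

Lemma glued_sym p q : glued p q -> glued q p.
Proof. by move=> [v [pv qv]]; exists v. Qed.

Lemma graph_path_ge0 p q L : graph_path p q L -> 0 <= L.
Proof. by elim=> // e x y M _ M0 _; rewrite addr_ge0. Qed.

Lemma graph_path_points p q L : points p -> graph_path p q L -> points q.
Proof.
by move=> pp; elim=> // q' r M _ _ [v [_ /at_vertex_points]].
Qed.

Lemma graph_path_cat p q r L M :
  graph_path p q L -> graph_path q r M -> graph_path p r (L + M).
Proof.
move=> pq; elim=> [|e x y N _ IH ey|q' r' N _ IH qr'].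
- by rewrite addr0.
- by rewrite addrA; exact: graph_path_edge IH ey.
- exact: graph_path_glue IH qr'.
Qed.

Lemma graph_path_rev p q L : points p -> graph_path p q L -> graph_path q p L.
Proof.
move=> pp; elim=> [|e x y N px IH ey|q' r' N _ IH qr'].
- exact: graph_path_refl.
- rewrite addrC; apply: graph_path_cat IH.
  rewrite distrC -[X in graph_path _ _ X]add0r.
  apply: graph_path_edge; first exact: graph_path_refl.
  exact: graph_path_points px.
- rewrite -[N]add0r; apply: graph_path_cat IH.
  apply: graph_path_glue (glued_sym qr'); exact: graph_path_refl.
Qed.

Lemma graph_path_edge1 e x y : points (e, y) -> graph_path (e, x) (e, y) `|y - x|.
Proof.
move=> ey; rewrite -[X in graph_path _ _ X]add0r.
apply: graph_path_edge ey; exact: graph_path_refl.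
Qed.

Lemma graph_path_glued p q : glued p q -> graph_path p q 0.
Proof. by move=> pq; apply: graph_path_glue pq; exact: graph_path_refl. Qed.

Let between_split (a b c t : R) : (a <= t <= c) || (c <= t <= a) ->
  ~~ ((a <= t <= b) || (b <= t <= a)) -> (b <= t <= c) || (c <= t <= b).
Proof. by case: (ltgtP a t); case: (ltgtP b t); case: (ltgtP c t). Qed.

(** An intermediate value property without continuity: along the path, t lies between the values of
    u at the two ends of some segment, which belong to one edge. Gluing must not change u. *)
Lemma path_between u p q L (t : R) :
  (forall a b, glued a b -> u a = u b) -> points p -> graph_path p q L ->
  (u p <= t <= u q) || (u q <= t <= u p) ->
  exists e x y, [/\ points (e, x), points (e, y) & u (e, x) <= t <= u (e, y)].
Proof.
move=> ug pp; elim=> [|e x y N px IH ey|q' r' N _ IH qr'].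
- rewrite orbb => upt; exists p.1, p.2, p.2.
  by rewrite -surjective_pairing.
- have ex := graph_path_points pp px => H.
  case: (boolP ((u p <= t <= u (e, x)) || (u (e, x) <= t <= u p))) => [|nH].
    exact: IH.
  have /orP[/andP[xt ty]|/andP[yt tx]] := between_split H nH.
    by exists e, x, y; split=> //; rewrite xt.
  by exists e, y, x; split=> //; rewrite yt.
- by rewrite -(ug _ _ qr').
Qed.

Section Connected.
Hypothesis G_connected : graph_connected G.

(** The alternative v = w covers a vertex that no point represents. Otherwise representatives at
    both ends are recorded, because transitivity passes through a point at the middle vertex. *)
Let joined (v w : vertex G) := v = w \/
  [/\ exists p, at_vertex p v, exists q, at_vertex q w &
   forall p q, at_vertex p v -> at_vertex q w -> exists L, graph_path p q L].

Let joined_vertices v w : joined v w.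
Proof.
elim: (G_connected v w) => {v w} [v w [e [ev ew]]|v|v w _ IH|a b c _ IH1 _ IH2].
- right; split.
  + by exists (e, 0); left.
  + by exists (e, len e); right.
  + move=> p q pv qw; exists (0 + `|len e - 0| + 0).
    apply: (@graph_path_cat _ (e, len e)); last first.
      by apply: graph_path_glued; exists w; split=> //; right.
    apply: (@graph_path_cat _ (e, 0)).
      by apply: graph_path_glued; exists v; split=> //; left.
    by apply: graph_path_edge1; rewrite /points/= lexx ltW// len_gt0.
- by left.
- case: IH => [->|[pv qw pq]]; [by left|right; split=> // p q pw qv].
  have [L qp] := pq _ _ qv pw; exists L.
  exact: graph_path_rev (at_vertex_points qv) qp.
- case: IH1 => [->//|[ea eb ab]]; case: IH2 => [<-|[eb' ec bc]]; right; split=> //.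
  move=> p q pa qc; have [r rb] := eb.
  have [L pr] := ab _ _ pa rb; have [M rq] := bc _ _ rb qc.
  by exists (L + M); exact: graph_path_cat rq.
Qed.

Lemma connected_graph_path p q : points p -> points q -> exists L, graph_path p q L.
Proof.
move=> pp pq.
have P0 r : points r -> graph_path r (r.1, 0) `|0 - r.2|.
  case: r => e x _ /=; apply: graph_path_edge1.
  by rewrite /points/= lexx ltW// len_gt0.
have [L H] : exists L, graph_path (p.1, 0) (q.1, 0) L.
  have [vw|[_ _]] := joined_vertices (src p.1) (src q.1); last first.
    by apply; left.
  by exists 0; apply: graph_path_glued; exists (src p.1); split; left.
exists (`|0 - p.2| + (L + `|0 - q.2|)).
apply: (graph_path_cat (P0 _ pp)); apply: (graph_path_cat H).
exact: graph_path_rev pq (P0 _ pq).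
Qed.

Lemma dist_le_path p q L : graph_path p q L -> (dist p q <= L%:E)%E.
Proof. by move=> pq; apply: ereal_inf_lbound; exists L. Qed.

Lemma dist_ge0 p q : (0 <= dist p q)%E.
Proof.
by apply: le_ereal_inf_tmp => _ [L /graph_path_ge0 L0 <-]; rewrite lee_fin.
Qed.

Lemma dist_glued p q : glued p q -> dist p q = 0%E.
Proof.
move=> pq; apply/eqP; rewrite eq_le dist_ge0 andbT.
exact/dist_le_path/graph_path_glued.
Qed.

Lemma dist_fin_num p q : points p -> points q -> dist p q \is a fin_num.
Proof.
move=> pp pq; have [L /dist_le_path H] := connected_graph_path pp pq.
by rewrite ge0_fin_numE ?dist_ge0// (le_lt_trans H)// ltry.
Qed.

Lemma dist_approx p q (c : R) : (dist p q < c%:E)%E -> exists2 L, graph_path p q L & L < c.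
Proof.
move=> /ereal_inf_lt[_ [L pL <-]]; rewrite lte_fin => Lc; by exists L.
Qed.

Definition rdist p q : R := fine (dist p q).

Lemma rdistE p q : points p -> points q -> dist p q = (rdist p q)%:E.
Proof. by move=> pp pq; rewrite /rdist fineK// dist_fin_num. Qed.

Lemma rdist_ge0 p q : 0 <= rdist p q.
Proof. exact/fine_ge0/dist_ge0. Qed.

Lemma rdist_le_path p q r L : points p -> points q -> graph_path q r L ->
  rdist p r <= rdist p q + L.
Proof.
move=> pp pq qr; have pr := graph_path_points pq qr.
apply/ler_addgt0Pr => e e0.
have [M pM Mlt] : exists2 M, graph_path p q M & M < rdist p q + e.
  by apply: dist_approx; rewrite rdistE// lte_fin ltrDl.
have := dist_le_path (graph_path_cat pM qr); rewrite rdistE// lee_fin.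
by move=> /le_trans; apply; rewrite addrAC lerD2r ltW.
Qed.

Lemma rdistxx p : points p -> rdist p p = 0.
Proof.
move=> pp; apply/eqP; rewrite eq_le rdist_ge0 andbT -lee_fin -rdistE//.
exact/dist_le_path/graph_path_refl.
Qed.

End Connected.

Lemma continuous_on_graph_glued u : continuous_on_graph u ->
  forall p q, glued p q -> u p = u q.
Proof.
move=> cu p q pq; apply/eqP; rewrite eq_sym -subr_eq0 -normr_le0.
apply/ler_addgt0Pr => e e0; rewrite add0r.
have [v [/at_vertex_points pp /at_vertex_points qq]] := pq.
have [d d0 /(_ q qq)] := cu p pp e e0.
by rewrite dist_glued// => /(_ _)/ltW; apply; rewrite lte_fin.
Qed.

Lemma continuous_on_graph_edge u e : continuous_on_graph u ->
  forall x, 0 <= x <= len e -> forall eps, 0 < eps ->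
  exists2 delta : R, 0 < delta & forall y, 0 <= y <= len e -> `|y - x| < delta ->
    `|edge_fun u e y - edge_fun u e x| < eps.
Proof.
move=> cu x xe eps eps0; have [d d0 H] := cu (e, x) xe eps eps0.
exists d => // y ye yx; apply: H => //.
by apply: le_lt_trans (dist_le_path (graph_path_edge1 _ ye)) _; rewrite lte_fin.
Qed.

Lemma continuous_edge_fun u e x : continuous_on_graph u ->
  0 < x < len e -> {for x, continuous (edge_fun u e)}.
Proof.
move=> cu /andP[x0 xe]; apply/cvgrPdist_lt => eps eps0.
have xi : 0 <= x <= len e by rewrite !ltW.
have [d d0 H] := continuous_on_graph_edge cu xi eps0.
near=> y; rewrite distrC; apply: H.
  by apply/andP; split; apply/ltW; near: y; [exact: lt_nbhsr|exact: lt_nbhsl].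
by rewrite distrC; near: y; apply/nbhs_normP; exists d.
Unshelve. all: by end_near. Qed.

End GraphPaths.

(** * Sobolev functions *)

Section EdgeSobolev.
Context {R : realType}.
Local Notation leb := (@lebesgue_measure R).
Implicit Types (u v phi : R -> R) (x y z w a b d t l eps : R).

Let mI a b : measurable (`]a, b[%classic : set (measurableTypeR R)).
Proof. exact: measurable_itv. Qed.

Lemma sq_int_L2_interval l u : sq_int leb `]0, l[ u -> L2_interval l u.
Proof. by move=> [mu ui]; split=> //; exact: integrable_lty. Qed.

Lemma test_function_continuous l phi : test_function l phi ->
  continuous phi /\ continuous (phi^`())%classic.
Proof.
move=> [dphi _]; split=> x; apply/differentiable_continuous/derivable1_diffP.
  exact: (dphi 0%N).
exact: (dphi 1%N).
Qed.

Lemma H1_intervalP l u v : H1_interval l u v <->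
  [/\ sq_int leb `]0, l[ u, sq_int leb `]0, l[ v & forall phi, test_function l phi ->
    ip leb `]0, l[ u (phi^`())%classic = - ip leb `]0, l[ v phi].
Proof.
split=> [[/L2_interval_sq_int ui /L2_interval_sq_int vi uv]|[ui vi uv]].
  split=> // phi tphi; have [c0 c1] := test_function_continuous tphi.
  have := uv _ tphi; rewrite (ipE (mI 0 l) ui (sq_int_continuous 0 l c1)).
  by rewrite (ipE (mI 0 l) vi (sq_int_continuous 0 l c0)) -EFinN => -[].
split; [exact: sq_int_L2_interval..|] => phi tphi.
have [c0 c1] := test_function_continuous tphi.
rewrite (ipE (mI 0 l) ui (sq_int_continuous 0 l c1)).
by rewrite (ipE (mI 0 l) vi (sq_int_continuous 0 l c0)) uv.
Qed.

Lemma H1_interval_lin l (a b : R) u v u' v' : H1_interval l u u' -> H1_interval l v v' ->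
  H1_interval l (fun x => a * u x + b * v x) (fun x => a * u' x + b * v' x).
Proof.
move=> /H1_intervalP[ui u'i uu'] /H1_intervalP[vi v'i vv']; apply/H1_intervalP.
split; [exact: sq_int_lin..|] => phi tphi.
have [c0 c1] := test_function_continuous tphi.
have c0i := sq_int_continuous 0 l c0; have c1i := sq_int_continuous 0 l c1.
rewrite (ip_linl (mI 0 l) a b ui vi c1i) (ip_linl (mI 0 l) a b u'i v'i c0i).
by rewrite uu'// vv'// !mulrN opprD.
Qed.

Lemma interior_approx l x d : 0 < l -> 0 <= x <= l -> 0 < d ->
  exists2 y, 0 < y < l & `|y - x| < d.
Proof.
move=> l0 /andP[x0 xl] d0; have [t [t0 td tl]] : exists t, [/\ 0 < t, t < d & t < l / 2].
  exists (Num.min d (l / 2) / 2).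
  have m0 : 0 < Num.min d (l / 2) by rewrite lt_min d0 divr_gt0.
  have : Num.min d (l / 2) / 2 < Num.min d (l / 2) by lra.
  by rewrite lt_min divr_gt0// => /andP[].
have [xl2|xl2] := leP x (l / 2).
  exists (x + t); first by apply/andP; split; lra.
  by rewrite addrC addKr gtr0_norm.
exists (x - t); first by apply/andP; split; lra.
by rewrite addrC addKr normrN gtr0_norm.
Qed.

(** Test functions only see the open interval; continuity carries the estimate to the endpoints. The
    affine modulus covers at once a constant bound (B = 0) and an equicontinuity bound. *)
Lemma affine_modulus_closure l u (A B : R) : 0 < l -> 0 <= B ->
  (forall x, 0 <= x <= l -> forall eps, 0 < eps -> exists2 d, 0 < d &
    forall y, 0 <= y <= l -> `|y - x| < d -> `|u y - u x| < eps) ->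
  (forall x y, 0 < x -> x < y -> y < l -> `|u y - u x| <= A + B * (y - x)) ->
  0 <= A ->
  forall x y, 0 <= x <= l -> 0 <= y <= l -> `|u y - u x| <= A + B * `|y - x|.
Proof.
move=> l0 B0 cu H A0 x y xl yl.
have {}H z w : 0 < z < l -> 0 < w < l -> `|u w - u z| <= A + B * `|w - z|.
  move=> /andP[z0 zl] /andP[w0 wl]; case: (ltgtP z w) => [zw|wz|->].
  - by rewrite (@gtr0_norm _ (w - z)) ?subr_gt0//; exact: H.
  - by rewrite distrC [in leRHS]distrC (@gtr0_norm _ (z - w)) ?subr_gt0//; exact: H.
  - by rewrite !subrr normr0 mulr0 addr0.
apply/ler_addgt0Pr => t t0.
(* Moving both points by at most eps costs 2 eps in the values of u and B times 2 eps in the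
   distance. *)
pose eps := t / (2 + 2 * B).
have den : 0 < 2 + 2 * B by lra.
have eps0 : 0 < eps by rewrite divr_gt0.
have tE : t = 2 * eps + B * (2 * eps).
  by rewrite /eps; field; rewrite gt_eqF.
have [d1 d10 d1P] := cu x xl eps eps0; have [d2 d20 d2P] := cu y yl eps eps0.
have m1 : 0 < Num.min d1 eps by rewrite lt_min d10.
have m2 : 0 < Num.min d2 eps by rewrite lt_min d20.
have [x' x'l] := interior_approx l0 xl m1; rewrite lt_min => /andP[x'd x'e].
have [y' y'l] := interior_approx l0 yl m2; rewrite lt_min => /andP[y'd y'e].
have i x0 : 0 < x0 < l -> 0 <= x0 <= l by move=> /andP[? ?]; rewrite !ltW.
have X := d1P _ (i _ x'l) x'd; have Y := d2P _ (i _ y'l) y'd.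
have XY := H _ _ x'l y'l.
have D : `|y' - x'| <= `|y - x| + 2 * eps.
  have -> : y' - x' = (y - x) + ((y' - y) - (x' - x)) by ring.
  apply: (le_trans (ler_normD _ _)); rewrite lerD2l.
  apply: (le_trans (ler_normB _ _)); lra.
have BD : B * `|y' - x'| <= B * (`|y - x| + 2 * eps) by rewrite ler_wpM2l.
have -> : u y - u x = (u y' - u x') + ((u x' - u x) - (u y' - u y)) by ring.
apply: (le_trans (ler_normD _ _)).
have N : `|u x' - u x - (u y' - u y)| <= 2 * eps.
  by apply: (le_trans (ler_normB _ _)); lra.
apply: (le_trans (lerD XY N)); rewrite {}tE.
by move: BD; rewrite mulrDr; lra.
Qed.

(** The first bound feeds the covering argument. The second replaces the Hoelder modulus with its
    square root: |v| <= v^2 / a + a is integrated over the segment, and a large makes the energy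
    term small. *)
Lemma H1_interval_osc l u v : 0 < l -> H1_interval l u v ->
  (forall x, 0 <= x <= l -> forall eps, 0 < eps -> exists2 d, 0 < d &
    forall y, 0 <= y <= l -> `|y - x| < d -> `|u y - u x| < eps) ->
  (forall x, 0 < x < l -> {for x, continuous u}) ->
  forall x y, 0 <= x <= l -> 0 <= y <= l ->
  `|u y - u x| <= \int[leb]_(t in `]0, l[) `|v t| /\
  forall a, 0 < a ->
   `|u y - u x| <= ip leb `]0, l[ v v / a + a * `|y - x|.
Proof.
move=> l0 uv cu cu' x y xl yl.
have /H1_intervalP[ui vi _] := uv.
have fin := lebesgue_itvoo_lty 0 l.
have vint := integrable_norm (sq_int_integrable (mI 0 l) fin vi).
have sub a b : 0 <= a -> b <= l -> (`]a, b[%classic : set R) `<=` `]0, l[%classic.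
  move=> a0 bl t /=; rewrite !in_itv/= => /andP[at_ tb].
  by rewrite (le_lt_trans a0 at_) (lt_le_trans tb bl).
have subint a b : 0 <= a -> b <= l ->
    \int[leb]_(t in `]a, b[) `|v t| <= \int[leb]_(t in `]0, l[) `|v t|.
  move=> a0 bl; rewrite /Rintegral fine_le//.
  - by apply: integrable_fin_num => //; apply: (integrableS (mI 0 l)) vint => //; exact: sub.
  - exact: integrable_fin_num.
  - apply: ge0_subset_integral => //; last exact: sub.
    exact: measurable_int vint.
split.
  rewrite -[leRHS]addr0 -[X in _ <= _ + X](mul0r `|y - x|).
  apply: (@affine_modulus_closure l) => //; last exact: Rintegral_ge0.
  move=> {xl yl}x {}y x0 xy yl; rewrite mul0r addr0.
  have [z yz zl] : exists2 z, y < z & z < l.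
    by exists ((y + l) / 2); lra.
  have xl : x < l by lra.
  apply: (le_trans (weak_derivative_osc uv x0 xy yz zl _ _)).
  - by apply: cu'; rewrite x0.
  - by apply: cu'; rewrite yl (lt_trans x0).
  - by apply: subint; rewrite ltW.
move=> a a0.
apply: (@affine_modulus_closure l) => //; [exact: ltW| |by rewrite divr_ge0 ?ip_ge0// ltW].
move=> {xl yl}x {}y x0 xy yl.
apply/ler_addgt0Pr => t t0.
have [z [yz zl zt]] : exists z, [/\ y < z, z < l & a * (z - y) <= t].
  have [m [m0 ml mt]] : exists m, [/\ 0 < m, m < l - y & m < t / a].
    exists (Num.min (l - y) (t / a) / 2).
    have m0 : 0 < Num.min (l - y) (t / a) by rewrite lt_min subr_gt0 yl divr_gt0.
    have : Num.min (l - y) (t / a) / 2 < Num.min (l - y) (t / a) by lra.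
    by rewrite lt_min divr_gt0// => /andP[].
  exists (y + m); split; [lra|lra|].
  by rewrite addrC addKr mulrC -ler_pdivlMr// ltW.
have xl : x < l by lra.
apply: (le_trans (weak_derivative_osc uv x0 xy yz zl _ _)).
- by apply: cu'; rewrite x0.
- by apply: cu'; rewrite yl (lt_trans x0).
have vxz := sq_int_subset (mI x z) (mI 0 l) (sub _ _ (ltW x0) (ltW zl)) vi.
have finxz := lebesgue_itvoo_lty x z.
have ci := sq_int_cst (mI x z) finxz a.
have sqi : leb.-integrable `]x, z[ (EFin \o (fun t => v t * v t)) by exact: (sq_int_mul (mI x z) vxz vxz).
have cxi : leb.-integrable `]x, z[ (EFin \o cst a) by exact: sq_int_integrable.
have svi : leb.-integrable `]x, z[ (EFin \o (fun t => a^-1 * (v t * v t))).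
  exact: (integrableZl (mI x z) a^-1 sqi).
apply: (@le_trans _ _ (\int[leb]_(t in `]x, z[) (a^-1 * (v t * v t) + cst a t))).
  apply: le_Rintegral => //.
  - exact: (integrable_norm (sq_int_integrable (mI x z) finxz vxz)).
  - exact: (integrableD (mI x z) svi cxi).
  - move=> s _ /=; rewrite -expr2 -(real_normK (num_real (v s))).
    have := normr_ge0 (v s); move: `|v s| => w w0.
    have : 0 <= (a - w) ^+ 2 / a by rewrite divr_ge0 ?sqr_ge0 1?ltW.
    have -> : (a - w) ^+ 2 / a = a - 2 * w + a^-1 * w ^+ 2.
      by field; rewrite gt_eqF.
    lra.
rewrite (RintegralD (mI x z) svi cxi) (RintegralZl _ (mI x z) sqi).
rewrite Rintegral_oo_cst; last by lra.
have : \int[leb]_(t in `]x, z[) (v t * v t) <= ip leb `]0, l[ v v.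
  rewrite /ip /Rintegral fine_le//.
  - exact: integrable_fin_num.
  - by apply: integrable_fin_num => //; exact: (sq_int_mul (mI 0 l) vi vi).
  - apply: ge0_subset_integral => //; last exact: sub (ltW x0) (ltW zl).
      exact: measurable_int (sq_int_mul (mI 0 l) vi vi).
    by move=> s _; rewrite lee_fin -expr2 sqr_ge0.
have ai : 0 <= a^-1 by rewrite invr_ge0 ltW.
move=> /(ler_wpM2l ai); rewrite [X in _ <= X -> _]mulrC => H.
have -> : z - x = (z - y) + (y - x) by ring.
by rewrite mulrDr; lra.
Qed.

End EdgeSobolev.

(** * Functions of H^1 on the whole graph *)

Section GraphSobolev.
Context {R : realType} (G : metric_graph R) (e0 : edge G).
Hypothesis G_connected : graph_connected G.
Hypothesis volume_fin : (volume G < +oo)%E.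
Local Notation leb := (@lebesgue_measure R).
Local Notation mu := (@graph_measure R G e0).
Local Notation D := (@open_edges R G e0).
Local Notation mD := (@measurable_open_edges R G e0).
Local Notation gip := (ip mu D).
Local Notation gsq := (sq_int mu D).
Implicit Types (u v g : edge G * R -> R) (e : edge G) (x y t eps a b : R).

Let mI a b : measurable (`]a, b[%classic : set (measurableTypeR R)).
Proof. exact: measurable_itv. Qed.

Lemma open_edges_lty : (mu D < +oo)%E.
Proof. by rewrite -volumeE. Qed.

Definition gvol : R := fine (volume G).

Lemma gvolE : mu D = gvol%:E.
Proof.
by rewrite /gvol -(volumeE e0) fineK// ge0_fin_numE// (volumeE e0).
Qed.

Lemma gvol_gt0 : 0 < gvol.
Proof.
rewrite -lte_fin -gvolE -(volumeE e0); apply: (@lt_le_trans _ _ (len e0)%:E).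
  by rewrite lte_fin len_gt0.
apply: esum_ge; exists [set e0]; first by split.
by rewrite fsbig_set1.
Qed.

Lemma Rintegral_graph_cst a : \int[mu]_(p in D) (cst a) p = a * gvol.
Proof. by rewrite Rintegral_cst ?gvolE//; exact: mD. Qed.

Lemma graph_sq_int_cst a : gsq (cst a).
Proof. exact: sq_int_cst mD open_edges_lty a. Qed.

Lemma open_edges_points p : D p -> points p.
Proof. by rewrite /open_edges /points/= => /andP[? ?]; rewrite !ltW. Qed.

Lemma ge0_integral_edge (h : graph_space e0 -> \bar R) e :
  measurable_fun D h -> (forall p, 0 <= h p)%E ->
  (\int[leb]_(x in `]0%R, len e[) h (e, x) <= \int[mu]_(p in D) h p)%E.
Proof.
move=> mh h0; rewrite ge0_integral_graph//.
apply: esum_ge; exists [set e]; first by split.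
by rewrite fsbig_set1.
Qed.

Lemma measurable_edge_fun u e : measurable_fun D u ->
  measurable_fun (`]0, len e[%classic : set (measurableTypeR R)) (edge_fun u e).
Proof.
by move=> /(measurable_graph_section (e := e) mD); rewrite edge_section_open_edges.
Qed.

Lemma measurable_graph u :
  (forall e, measurable_fun (`]0, len e[%classic : set (measurableTypeR R)) (edge_fun u e)) ->
  measurable_fun D (u : graph_space e0 -> R).
Proof.
move=> H; apply: measurable_graph_fun; first exact: mD.
by move=> e; rewrite edge_section_open_edges; exact: H.
Qed.

Lemma sq_int_edge u e : gsq u ->
  sq_int leb `]0, len e[ (edge_fun u e) /\
  ip leb `]0, len e[ (edge_fun u e) (edge_fun u e) <= gip u u.
Proof.
move=> ui; have [mu_ _] := ui.
have mu2 : measurable_fun D (fun p => (u p * u p)%:E).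
  exact: measurable_int (sq_int_mul mD ui ui).
have H : (\int[leb]_(x in `]0%R, len e[) (edge_fun u e x * edge_fun u e x)%:E <= (gip u u)%:E)%E.
  rewrite -ipE//; last exact: mD.
  by apply: (@ge0_integral_edge (fun p => (u p * u p)%:E)) => // p; rewrite lee_fin -expr2 sqr_ge0.
have uei : sq_int leb `]0, len e[ (edge_fun u e).
  apply: sq_intP; first exact: measurable_edge_fun.
  under eq_integral do rewrite expr2.
  by apply: (le_lt_trans H); rewrite ltry.
by split=> //; rewrite -lee_fin -ipE.
Qed.

Lemma H1_graphP u v : H1_graph u v <->
  [/\ continuous_on_graph u, forall e, H1_interval (len e) (edge_fun u e) (edge_fun v e),
    gsq u & gsq v].
Proof.
split=> [[cu uv]|[cu uv ui vi]]; last first.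
  split=> //; rewrite (@graph_integralE _ _ e0).
    exact: (integrable_lty mD (integrableD mD ui.2 vi.2)).
  by apply: measurable_funD; apply: measurable_funX; [exact: ui.1|exact: vi.1].
have mu_ : measurable_fun D (u : graph_space e0 -> R).
  by apply: measurable_graph => e; have [[]] := uv e.
have mv : measurable_fun D (v : graph_space e0 -> R).
  by apply: measurable_graph => e; have [_ []] := uv e.
have mu2 : measurable_fun D (fun p : graph_space e0 => (u p ^+ 2)%:E).
  by apply/measurable_EFinP/measurable_funX.
have mv2 : measurable_fun D (fun p : graph_space e0 => (v p ^+ 2)%:E).
  by apply/measurable_EFinP/measurable_funX.
rewrite (@graph_integralE _ _ e0); last by apply: measurable_funD; exact: measurable_funX.
move=> uvi; split=> //; apply: sq_intP => //; apply: le_lt_trans uvi.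
  apply: ge0_le_integral => //; [exact: mD|by move=> p _; rewrite lee_fin sqr_ge0| |].
    by apply/measurable_EFinP/measurable_funD; exact: measurable_funX.
  by move=> p _; rewrite lee_fin lerDl sqr_ge0.
apply: ge0_le_integral => //; [exact: mD|by move=> p _; rewrite lee_fin sqr_ge0| |].
  by apply/measurable_EFinP/measurable_funD; exact: measurable_funX.
by move=> p _; rewrite lee_fin lerDr sqr_ge0.
Qed.

Lemma continuous_on_graph_lin u g a b : continuous_on_graph u -> continuous_on_graph g ->
  continuous_on_graph (fun p => a * u p + b * g p).
Proof.
move=> cu cg p pp eps eps0.
pose k := `|a| + `|b| + 1; have k0 : 0 < k by rewrite ltr_wpDl ?addr_ge0.
have ek0 : 0 < eps / k by rewrite divr_gt0.
have [d1 d10 d1P] := cu p pp _ ek0; have [d2 d20 d2P] := cg p pp _ ek0.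
exists (Num.min d1 d2); first by rewrite lt_min d10.
move=> q qq; rewrite EFin_min lt_min => /andP[/(d1P q qq) U /(d2P q qq) V].
have -> : a * u q + b * g q - (a * u p + b * g p) = a * (u q - u p) + b * (g q - g p) by ring.
apply: (le_lt_trans (ler_normD _ _)); rewrite !normrM.
apply: (@le_lt_trans _ _ (`|a| * (eps / k) + `|b| * (eps / k))).
  by apply: lerD; apply: ler_wpM2l => //; exact: ltW.
by rewrite -mulrDl mulrA ltr_pdivrMr// mulrC ltr_pM2l// /k ltrDl.
Qed.

Lemma H1_graph_lin u u' g g' a b : H1_graph u u' -> H1_graph g g' ->
  H1_graph (fun p => a * u p + b * g p) (fun p => a * u' p + b * g' p).
Proof.
move=> /H1_graphP[cu uu' ui u'i] /H1_graphP[cg gg' gi g'i]; apply/H1_graphP; split.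
- exact: continuous_on_graph_lin.
- by move=> e; exact: H1_interval_lin (uu' e) (gg' e).
- exact: (sq_int_lin mD).
- exact: (sq_int_lin mD).
Qed.

Lemma H1_graph_cst a : @H1_graph R G (fun=> a) (fun=> 0).
Proof.
apply/H1_graphP; split; [| |exact: graph_sq_int_cst|exact: graph_sq_int_cst].
  by move=> p _ eps eps0; exists 1 => // q _ _; rewrite subrr normr0.
move=> e; apply/H1_intervalP; have fin := lebesgue_itvoo_lty 0 (len e).
split; [exact: (sq_int_cst (mI _ _) fin)|exact: (sq_int_cst (mI _ _) fin)|].
move=> phi tphi; have [c0 c1] := test_function_continuous tphi.
have c1i := sq_int_integrable (mI _ _) fin (sq_int_continuous 0 (len e) c1).
rewrite /ip (RintegralZl _ (mI _ _) c1i).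
have dphi (x : R) : is_derive x 1 phi ((phi^`())%classic x).
  by rewrite derive1E; apply: derivableP; exact: (tphi.1 0%N).
rewrite (Rintegral_derive (ltW (len_gt0 e)) dphi c1).
have [_ [s [t [s0 tl out]]]] := tphi.
rewrite !out; last 2 first.
- by rewrite negb_and -!ltNge s0.
- by rewrite negb_and -!ltNge tl orbT.
rewrite subrr mulr0; apply/esym/eqP; rewrite oppr_eq0.
by under eq_Rintegral do rewrite mul0r; rewrite (Rintegral_cst _ (mI _ _)) mul0r.
Qed.

Lemma H1_graph_edge_osc u u' : H1_graph u u' -> forall e x y,
  0 <= x <= len e -> 0 <= y <= len e ->
  `|u (e, y) - u (e, x)| <= \int[leb]_(t in `]0, len e[) `|edge_fun u' e t| /\
  forall a, 0 < a -> `|u (e, y) - u (e, x)| <= gip u' u' / a + a * `|y - x|.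
Proof.
move=> H e x y xe ye; have /H1_graphP[cu uu' ui u'i] := H.
have [] := H1_interval_osc (len_gt0 e) (uu' e) (continuous_on_graph_edge cu)
  (fun x => continuous_edge_fun cu) xe ye.
move=> H1 H2; split=> // a a0; apply: le_trans (H2 a a0) _.
rewrite lerD2r ler_wpM2r ?invr_ge0 ?(ltW a0)//.
exact: (sq_int_edge e u'i).2.
Qed.

(* The values of u on the edge e lie in an interval J e of length twice the
   integral of |u'| over e; these intervals cover the segment between u p and u q. *)
Lemma H1_graph_osc u u' p q : H1_graph u u' -> points p -> points q ->
  `|u q - u p| <= Num.sqrt (4 * gvol * gip u' u').
Proof.
move=> H pp pq; have /H1_graphP[cu uu' ui u'i] := H.
wlog upq : p q pp pq / u p <= u q.
  move=> W; have [|/ltW] := leP (u p) (u q); first exact: W.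
  by rewrite distrC; exact: W.
pose r e := \int[leb]_(t in `]0, len e[) `|edge_fun u' e t|.
pose J e : set (measurableTypeR R) := `[u (e, 0) - r e, u (e, 0) + r e]%classic.
have r0 e : 0 <= r e by exact: Rintegral_ge0.
have cover : `[u p, u q]%classic `<=` \bigcup_e J e.
  move=> t /=; rewrite in_itv/= => ut.
  have [L pL] := connected_graph_path G_connected pp pq.
  have [|e [x [y [ex ey /andP[xt ty]]]]] :=
    path_between (t := t) (continuous_on_graph_glued cu) pp pL; first by rewrite ut.
  exists e => //; rewrite /J/= in_itv/=.
  have e00 : 0 <= (0 : R) <= len e by rewrite lexx ltW ?len_gt0.
  have [Hx _] := H1_graph_edge_osc H e00 ex; have [Hy _] := H1_graph_edge_osc H e00 ey.
  move: Hx Hy; rewrite -/(r e) !ler_norml => /andP[? ?] /andP[? ?].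
  by apply/andP; split; lra.
have absi : gsq (fun p => `|u' p|).
  split; first exact: measurableT_comp u'i.1.
  apply: eq_integrable u'i.2; first exact: mD.
  by move=> s _ /=; rewrite real_normK// num_real.
have absint := sq_int_integrable mD open_edges_lty absi.
have key : u q - u p <= 2 * \int[mu]_(p in D) `|u' p|.
  have := @le_integral_cover _ (measurableTypeR R) R leb _ `[u p, u q] J (cst 1%E)
     (measurable_itv _) (fun e => measurable_itv _) (measurable_cst _) (fun _ => lee01) cover.
  rewrite integral_cst; last exact: measurable_itv.
  rewrite [X in (1 * X)%E](lebesgue_itvcc upq) mul1e.
  move=> /le_trans; rewrite -lee_fin; apply.
  rewrite EFinM /Rintegral fineK; last exact: (integrable_fin_num mD absint).
  have mabs : measurable_fun D (fun p : graph_space e0 => `|u' p|%:E).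
    exact: measurable_int absint.
  rewrite -ge0_integralZl_EFin//; last exact: mD.
  rewrite ge0_integral_graph//; last by apply: emeasurable_funM.
  apply: le_esum => e _.
  rewrite integral_cst; last exact: measurable_itv.
  have ur : u (e, 0) - r e <= u (e, 0) + r e by have := r0 e; lra.
  rewrite [X in (1 * X)%E](lebesgue_itvcc ur) mul1e.
  have mabse : measurable_fun (`]0, len e[%classic : set (measurableTypeR R))
      (fun t : R => `|u' (e, t)|%:E).
    apply/measurable_EFinP; apply: measurableT_comp => //.
    exact: measurable_edge_fun u'i.1.
  rewrite (@ge0_integralZl_EFin _ _ _ leb _ (mI _ _) (fun t => `|u' (e, t)|%:E))//.
  have -> : (\int[leb]_(x in `]0%R, len e[) `|u' (e, x)|%:E = (r e)%:E)%E.
    rewrite /r /Rintegral fineK//.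
    have [u'ei _] := sq_int_edge e u'i.
    apply: integrable_fin_num => //.
    exact: integrable_norm (sq_int_integrable (mI _ _) (lebesgue_itvoo_lty _ _) u'ei).
  by rewrite -EFinM lee_fin; lra.
rewrite ger0_norm ?subr_ge0//; apply: (le_trans key).
have I0 : 0 <= \int[mu]_(p in D) `|u' p| by exact: Rintegral_ge0.
rewrite -[leLHS]ger0_norm ?mulr_ge0// -sqrtr_sqr ler_wsqrtr//.
(* Cauchy-Schwarz against the constant 1 turns twice the integral of |u'| into the square root of 4
   |G| times the energy. *)
have := ip_cauchy_schwarz mD absi (graph_sq_int_cst 1).
have -> : gip (fun p => `|u' p|) (cst 1) = \int[mu]_(p in D) `|u' p|.
  by apply: eq_Rintegral => s _; rewrite mulr1.
have -> : gip (cst 1) (cst 1) = gvol.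
  by rewrite -[RHS]mul1r -Rintegral_graph_cst; apply: eq_Rintegral => s _; rewrite mulr1.
have -> : gip (fun p => `|u' p|) (fun p => `|u' p|) = gip u' u'.
  by apply: eq_Rintegral => s _; rewrite -!expr2 real_normK// num_real.
by nra.
Qed.

(** If v p exceeded the oscillation bound, v would be bounded below by a positive constant on the
    whole graph and its mean could not vanish. *)
Lemma H1_graph_mean0_bound u u' p : H1_graph u u' -> gip u (cst 1) = 0 -> points p ->
  `|u p| <= Num.sqrt (4 * gvol * gip u' u').
Proof.
have main v v' : H1_graph v v' -> gip v (cst 1) = 0 -> points p ->
    v p <= Num.sqrt (4 * gvol * gip v' v').
  move=> H v0 pp; rewrite leNgt; apply/negP => lt.
  have /H1_graphP[_ _ vi _] := H.
  have vint := sq_int_integrable mD open_edges_lty vi.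
  have : \int[mu]_(q in D) (cst (v p - Num.sqrt (4 * gvol * gip v' v'))) q <= gip v (cst 1).
    have -> : gip v (cst 1) = \int[mu]_(q in D) v q.
      by apply: eq_Rintegral => s _; rewrite mulr1.
    apply: le_Rintegral => //; first exact: mD.
      exact: (sq_int_integrable mD open_edges_lty (graph_sq_int_cst _)).
    move=> q /open_edges_points qq; have := H1_graph_osc H qq pp.
    by rewrite ler_norml /= => /andP[_]; lra.
  rewrite v0 Rintegral_graph_cst pmulr_lle0 ?gvol_gt0// => le.
  by move: lt le; lra.
move=> H u0 pp; rewrite ler_norml; apply/andP; split; last exact: main.
have /H1_graphP[_ _ ui u'i] := H.
have HN := H1_graph_lin (-1) 0 H (H1_graph_cst 0).
have uN : gip (fun p => -1 * u p + 0 * 0) (cst 1) = 0.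
  by rewrite (ip_linl mD)// ?u0 ?mulr0 ?mul0r ?addr0//; exact: graph_sq_int_cst.
have := main _ _ HN uN pp.
have -> : gip (fun p => -1 * u' p + 0 * 0) (fun p => -1 * u' p + 0 * 0) = gip u' u'.
  by apply: eq_Rintegral => s _; ring.
by lra.
Qed.

Let sq_sum_le a a' b b' t : a ^+ 2 <= t * b' -> a' ^+ 2 <= t * b -> 0 < t ->
  (a + a') ^+ 2 <= t * (2 * (b + b' + 1)).
Proof. by have := sqr_ge0 (a - a'); nra. Qed.

(** For a fixed test function, the defect of integration by parts is continuous in L^2 and vanishes
    for the approximations w, so it is arbitrarily small. Continuity of u is a separate hypothesis,
    since L^2 limits do not provide it. *)
Lemma H1_graph_closed u v : continuous_on_graph u -> gsq u -> gsq v ->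
  (forall eps, 0 < eps -> exists w w', [/\ H1_graph w w',
    gip (fun p => u p - w p) (fun p => u p - w p) <= eps &
    gip (fun p => v p - w' p) (fun p => v p - w' p) <= eps]) ->
  H1_graph u v.
Proof.
move=> cu ui vi H; apply/H1_graphP; split=> // e; apply/H1_intervalP.
have [uei _] := sq_int_edge e ui; have [vei _] := sq_int_edge e vi.
split=> // phi tphi; have [c0 c1] := test_function_continuous tphi.
have c0i := sq_int_continuous 0 (len e) c0; have c1i := sq_int_continuous 0 (len e) c1.
set A := ip _ _ _ _; set B := ip _ _ _ _.
apply/eqP; rewrite -subr_eq0 opprK -[_ == 0](@expf_eq0 _ _ 2) /=.
rewrite eq_le sqr_ge0 andbT; apply/ler_addgt0Pr => t t0; rewrite add0r.
pose C := ip leb `]0, len e[ phi phi + ip leb `]0, len e[ (phi^`())%classic (phi^`())%classic + 1.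
have C0 : 0 < C by rewrite ltr_wpDl ?addr_ge0 ?ip_ge0.
have [w [w' [Hw uw vw']]] := H (t / (2 * C)) (divr_gt0 t0 (mulr_gt0 (ltr0n _ 2) C0)).
have /H1_graphP[_ ww' wi w'i] := Hw.
have /H1_intervalP[wei w'ei /(_ phi tphi) E] := ww' e.
have [d1i d1] := sq_int_edge e (sq_intB mD ui wi).
have [d2i d2] := sq_int_edge e (sq_intB mD vi w'i).
have -> : A + B = ip leb `]0, len e[ (edge_fun (fun p => u p - w p) e) (phi^`())%classic +
    ip leb `]0, len e[ (edge_fun (fun p => v p - w' p) e) phi.
  rewrite (ipBl (mI 0 (len e)) uei wei c1i) (ipBl (mI 0 (len e)) vei w'ei c0i) E.
  by rewrite -/A -/B; ring.
have cs1 := le_trans (ip_cauchy_schwarz (mI _ _) d1i c1i)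
  (ler_wpM2r (ip_ge0 _ _ _) (le_trans d1 uw)).
have cs2 := le_trans (ip_cauchy_schwarz (mI _ _) d2i c0i)
  (ler_wpM2r (ip_ge0 _ _ _) (le_trans d2 vw')).
have tE : t / (2 * C) * (2 * C) = t by rewrite divfK// mulf_neq0// gt_eqF.
have tC0 : 0 < t / (2 * C) by rewrite divr_gt0// mulr_gt0.
rewrite -[leRHS]tE {2}/C; exact: sq_sum_le cs1 cs2 tC0.
Qed.

End GraphSobolev.

(** * Minimizers of the Rayleigh quotient *)

(** An ultrafilter finer than the eventual filter makes all bounded coordinates converge at once.
    For each k it contains the set of those n >= k whose coordinates up to k are within 1 / (k + 1)
    of their limits; [phi k] is chosen there. *)
Lemma diagonal_extraction (R : realType) (f : nat -> nat -> R) (M : R) :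
  (forall n j, `|f n j| <= M) ->
  exists2 phi : nat -> nat, (forall k, (k <= phi k)%N) &
    forall j, cvgn (fun k => f (phi k) j).
Proof.
move=> fM.
have [U [UU oU]] := ultraFilterLemma (@eventually_filter : ProperFilter \oo).
have /choice[l lP] : forall j, exists l : R, forall e, 0 < e -> U [set n | `|l - f n j| < e].
  move=> j; have PF : ProperFilter (f^~ j @ U) by exact: fmap_proper_filter.
  have : (f^~ j @ U) `[-M, M]%classic.
    by apply: (@filterS _ U _ setT) filterT => n _ /=; rewrite in_itv/= -ler_norml.
  move=> /(@segment_compact R (-M) M _ PF)[l [_ cl]].
  exists l => e e0; have [//|UC] := in_ultra_setVsetC [set n | `|l - f n j| < e] UU.
  have [] := cl [set f n j | n in ~` [set n | `|l - f n j| < e]] (ball l e) _ (nbhsx_ballx l e e0).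
    by apply: (@filterS _ U _ _ _ _ UC) => n Un; exists n.
  by move=> _ [[n nP <-] ln].
have near_l k : U [set n | (k <= n)%N /\ forall j, (j <= k)%N -> `|l j - f n j| < k.+1%:R^-1].
  suff H m : U [set n | forall j, (j <= m)%N -> `|l j - f n j| < k.+1%:R^-1].
    by apply: filterI (H k); apply: oU; exact: nbhs_infty_ge.
  elim: m => [|m IH].
    by apply: filterS (lP 0%N k.+1%:R^-1 _) => [n /= H [|j]//|]; rewrite invr_gt0.
  have km : 0 < k.+1%:R^-1 :> R by rewrite invr_gt0.
  apply: filterS (filterI IH (lP m.+1 _ km)) => n [Hm Hm1] j.
  by rewrite leq_eqVlt => /predU1P[->//|]; exact: Hm.
have /choice[phi phiP] k : exists n, (k <= n)%N /\ forall j, (j <= k)%N -> `|l j - f n j| < k.+1%:R^-1.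
  exact: filter_ex (near_l k).
exists phi => [k|j]; first exact: (phiP k).1.
apply/cvg_ex; exists (l j); apply/cvgrPdist_lt => e e0.
near=> k; have [_ /(_ j)] := phiP k.
have jk : (j <= k)%N by near: k; exact: nbhs_infty_ge.
move=> /(_ jk)/lt_trans; apply.
rewrite -[e]invrK ltf_pV2 ?posrE ?invr_gt0//.
by near: k; apply: filterS (nbhs_infty_gtr e^-1) => n /= H; rewrite (lt_trans H)// ltr_nat.
Unshelve. all: by end_near. Qed.

Lemma cauchy_cvgn (R : realType) (u : nat -> R) :
  (forall e, 0 < e -> exists N, forall n, (N <= n)%N -> `|u N - u n| < e) -> cvgn u.
Proof.
move=> H; apply: R_complete; apply: cauchy_exP => e e0.
by have [N NP] := H e e0; exists (u N); exists N => // n /= /NP.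
Qed.

(** * Compactness of sequences with bounded energy *)

Section Compactness.
Context {R : realType} (G : metric_graph R) (e0 : edge G).
Hypothesis G_connected : graph_connected G.
Hypothesis volume_fin : (volume G < +oo)%E.
Local Notation mu := (@graph_measure R G e0).
Local Notation D := (@open_edges R G e0).
Local Notation mD := (@measurable_open_edges R G e0).
Local Notation gip := (ip mu D).
Local Notation gsq := (sq_int mu D).

Let close_via (s t s' t' l eps : R) : `|s' - s| <= eps / 4 -> `|t' - t| <= eps / 4 ->
  `|l - s'| < eps / 8 -> `|l - t'| < eps / 8 -> 0 < eps -> `|s - t| < eps.
Proof.
rewrite !ler_norml !ltr_norml => /andP[? ?] /andP[? ?] /andP[? ?] /andP[? ?] ?.
by apply/andP; split; lra.
Qed.

(** Convergence at rational points spreads along each edge by an equicontinuity uniform in n. The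
    uniform bound on the functions and the finite volume then give L^2 convergence by domination. *)
Lemma H1_graph_compact (u u' : nat -> edge G * R -> R) (C : R) :
  (forall n, H1_graph (u n) (u' n)) -> (forall n, gip (u n) (cst 1) = 0) ->
  (forall n, gip (u' n) (u' n) <= C) ->
  exists phi (w : edge G * R -> R), [/\ forall k, (k <= phi k)%N, gsq w,
    (forall p, points p -> (fun k => u (phi k) p) @ \oo --> w p) &
    (fun k => gip (fun p => u (phi k) p - w p) (fun p => u (phi k) p - w p)) @ \oo --> (0 : R)].
Proof.
move=> H u0 uC.
have C0 : 0 <= C by apply: le_trans (uC 0%N); exact: ip_ge0.
pose M := Num.sqrt (4 * gvol G * C).
have M0 : 0 <= M by exact: sqrtr_ge0.
have uM n p : points p -> `|u n p| <= M.
  move=> pp; apply: (le_trans (H1_graph_mean0_bound G_connected volume_fin (H n) (u0 n) pp)).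
  by rewrite ler_wsqrtr// ler_wpM2l// mulr_ge0// ltW// (gvol_gt0 e0).
(* The coordinates are the values at the rational points of the edges; every other code gives the
   zero sequence. *)
pose f (n j : nat) : R := if (unpickle j : option (edge G * rat)) is Some (e, q) then
  (if 0 <= (ratr q : R) <= len e then u n (e, ratr q) else 0) else 0.
have fM n j : `|f n j| <= M.
  rewrite /f; case: unpickle => [[e q]|]; last by rewrite normr0.
  by case: ifPn => [qe|_]; [exact: uM|rewrite normr0].
have [phi kphi phiP] := diagonal_extraction fM.
have ucvg p : points p -> cvgn (fun k => u (phi k) p).
  case: p => e x xe; apply: cauchy_cvgn => eps eps0.
  (* The energy term C / a of the modulus is then at most eps / 8, and points at distance at most
     eps / (8 a) add at most another eps / 8. *)
  pose a := (C + 1) * 8 / eps.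
  have a0 : 0 < a by rewrite divr_gt0// mulr_gt0// ltr_wpDl.
  have dl : 0 < eps / 8 / a by apply: divr_gt0 => //; apply: divr_gt0.
  have [y /andP[y0 yl] yx] := interior_approx (len_gt0 e) xe dl.
  have yz : y < Num.min (len e) (y + (eps / 8 / a - `|y - x|)).
    by rewrite lt_min yl ltrDl subr_gt0.
  have [q] := rat_in_itvoo yz; rewrite in_itv/= lt_min => /and3P[yq qe qd].
  have qi : 0 <= (ratr q : R) <= len e by rewrite (ltW qe) (ltW (lt_trans y0 yq)).
  have qx : `|ratr q - x| <= eps / 8 / a.
    have -> : ratr q - x = (ratr q - y) + (y - x) by ring.
    apply: (le_trans (ler_normD _ _)); rewrite (@gtr0_norm _ (ratr q - y)) ?subr_gt0//.
    by rewrite -lerBrDr lerBlDl ltW.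
  have near_q n : `|u n (e, ratr q) - u n (e, x)| <= eps / 4.
    have [_ /(_ a a0)] := H1_graph_edge_osc e0 (H n) xe qi.
    move=> /le_trans; apply.
    have -> : eps / 4 = eps / 8 + a * (eps / 8 / a).
      by rewrite [a * _]mulrC divfK ?gt_eqF//; field.
    apply: lerD; last by rewrite ler_pM2l.
    rewrite ler_pdivrMr// /a; have -> : eps / 8 * ((C + 1) * 8 / eps) = C + 1.
      by field; rewrite gt_eqF.
    by rewrite (le_trans (uC n))// lerDl.
  have fq n : f n (pickle (e, q)) = u n (e, ratr q).
    by rewrite /f pickleK qi.
  have /cvg_ex[l /cvgrPdist_lt/(_ (eps / 8))] := phiP (pickle (e, q)).
  rewrite divr_gt0// => /(_ isT)[N _ NP]; exists N => n Nn.
  have := NP N (leqnn N); have := NP n Nn; rewrite /= !fq => Hn HN.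
  exact: (close_via (near_q _) (near_q _) HN Hn eps0).
pose w p : R := if `[< points p >] then limn (fun k => u (phi k) p) else 0.
have uw p : points p -> (fun k => u (phi k) p) @ \oo --> w p.
  by move=> pp; rewrite /w asboolT//; exact: ucvg.
have ui n : gsq (u n) by have /(H1_graphP e0)[] := H n.
have mw : measurable_fun D w.
  apply: (@measurable_fun_cvg _ _ _ D (fun k => u (phi k))).
    by move=> n; exact: (ui _).1.
  by move=> p /open_edges_points; exact: uw.
have wM p : points p -> `|w p| <= M.
  move=> pp; have wn : (fun k => `|u (phi k) p|) @ \oo --> `|w p| by apply: cvg_norm; exact: uw.
  rewrite -(cvg_lim _ wn)//; apply: limr_le; first by apply/cvg_ex; exists `|w p|.
  by apply: nearW => k; exact: uM.
have wi : gsq w.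
  apply: (@sq_int_bounded _ _ _ mu D mD (open_edges_lty e0 volume_fin) _ M) => //.
  by move=> p /open_edges_points; exact: wM.
exists phi, w; split=> //.
have fin := open_edges_lty e0 volume_fin.
pose h k : graph_space e0 -> \bar R := fun p => ((u (phi k) p - w p) * (u (phi k) p - w p))%:E.
have hE k : (\int[mu]_(p in D) h k p)%E = (gip (fun p => u (phi k) p - w p) (fun p => u (phi k) p - w p))%:E.
  by rewrite -ipE//; [exact: mD|exact: (sq_intB mD)|exact: (sq_intB mD)].
have di k : gsq (fun p => u (phi k) p - w p) by exact: (sq_intB mD).
have mh k : measurable_fun D (h k) by exact: measurable_int (sq_int_mul mD (di k) (di k)).
have h0 : {ae mu, forall p, D p -> h^~ p @ \oo --> cst 0%E p}.
  apply: aeW => p /open_edges_points pp; rewrite /h /=.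
  apply: cvg_EFin; first exact: nearW.
  have -> : (0 : R) = (w p - w p) * (w p - w p) by rewrite subrr mulr0.
  by apply: cvgM; (apply: cvgB; [exact: uw|exact: cvg_cst]).
have hb : {ae mu, forall p n, D p -> (`|h n p| <= cst ((2 * M) ^+ 2)%:E p)%E}.
  apply: aeW => p n /open_edges_points pp /=.
  rewrite lee_fin -expr2 normrX lerXn2r ?nnegrE ?mulr_ge0//.
  apply: (le_trans (ler_normB _ _)).
  by have := uM (phi n) _ pp; have := wM _ pp; lra.
have ci : mu.-integrable D (cst ((2 * M) ^+ 2)%:E).
  exact: (sq_int_integrable mD fin (graph_sq_int_cst e0 volume_fin ((2 * M) ^+ 2))).
have [_ _] := dominated_convergence mD mh (measurable_cst _) h0 ci hb.
rewrite integral0; under eq_fun do rewrite hE.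
by move=> /fine_cvg.
Unshelve. all: by end_near. Qed.

End Compactness.

Section StrongConvergence.
Context d (T : measurableType d) (R : realType).
Variables (mu : {measure set T -> \bar R}) (D : set T) (mD : measurable D).
Variables (f : nat -> T -> R) (g : T -> R).
Hypotheses (fi : forall n, sq_int mu D (f n)) (gi : sq_int mu D g).
Hypothesis fg : (fun n => ip mu D (fun x => f n x - g x) (fun x => f n x - g x)) @ \oo --> (0 : R).

Lemma ip_cvg_weak h : sq_int mu D h ->
  (fun n => ip mu D (f n) h) @ \oo --> ip mu D g h.
Proof.
move=> hi; apply/cvgrPdist_lt => e e0.
pose C := ip mu D h h + 1.
have C0 : 0 < C by rewrite ltr_wpDl ?ip_ge0.
have eC : 0 < e ^+ 2 / C by rewrite divr_gt0// exprn_gt0.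
move/cvgrPdist_lt : fg => /(_ _ eC); apply: filterS => n.
rewrite sub0r normrN ger0_norm ?ip_ge0// ltr_pdivlMr// => H.
have := ip_cauchy_schwarz mD (sq_intB mD (fi n) gi) hi.
rewrite (ipBl mD (fi n) gi hi) => CS.
rewrite distrC -(@ltr_pXn2r _ 2)// ?nnegrE ?(ltW e0)//.
rewrite real_normK ?num_real//; apply: (le_lt_trans CS); apply: le_lt_trans H.
by rewrite ler_wpM2l ?ip_ge0// lerDl.
Qed.

Lemma ip_cvg_sq : (fun n => ip mu D (f n) (f n)) @ \oo --> ip mu D g g.
Proof.
have -> : (fun n => ip mu D (f n) (f n)) = (fun n =>
    ip mu D (fun x => f n x - g x) (fun x => f n x - g x) + 2 * ip mu D (f n) g - ip mu D g g).
  by apply/funext => n; rewrite ipB_sq//; ring.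
rewrite [X in _ --> X](_ : _ = 0 + 2 * ip mu D g g - ip mu D g g); last by ring.
apply: cvgB; last exact: cvg_cst.
by apply: cvgD => //; apply: cvgM; [exact: cvg_cst|exact: ip_cvg_weak].
Qed.

End StrongConvergence.

(** * The minimizer and its Euler-Lagrange equation *)

Section Minimizer.
Context {R : realType} (G : metric_graph R) (e0 : edge G).
Hypothesis G_connected : graph_connected G.
Hypothesis volume_fin : (volume G < +oo)%E.
Local Notation mu := (@graph_measure R G e0).
Local Notation D := (@open_edges R G e0).
Local Notation mD := (@measurable_open_edges R G e0).
Local Notation gip := (ip mu D).
Local Notation gsq := (sq_int mu D).
Implicit Types (u v f g w : edge G * R -> R).

Let H1_sq_int u u' : H1_graph u u' -> gsq u /\ gsq u'.
Proof. by move=> /(H1_graphP e0)[]. Qed.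

Lemma continuous_on_graph_ulimit (v : nat -> edge G * R -> R) w :
  (forall n, continuous_on_graph (v n)) ->
  (forall e, 0 < e -> exists n, forall p, points p -> `|w p - v n p| <= e) ->
  continuous_on_graph w.
Proof.
move=> cv vw p pp e e_gt0; have e3 : 0 < e / 3 by rewrite divr_gt0.
have [n nP] := vw _ e3; have [d d0 dP] := cv n p pp _ e3.
exists d => // q qq pq; have := dP q qq pq; have := nP q qq; have := nP p pp.
have -> : w q - w p = (w q - v n q) - (w p - v n p) + (v n q - v n p) by ring.
move=> Hp Hq Hqp; apply: (le_lt_trans (ler_normD _ _)).
apply: (@le_lt_trans _ _ (e / 3 + e / 3 + `|v n q - v n p|)); last by lra.
by rewrite lerD2r; apply: (le_trans (ler_normB _ _)); exact: lerD.
Qed.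

Definition mean0 u u' := H1_graph u u' /\ gip u (cst 1) = 0.

Lemma mean0_lin u u' g g' (a b : R) : mean0 u u' -> mean0 g g' ->
  mean0 (fun p => a * u p + b * g p) (fun p => a * u' p + b * g' p).
Proof.
move=> [Hu u0] [Hg g0]; split; first exact: (H1_graph_lin e0).
have [[ui _] [gi _]] := (H1_sq_int Hu, H1_sq_int Hg).
by rewrite (ip_linl mD _ _ ui gi (graph_sq_int_cst e0 volume_fin 1)) u0 g0 !mulr0 addr0.
Qed.

(** Homogeneity: u is scaled to norm 1, and for norm 0 the left side vanishes. *)
Lemma rayleigh_le (m : R) :
  (forall u u', mean0 u u' -> gip u u = 1 -> m <= gip u' u') ->
  forall u u', mean0 u u' -> m * gip u u <= gip u' u'.
Proof.
move=> mP u u' Hu; have [ui u'i] := H1_sq_int Hu.1.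
have [uu|uu] := eqVneq (gip u u) 0; first by rewrite uu mulr0 ip_ge0.
have uu0 : 0 < gip u u by rewrite lt0r uu ip_ge0.
pose c := (Num.sqrt (gip u u))^-1.
have c2 : c ^+ 2 = (gip u u)^-1 by rewrite exprVn sqr_sqrtr// ltW.
have Hc := mean0_lin c 0 Hu Hu.
have nrm v : gsq v -> gip (fun p => c * v p + 0 * v p) (fun p => c * v p + 0 * v p) = (gip u u)^-1 * gip v v.
  by move=> vi; rewrite (ip_lin_sq mD _ _ vi vi) c2; ring.
have := mP _ _ Hc; rewrite !nrm// mulVf// => /(_ erefl).
by rewrite mulrC ler_pdivlMr.
Qed.

(** Energy minus m times squared norm, along w + t g0, is a nonnegative quadratic in t with constant
    term at most 0, so its linear coefficient vanishes. Here g0 is g minus its mean: the shift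
    changes neither g' nor the product with w, which has mean zero. *)
Lemma euler_lagrange (m : R) w w' : mean0 w w' -> gip w' w' <= m * gip w w ->
  (forall u u', mean0 u u' -> m * gip u u <= gip u' u') ->
  forall g g', H1_graph g g' -> gip w' g' = m * gip w g.
Proof.
move=> Hw wm mP g g' Hg.
have [wi w'i] := H1_sq_int Hw.1; have [gi g'i] := H1_sq_int Hg.
have oi := graph_sq_int_cst e0 volume_fin 1.
pose c := - (gip g (cst 1) / gvol G).
have V0 : 0 < gvol G := gvol_gt0 e0 volume_fin.
have one2 : gip (fun=> 1) (cst 1) = gvol G.
  rewrite -[RHS]mul1r -(Rintegral_graph_cst e0 volume_fin).
  by apply: eq_Rintegral => s _; rewrite mulr1.
have Hg0 : mean0 (fun p => 1 * g p + c * 1) (fun p => 1 * g' p + c * 0).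
  split; first exact: (H1_graph_lin e0 _ _ Hg (H1_graph_cst e0 volume_fin 1)).
  rewrite (ip_linl mD _ _ gi oi oi) one2 mul1r /c mulNr divfK ?gt_eqF//.
  by rewrite subrr.
have [g0i g0'i] := H1_sq_int Hg0.1.
set g0 := (fun p => 1 * g p + c * 1) in Hg0 g0i; set g0' := (fun p => 1 * g' p + c * 0) in Hg0 g0'i.
have E' : gip w' g' = gip w' g0'.
  by apply: eq_ip => // p _; rewrite /g0' mulr0 addr0 mul1r.
have E : gip w g = gip w g0.
  rewrite [RHS]ipC (ip_linl mD _ _ gi oi wi) mul1r ipC -[LHS]addr0; congr (_ + _).
  by rewrite [X in _ = c * X]ipC (_ : gip w (fun=> 1) = 0) ?mulr0//; exact: Hw.2.
have := @quadratic_ge0_discr R 0 (gip w' g0' - m * gip w g0) (gip g0' g0' - m * gip g0 g0).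
rewrite subr_ge0 mul0r => /(_ (mP _ _ Hg0)) H.
apply/eqP; rewrite E' E -subr_eq0 -[_ == 0](@expf_eq0 _ _ 2)/= eq_le sqr_ge0 andbT.
apply: H => t; have := mP _ _ (mean0_lin 1 t Hw Hg0).
rewrite (ip_lin_sq mD _ _ wi g0i) (ip_lin_sq mD _ _ w'i g0'i); move: wm.
set a1 := gip w w; set a2 := gip w g0; set a3 := gip g0 g0.
set b1 := gip w' w'; set b2 := gip w' g0'; set b3 := gip g0' g0'.
by move=> wm H1; lra.
Qed.

Lemma neumann_laplacian_eigen (m : R) w w' : H1_graph w w' ->
  (forall g g', H1_graph g g' -> gip w' g' = m * gip w g) ->
  neumann_laplacian w (fun p => m * w p).
Proof.
move=> Hw EL; have [wi w'i] := H1_sq_int Hw.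
have mwi := sq_intZ mD m wi; split.
  split=> [e|].
    exact: (sq_int_L2_interval (sq_int_edge e mwi).1).
  rewrite (@graph_integralE _ _ e0); first exact: (integrable_lty mD mwi.2).
  exact: measurable_funX mwi.1.
exists w'; split=> // g g' Hg; have [gi g'i] := H1_sq_int Hg.
rewrite !(@graph_integralE _ _ e0); last 2 first.
- exact: measurable_funM mwi.1 gi.1.
- exact: measurable_funM w'i.1 g'i.1.
rewrite (ipE mD w'i g'i) (ipE mD mwi gi) (EL _ _ Hg); congr EFin.
have := ip_linl mD m 0 wi wi gi; rewrite mul0r addr0 => <-.
by apply: eq_ip => // p _; rewrite mul0r addr0.
Qed.

(* Let u n be a minimizing sequence of norm 1 for the Rayleigh quotient, converging
   in L^2.  The parallelogram law gives
   |u_m' - u_n'|^2 <= 2 |u_m'|^2 + 2 |u_n'|^2 - m |u_m + u_n|^2, which tends to 0: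
   hence the derivatives converge in L^2 and the functions converge uniformly. *)
Lemma rayleigh_minimizer f f' : mean0 f f' -> 0 < gip f f ->
  exists (m : R) w w', [/\ mean0 w w', gip w w = 1, 0 <= m, gip w' w' <= m &
    forall u u', mean0 u u' -> m * gip u u <= gip u' u'].
Proof.
move=> Hf ff.
pose S := [set E : R | exists u u', [/\ mean0 u u', gip u u = 1 & E = gip u' u']].
have S0 : S !=set0.
  pose c := (Num.sqrt (gip f f))^-1.
  have c2 : c ^+ 2 = (gip f f)^-1 by rewrite exprVn sqr_sqrtr// ltW.
  have [fi f'i] := H1_sq_int Hf.1.
  eexists; exists (fun p => c * f p + 0 * f p), (fun p => c * f' p + 0 * f' p).
  split; [exact: mean0_lin| |reflexivity].
  by rewrite (ip_lin_sq mD _ _ fi fi) c2 !mulr0 mul0r !expr0n/= !mul0r !addr0 mulVf// gt_eqF.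
have Slb : lbound S 0 by move=> _ [u [u' [_ _ ->]]]; exact: ip_ge0.
pose m := inf S.
have hS : has_inf S by split=> //; exists 0.
have m0 : 0 <= m by exact: lb_le_inf.
have mP1 u u' : mean0 u u' -> gip u u = 1 -> m <= gip u' u'.
  by move=> Hu uu; apply: ge_inf; [exists 0|exists u, u'].
have mP := rayleigh_le mP1.
have /choice[uu uuP] : forall n, exists uu : (edge G * R -> R) * (edge G * R -> R),
    [/\ mean0 uu.1 uu.2, gip uu.1 uu.1 = 1 & gip uu.2 uu.2 < m + n.+1%:R^-1].
  move=> n; have n0 : 0 < n.+1%:R^-1 :> R by rewrite invr_gt0.
  have [E [u [u' [Hu u1 ->]]] Em] := inf_adherent n0 hS.
  by exists (u, u').
pose u n := (uu n).1; pose u' n := (uu n).2.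
have Hu n : mean0 (u n) (u' n) by have [] := uuP n.
have u1 n : gip (u n) (u n) = 1 by have [] := uuP n.
have uE n : gip (u' n) (u' n) < m + n.+1%:R^-1 by have [] := uuP n.
have uC n : gip (u' n) (u' n) <= m + 1.
  apply: (le_trans (ltW (uE n))); rewrite lerD2l invf_le1// ler1n//.
have [phi [w [kphi wi vw vw2]]] := H1_graph_compact G_connected volume_fin
  (fun n => (Hu n).1) (fun n => (Hu n).2) uC.
pose v n := u (phi n); pose v' n := u' (phi n).
have Hv n : mean0 (v n) (v' n) by exact: Hu.
have vi n : gsq (v n) by have [] := H1_sq_int (Hv n).1.
have v'i n : gsq (v' n) by have [] := H1_sq_int (Hv n).1.
have v1 n : gip (v n) (v n) = 1 by exact: u1.
have vE n : gip (v' n) (v' n) <= m + n.+1%:R^-1.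
  apply: (le_trans (ltW (uE _))); rewrite lerD2l lef_pV2 ?posrE// ler_nat ltnS.
  exact: kphi.
pose del n := gip (fun p => v n p - w p) (fun p => v n p - w p).
have del0 n : 0 <= del n by exact: ip_ge0.
(* Since the norms are 1, |v_k + v_n|^2 = 4 - |v_k - v_n|^2, and the subtracted part is at most 2
   [del k] + 2 [del n]. The terms 4 m cancel, leaving the excess of the two energies over m and
   these distances. *)
pose err n := 2 * n.+1%:R^-1 + 2 * m * del n.
have err0 : err @ \oo --> (0 : R).
  have -> : (0 : R) = 2 * 0 + 2 * m * 0 by rewrite !mulr0 addr0.
  apply: cvgD; apply: cvgM; (try exact: cvg_cst); [exact: cvg_harmonic|exact: vw2].
have diffE k n : gip (fun p => v' k p - v' n p) (fun p => v' k p - v' n p) <= err k + err n.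
  have sum : m * gip (fun p => v k p + v n p) (fun p => v k p + v n p) <=
      gip (fun p => v' k p + v' n p) (fun p => v' k p + v' n p).
    have := mP _ _ (mean0_lin 1 1 (Hv k) (Hv n)).
    set A := gip _ _; set B := gip _ _ => AB.
    rewrite (_ : gip (fun p => v k p + v n p) _ = A); last by apply: eq_ip => p _; ring.
    by rewrite (_ : gip (fun p => v' k p + v' n p) _ = B)//; apply: eq_ip => p _; ring.
  have diff : gip (fun p => v k p - v n p) (fun p => v k p - v n p) <= 2 * del k + 2 * del n.
    have := ip_ge0 mu D (fun p => (v k p - w p) + (v n p - w p)).
    rewrite (ipD_sq mD (sq_intB mD (vi k) wi) (sq_intB mD (vi n) wi)).
    have -> : gip (fun p => v k p - v n p) (fun p => v k p - v n p) =
      gip (fun p => (v k p - w p) - (v n p - w p)) (fun p => (v k p - w p) - (v n p - w p)).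
      by apply: eq_ip => p _; ring.
    rewrite (ipB_sq mD (sq_intB mD (vi k) wi) (sq_intB mD (vi n) wi)).
    by rewrite -/(del k) -/(del n); lra.
  have := ler_wpM2l m0 diff; have := vE k; have := vE n; move: sum.
  rewrite /err (ipD_sq mD (v'i k) (v'i n)) (ipB_sq mD (v'i k) (v'i n)).
  rewrite (ipD_sq mD (vi k) (vi n)) (ipB_sq mD (vi k) (vi n)) !v1.
  set a := gip (v k) (v n); set b := gip (v' k) (v' n).
  set k1 := k.+1%:R^-1; set n1 := n.+1%:R^-1.
  by rewrite !mulrDr mulrN; lra.
have errC eps : 0 < eps -> exists N, forall k n, (N <= k)%N -> (N <= n)%N ->
    gip (fun p => v' k p - v' n p) (fun p => v' k p - v' n p) < eps.
  move=> eps0; have e2 : 0 < eps / 2 by rewrite divr_gt0.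
  move/cvgrPdist_lt : err0 => /(_ _ e2)[N _ NP]; exists N => k n Nk Nn.
  apply: (le_lt_trans (diffE k n)).
  have := NP k Nk; have := NP n Nn; rewrite /= !sub0r !normrN.
  by move=> /(le_lt_trans (ler_norm _)) ? /(le_lt_trans (ler_norm _)) ?; lra.
have [w' w'i vw'] := sq_int_complete mD v'i errC.
have vw'2 : (fun n => gip (fun p => v' n p - w' p) (fun p => v' n p - w' p)) @ \oo --> (0 : R).
  apply/cvgrPdist_le => eps eps0; have [N NP] := vw' _ eps0.
  by exists N => // n Nn; rewrite /= sub0r normrN ger0_norm ?ip_ge0//; exact: NP.
(* The difference v k - v N has mean zero, so its energy bounds its supremum; then k tends to
   infinity at each point. This is what makes the pointwise limit w continuous. *)
have unif eps : 0 < eps -> exists n, forall p, points p -> `|w p - v n p| <= eps.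
  move=> eps0; pose eta := eps ^+ 2 / (4 * gvol G).
  have V0 : 0 < 4 * gvol G by rewrite mulr_gt0// (gvol_gt0 e0).
  have eta0 : 0 < eta by rewrite divr_gt0// exprn_gt0.
  have [N NP] := errC _ eta0; exists N => p pp.
  have wn : (fun k => `|v k p - v N p|) @ \oo --> `|w p - v N p|.
    by apply: cvg_norm; apply: cvgB; [exact: vw|exact: cvg_cst].
  rewrite -(cvg_lim _ wn)//; apply: limr_le; first by apply/cvg_ex; exists `|w p - v N p|.
  exists N => // k Nk /=.
  have [Hkn kn0] := mean0_lin 1 (-1) (Hv k) (Hv N).
  have := H1_graph_mean0_bound G_connected volume_fin Hkn kn0 pp.
  rewrite mul1r mulN1r => /le_trans; apply.
  rewrite -[leRHS]gtr0_norm// -sqrtr_sqr ler_wsqrtr//.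
  rewrite mulrC -ler_pdivlMr//; apply: le_trans (ltW (NP k N Nk (leqnn N))).
  rewrite le_eqVlt; apply/orP; left; apply/eqP.
  by apply: eq_ip => q _; rewrite mul1r mulN1r.
have cw : continuous_on_graph w.
  apply: (@continuous_on_graph_ulimit v) => // n.
  by have /(H1_graphP e0)[] := (Hv n).1.
have Hw : H1_graph w w'.
  apply: (H1_graph_closed (e0 := e0)) => // eps eps0.
  move/cvgrPdist_le : vw2 => /(_ _ eps0)[N1 _ N1P].
  have [N2 N2P] := vw' _ eps0.
  pose n := maxn N1 N2; exists (v n), (v' n); split; first exact: (Hv n).1.
    have := N1P n (leq_maxl _ _); rewrite /= sub0r normrN ger0_norm ?ip_ge0//.
    by apply: le_trans; rewrite le_eqVlt; apply/orP; left; apply/eqP;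
      apply: eq_Rintegral => p _; rewrite /v; ring.
  apply: le_trans (N2P n (leq_maxr _ _)).
  by rewrite le_eqVlt; apply/orP; left; apply/eqP; apply: eq_Rintegral => p _; ring.
have w0 : gip w (cst 1) = 0.
  have := ip_cvg_weak mD vi wi vw2 (graph_sq_int_cst e0 volume_fin 1).
  have -> : (fun n => gip (v n) (cst 1)) = (fun=> 0) by apply/funext => n; exact: (Hv n).2.
  by move=> /(cvg_unique _ (cvg_cst (0 : R)))<-.
exists m, w, w'; split=> //.
- have := ip_cvg_sq mD vi wi vw2.
  have -> : (fun n => gip (v n) (v n)) = (fun=> 1) by apply/funext => n; exact: v1.
  by move=> /(cvg_unique _ (cvg_cst (1 : R)))<-.
- have C1 := ip_cvg_sq mD v'i w'i vw'2.
  have C2 : (fun n => m + n.+1%:R^-1) @ \oo --> m + (0 : R).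
    by apply: cvgD; [exact: cvg_cst|exact: cvg_harmonic].
  rewrite -[m]addr0; apply: (ler_cvg_to C1 C2); exact: nearW.
Qed.

End Minimizer.

(** * The test function *)

Section ChainRule.
Context {R : realType}.
Local Notation leb := (@lebesgue_measure R).
Implicit Types (f F eta phi h H delta : R -> R) (a b c l m s t r x y z B : R).

Let mI a b : measurable (`]a, b[%classic : set (measurableTypeR R)).
Proof. exact: measurable_itv. Qed.

Lemma continuous_bounded f a b : continuous f ->
  exists M, forall z, a <= z <= b -> `|f z| <= M.
Proof.
move=> cf; have [ab|ba] := leP a b; last first.
  by exists 0 => z /andP[az zb]; have := le_trans az zb; rewrite leNgt ba.
have cN : {within `[a, b], continuous (fun x => `|f x|)}.
  apply: continuous_subspaceT => x; apply: continuous_comp; first exact: cf.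
  exact: norm_continuous.
by have [c _ cP] := EVT_max ab cN; exists `|f c| => z zab; apply: cP; rewrite in_itv.
Qed.

Lemma Rintegral_oo_split f x t y : x <= t -> t <= y ->
  leb.-integrable `]x, y[ (EFin \o f) ->
  \int[leb]_(z in `]x, y[) f z = \int[leb]_(z in `]x, t[) f z + \int[leb]_(z in `]t, y[) f z.
Proof.
move=> xt; rewrite le_eqVlt => /predU1P[->|ty] fi.
  by rewrite [X in _ + X](_ : _ = 0) ?addr0// set_itvoo0 Rintegral_set0.
have := @Rintegral_itvB R f (BRight x) (BLeft y) t fi.
rewrite !bnd_simp => /(_ xt ty) <-.
rewrite -Rintegral_itv_bndo_bndc; first by rewrite addrC subrK.
apply: (integrableS (mI x y)) fi => //.
by move=> z /=; rewrite !in_itv/= => /andP[-> zt]; rewrite (lt_trans zt).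
Qed.

(* phi is an antiderivative of phi' in the sense that the chain rule and
   integration by parts hold for (F o phi) * eta on all subintervals of [s, t]. *)
Definition chain_rule s t phi phi' :=
  forall x y, s <= x -> x <= y -> y <= t -> forall F F' eta eta',
    (forall z : R, is_derive z 1 F (F' z)) -> continuous F' ->
    (forall z : R, is_derive z 1 eta (eta' z)) -> continuous eta' ->
    \int[leb]_(z in `]x, y[) (F (phi z) * eta' z + F' (phi z) * phi' z * eta z) =
    F (phi y) * eta y - F (phi x) * eta x.

(** The integrand is the classical derivative of F (m z + c) eta z. As phi' is prescribed on the
    open interval only, its values at the nodes of a piecewise affine function are free. *)
Lemma chain_rule_affine s t m c phi phi' :
  (forall x, s <= x <= t -> phi x = m * x + c) -> (forall x, s < x < t -> phi' x = m) ->
  chain_rule s t phi phi'.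
Proof.
move=> phiE phi'E x y sx xy yt F F' eta eta' dF cF' deta ceta'.
have cF : continuous F.
  by move=> z; apply/differentiable_continuous/derivable1_diffP; exact: ex_derive.
have ceta : continuous eta.
  by move=> z; apply/differentiable_continuous/derivable1_diffP; exact: ex_derive.
have caff : continuous (fun z => m * z + c).
  by move=> z; apply: cvgD; [apply: cvgM; [exact: cvg_cst|exact: cvg_id]|exact: cvg_cst].
have daff (z : R) : is_derive z 1 (fun z => m * z + c) m.
  have : is_derive z 1 (fun z => m *: (z : R) + c) (m *: 1 + 0) by exact: is_deriveD.
  by rewrite addr0 /GRing.scale/= mulr1.
have dg (z : R) : is_derive z 1 (fun z => F (m * z + c) * eta z)
    (F (m * z + c) * eta' z + F' (m * z + c) * m * eta z).
  have d1 := @is_derive1_comp _ F (fun z => m * z + c) z _ _ (dF _) (daff z).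
  have := is_deriveM d1 (deta z); rewrite /GRing.scale/= => d2.
  by apply: (is_derive_eq d2); rewrite [eta z * _]mulrC.
have cg : continuous (fun z => F (m * z + c) * eta' z + F' (m * z + c) * m * eta z).
  move=> z; apply: cvgD; apply: cvgM; (try exact: ceta'); (try exact: ceta).
    exact: (continuous_comp (caff z) (cF _)).
  by apply: cvgM; [exact: (continuous_comp (caff z) (cF' _))|exact: cvg_cst].
rewrite !phiE; last 2 first.
- by rewrite sx (le_trans xy).
- by rewrite yt andbT (le_trans sx).
rewrite -(Rintegral_derive xy dg cg); apply: eq_Rintegral => z.
rewrite inE/= in_itv/= => /andP[xz zy].
rewrite phiE; last by rewrite !ltW ?(lt_le_trans zy)// (le_lt_trans sx).
by rewrite phi'E// (le_lt_trans sx xz) (lt_le_trans zy yt).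
Qed.

Section Properties.
Variables (phi phi' : R -> R).
Hypotheses (mphi : measurable_fun [set: measurableTypeR R] phi)
  (mphi' : measurable_fun [set: measurableTypeR R] phi').
Hypothesis phi'1 : forall x, `|phi' x| <= 1.

Lemma chain_rule_integrable B x y F F' eta eta' :
  (forall z, x <= z <= y -> `|phi z| <= B) ->
  continuous F -> continuous F' -> continuous eta -> continuous eta' ->
  leb.-integrable `]x, y[ (EFin \o (fun z => F (phi z) * eta' z + F' (phi z) * phi' z * eta z)).
Proof.
move=> phiB cF cF' ceta ceta'.
have [MF MFP] := continuous_bounded (- B) B cF.
have [MF' MF'P] := continuous_bounded (- B) B cF'.
have [Me MeP] := continuous_bounded x y ceta.
have [Me' Me'P] := continuous_bounded x y ceta'.
apply: (@integrable_bounded _ _ _ leb _ (mI x y) (lebesgue_itvoo_lty _ _) _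
  (MF * Me' + MF' * 1 * Me)).
  apply: measurable_funTS; apply: measurable_funD; apply: measurable_funM.
  - by apply: measurableT_comp => //; exact: continuous_measurable_fun.
  - exact: continuous_measurable_fun.
  - apply: measurable_funM => //.
    by apply: measurableT_comp => //; exact: continuous_measurable_fun.
  - exact: continuous_measurable_fun.
move=> z /=; rewrite in_itv/= => /andP[/ltW xz /ltW zy].
have zxy : x <= z <= y by rewrite xz.
have pB : - B <= phi z <= B by rewrite -ler_norml; exact: phiB.
apply: (le_trans (ler_normD _ _)); rewrite !normrM; apply: lerD.
  by apply: ler_pM => //; [exact: MFP|exact: Me'P].
apply: ler_pM; [by rewrite mulr_ge0|by []| |exact: MeP].
by apply: ler_pM => //; [exact: MF'P].
Qed.

(** The bound B makes the integrand integrable, so that its integral can be split at t. *)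
Lemma chain_rule_cat B s t r : (forall z, s <= z <= r -> `|phi z| <= B) ->
  chain_rule s t phi phi' -> chain_rule t r phi phi' -> s <= t -> t <= r ->
  chain_rule s r phi phi'.
Proof.
move=> phiB st tr slt tler x y sx xy yr F F' eta eta' dF cF' deta ceta'.
have [yt|ty] := leP y t; first exact: st.
have [tx|xt] := leP t x; first exact: tr.
have cF : continuous F.
  by move=> z; apply/differentiable_continuous/derivable1_diffP; exact: ex_derive.
have ceta : continuous eta.
  by move=> z; apply/differentiable_continuous/derivable1_diffP; exact: ex_derive.
rewrite (Rintegral_oo_split (ltW xt) (ltW ty)); last first.
  apply: (@chain_rule_integrable B) => // z /andP[xz zy].
  by apply: phiB; rewrite (le_trans sx xz) (le_trans zy).
rewrite (st _ _ _ _ _ F F' eta eta')//; last exact: ltW.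
rewrite (tr _ _ _ _ _ F F' eta eta')//; last exact: ltW.
ring.
Qed.

(** With F the identity and eta = 1, the increment of phi is the integral of phi'. *)
Lemma chain_rule_lipschitz s t x y : chain_rule s t phi phi' ->
  s <= x <= t -> s <= y <= t -> `|phi y - phi x| <= `|y - x|.
Proof.
move=> C; wlog xy : x y / x <= y.
  move=> W xs ys; have [|/ltW] := leP x y; first by move=> ?; exact: W.
  by rewrite (distrC (phi y)) (distrC y) => ?; exact: W.
move=> /andP[sx _] /andP[_ yt].
have := C x y sx xy yt id (cst 1) (cst 1) (cst 0) (fun z => is_derive_id _ _)
  (@cst_continuous _ _ _) (fun z => is_derive_cst _ _ _) (@cst_continuous _ _ _).
rewrite !mulr1 => <-.
have mphi'xy : measurable_fun (`]x, y[%classic : set (measurableTypeR R)) phi'.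
  exact: measurable_funTS.
have fin := lebesgue_itvoo_lty x y.
have i1 := @integrable_bounded _ _ _ leb _ (mI x y) fin phi' 1 mphi'xy (fun z _ => phi'1 z).
have -> : \int[leb]_(z in `]x, y[) (id (phi z) * cst 0 z + cst 1 (phi z) * phi' z * cst 1 z) =
  \int[leb]_(z in `]x, y[) phi' z.
  by apply: eq_Rintegral => z _ /=; rewrite mulr0 add0r mul1r mulr1.
apply: (le_trans (le_normr_Rintegral (mI x y) i1)).
rewrite [leRHS]ger0_norm ?subr_ge0// -[leRHS]mul1r -Rintegral_oo_cst//.
apply: le_Rintegral => //; first exact: integrable_norm i1.
exact: (sq_int_integrable (mI x y) fin (sq_int_cst (mI x y) fin 1)).
Qed.

(** Substitution as an inequality: F = H and eta = 1 express the increment as the integral of h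
    (phi) phi', which is at most that of h (phi). No monotonicity of phi is involved. *)
Lemma chain_rule_cover B s t x y h H : chain_rule s t phi phi' ->
  (forall z, s <= z <= t -> `|phi z| <= B) ->
  (forall z : R, is_derive z 1 H (h z)) -> continuous h -> (forall z, 0 <= h z) ->
  s <= x <= t -> s <= y <= t ->
  H (phi y) - H (phi x) <= \int[leb]_(z in `]s, t[) h (phi z).
Proof.
move=> C phiB dH ch h0 xs ys.
have cH : continuous H.
  by move=> z; apply/differentiable_continuous/derivable1_diffP; exact: ex_derive.
have fin a b := lebesgue_itvoo_lty a b.
have [Mh MhP] := continuous_bounded (- B) B ch.
have mhphi : measurable_fun [set: measurableTypeR R] (h \o phi).
  by apply: measurableT_comp => //; exact: continuous_measurable_fun.
have hi a b : s <= a -> b <= t -> leb.-integrable `]a, b[ (EFin \o (h \o phi)).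
  move=> sa bt; apply: (@integrable_bounded _ _ _ leb _ (mI a b) (fin a b) _ Mh).
    exact: measurable_funTS.
  move=> z /=; rewrite in_itv/= => /andP[/ltW az /ltW zb]; apply: MhP; rewrite -ler_norml.
  by apply: phiB; rewrite (le_trans sa az) (le_trans zb).
have key a b : s <= a -> a <= b -> b <= t ->
    `|H (phi b) - H (phi a)| <= \int[leb]_(z in `]s, t[) h (phi z).
  move=> sa ab bt.
  have := C a b sa ab bt H h (cst 1) (cst 0) dH ch
    (fun z => is_derive_cst _ _ _) (@cst_continuous _ _ _).
  rewrite !mulr1 => <-.
  have ci : leb.-integrable `]a, b[
      (EFin \o (fun z => H (phi z) * cst 0 z + h (phi z) * phi' z * cst 1 z)).
    apply: (@chain_rule_integrable B) => //; try exact: cst_continuous.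
    move=> z /andP[az zb]; apply: phiB.
    by rewrite (le_trans sa az) (le_trans zb).
  apply: (le_trans (le_normr_Rintegral (mI a b) ci)).
  apply: (@le_trans _ _ (\int[leb]_(z in `]a, b[) h (phi z))).
    apply: le_Rintegral => //; [exact: integrable_norm ci|exact: hi|].
    move=> z _; rewrite /= mulr0 add0r mulr1 normrM (ger0_norm (h0 _)).
    by rewrite ler_piMr.
  rewrite /Rintegral fine_le//.
  - by apply: integrable_fin_num => //; exact: (hi a b sa bt).
  - by apply: integrable_fin_num => //; exact: (hi s t).
  - apply: ge0_subset_integral => //; first exact: (measurable_int leb (hi s t _ _)).
      by move=> z _; rewrite lee_fin.
    move=> z /=; rewrite !in_itv/= => /andP[az zb].
    by rewrite (le_lt_trans sa az) (lt_le_trans zb bt).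
move: xs ys => /andP[sx xt] /andP[sy yt].
have [xy|/ltW yx] := leP x y.
  by apply: (le_trans (ler_norm _)); exact: key.
by apply: (le_trans (ler_norm _)); rewrite distrC; exact: key.
Qed.

End Properties.

(** For s = t the slope is 0, as 0^-1 = 0, so coinciding nodes do no harm. *)
Definition lin s t a b x := a + (b - a) / (t - s) * (x - s).

Let lin_s s t a b : lin s t a b s = a.
Proof. by rewrite /lin subrr mulr0 addr0. Qed.

Let lin_t s t a b : (s = t -> a = b) -> lin s t a b t = b.
Proof.
move=> ab; rewrite /lin; have [st|st] := eqVneq s t.
  by rewrite -st !subrr mulr0 addr0 ab.
by rewrite divfK ?subr_eq0 1?eq_sym// addrC subrK.
Qed.

Let slope_le1 s t a b : s <= t -> `|b - a| <= t - s -> `|(b - a) / (t - s)| <= 1.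
Proof.
rewrite le_eqVlt => /predU1P[->|st]; first by rewrite subrr invr0 mulr0 normr0.
rewrite normrM normfV (gtr0_norm (_ : 0 < t - s)) ?subr_gt0//.
by rewrite ler_pdivrMr ?subr_gt0// mul1r.
Qed.

(** Two inner nodes suffice because at most two prescribed points lie on an edge. The Lipschitz
    bound on [delta] is exactly a bound by 1 on the slopes. *)
Lemma piecewise_linear_interpolation (delta : R -> R) s1 s2 l :
  0 <= s1 -> s1 <= s2 -> s2 <= l ->
  (forall x y, 0 <= x <= l -> 0 <= y <= l -> `|delta y - delta x| <= `|y - x|) ->
  exists phi phi' : R -> R,
  [/\ measurable_fun [set: measurableTypeR R] phi,
      measurable_fun [set: measurableTypeR R] phi',
      forall x, `|phi' x| <= 1,
      chain_rule 0 l phi phi' &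
      [/\ phi 0 = delta 0, phi s1 = delta s1, phi s2 = delta s2 & phi l = delta l]].
Proof.
move=> s10 s12 s2l dl.
have l0 : 0 <= l by lra.
pose m s t := (delta t - delta s) / (t - s).
pose L s t x := lin s t (delta s) (delta t) x.
have dle s t : 0 <= s -> s <= t -> t <= l -> `|m s t| <= 1.
  move=> s0 st tl; apply: slope_le1 => //; rewrite -[leRHS]ger0_norm ?subr_ge0//.
  by apply: dl; rewrite ?s0 ?tl ?(le_trans st)// (le_trans s0).
have LE s t x : L s t x = m s t * x + (delta s - m s t * s).
  by rewrite /L /lin -/(m s t); ring.
have Lt s t : L s t t = delta t by apply: lin_t => ->.
have Ls s t : L s t s = delta s by exact: lin_s.
have cL s t : continuous (L s t).
  have -> : L s t = (fun x => m s t * x + (delta s - m s t * s)) by apply/funext => x; exact: LE.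
  by move=> z; apply: cvgD; [apply: cvgM; [exact: cvg_cst|exact: cvg_id]|exact: cvg_cst].
pose phi x := if x <= s1 then L 0 s1 x else if x <= s2 then L s1 s2 x else L s2 l x.
pose phi' x := if x <= s1 then m 0 s1 else if x <= s2 then m s1 s2 else m s2 l.
have mle (a : R) : measurable_fun [set: measurableTypeR R] (fun x : R => x <= a).
  exact: measurable_fun_ler.
have mphi : measurable_fun [set: measurableTypeR R] phi.
  apply: measurable_fun_ifT => //; first exact: continuous_measurable_fun.
  by apply: measurable_fun_ifT => //; exact: continuous_measurable_fun.
have mphi' : measurable_fun [set: measurableTypeR R] phi'.
  by apply: measurable_fun_ifT => //; apply: measurable_fun_ifT.
have phi'1 x : `|phi' x| <= 1.
  rewrite /phi'; case: ifP => _; first exact: dle (le_trans s12 s2l).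
  by case: ifP => _; apply: dle => //; exact: le_trans s12.
have phi_1 x : x <= s1 -> phi x = L 0 s1 x by rewrite /phi => ->.
have phi_2 x : s1 <= x <= s2 -> phi x = L s1 s2 x.
  move=> /andP[]; rewrite le_eqVlt => /predU1P[<-|s1x xs2].
    by rewrite phi_1// Ls Lt.
  by rewrite /phi leNgt s1x/= xs2.
have phi_3 x : s2 <= x -> phi x = L s2 l x.
  rewrite le_eqVlt => /predU1P[<-|s2x].
    by rewrite phi_2 ?s12 ?lexx// Ls Lt.
  by rewrite /phi !leNgt s2x/= (le_lt_trans s12 s2x).
have [B phiB] : exists B, forall x, 0 <= x <= l -> `|phi x| <= B.
  have [B1 P1] := continuous_bounded 0 l (cL 0 s1).
  have [B2 P2] := continuous_bounded 0 l (cL s1 s2).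
  have [B3 P3] := continuous_bounded 0 l (cL s2 l).
  exists (Num.max B1 (Num.max B2 B3)) => x xl; rewrite /phi !le_max.
  by case: ifP => _; [rewrite P1|case: ifP => _; [rewrite P2// orbT|rewrite P3// !orbT]].
exists phi, phi'; split=> //; last first.
  split; [by rewrite phi_1// Ls|by rewrite phi_1// Lt| |by rewrite phi_3// Lt].
  by rewrite phi_3// Ls.
apply: (@chain_rule_cat _ _ mphi mphi' phi'1 B _ s2) => //; last 2 first.
- apply: (@chain_rule_affine _ _ (m s2 l) (delta s2 - m s2 l * s2)) => x /andP[? ?].
    by rewrite phi_3// LE.
  by rewrite /phi' !leNgt (le_lt_trans s12)//=; case: ltP => //; lra.
- exact: le_trans s12.
apply: (@chain_rule_cat _ _ mphi mphi' phi'1 B _ s1) => //.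
- by move=> z /andP[? ?]; apply: phiB; apply/andP; split; lra.
- apply: (@chain_rule_affine _ _ (m 0 s1) (delta 0 - m 0 s1 * 0)) => x /andP[x0 xs].
    by rewrite phi_1// LE.
  by rewrite /phi' (ltW xs).
- apply: (@chain_rule_affine _ _ (m s1 s2) (delta s1 - m s1 s2 * s1)) => x /andP[x0 xs].
    by rewrite phi_2 ?x0// LE.
  by rewrite /phi' leNgt x0/= (ltW xs).
Qed.

End ChainRule.

(** * The distance to a point, made piecewise affine *)

Section DistanceProfile.
Context {R : realType} (G : metric_graph R).
Hypothesis G_connected : graph_connected G.
Local Notation leb := (@lebesgue_measure R).
Variables (p0 q0 : edge G * R).
Hypotheses (p0P : points p0) (q0P : points q0).
Let T := rdist p0 q0.

Lemma rdist_glued p q : points p -> points q -> glued p q -> rdist p0 p = rdist p0 q.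
Proof.
move=> pp pq pg; apply: le_anti; apply/andP; split; rewrite -[leRHS]addr0.
  exact: (rdist_le_path G_connected p0P pq (graph_path_glued (glued_sym pg))).
exact: (rdist_le_path G_connected p0P pp (graph_path_glued pg)).
Qed.

Lemma rdist_edge_lipschitz e x y : 0 <= x <= len e -> 0 <= y <= len e ->
  `|rdist p0 (e, y) - rdist p0 (e, x)| <= `|y - x|.
Proof.
move=> xe ye.
have H1 := rdist_le_path G_connected p0P (xe : points (e, x)) (graph_path_edge1 x ye).
have H2 := rdist_le_path G_connected p0P (ye : points (e, y)) (graph_path_edge1 y xe).
by rewrite distrC in H2; rewrite ler_norml; apply/andP; split; lra.
Qed.

(* On every edge the distance to p0 is interpolated linearly between its values at
   the endpoints and at the points p0 and q0 if they lie on that edge. *)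
Lemma distance_profile : exists Phi dPhi : edge G * R -> R,
  [/\ forall e, measurable_fun [set: measurableTypeR R] (edge_fun Phi e),
      forall e, measurable_fun [set: measurableTypeR R] (edge_fun dPhi e),
      forall p, `|dPhi p| <= 1,
      forall e, chain_rule 0 (len e) (edge_fun Phi e) (edge_fun dPhi e) &
      [/\ Phi p0 = 0, Phi q0 = T & forall p q, glued p q -> Phi p = Phi q]].
Proof.
(* An edge that does not carry the point gets the node 0, an endpoint that is interpolated
   anyway. *)
pose bp (p : edge G * R) e := if p.1 == e then p.2 else 0.
have bpi p e : points p -> 0 <= bp p e <= len e.
  by rewrite /bp => pp; case: eqP => [<-//|_]; rewrite lexx ltW// len_gt0.
pose s1 e := Num.min (bp p0 e) (bp q0 e); pose s2 e := Num.max (bp p0 e) (bp q0 e).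
have s10 e : 0 <= s1 e by rewrite le_min; have /andP[-> _] := bpi _ e p0P;
  have /andP[-> _] := bpi _ e q0P.
have s12 e : s1 e <= s2 e by rewrite ge_min le_max lexx.
have s2l e : s2 e <= len e by rewrite ge_max; have /andP[_ ->] := bpi _ e p0P;
  have /andP[_ ->] := bpi _ e q0P.
have /choice[f fP] : forall e, exists f : (R -> R) * (R -> R),
  [/\ measurable_fun [set: measurableTypeR R] f.1,
      measurable_fun [set: measurableTypeR R] f.2,
      forall x, `|f.2 x| <= 1,
      chain_rule 0 (len e) f.1 f.2 &
      [/\ f.1 0 = rdist p0 (e, 0), f.1 (s1 e) = rdist p0 (e, s1 e),
          f.1 (s2 e) = rdist p0 (e, s2 e) & f.1 (len e) = rdist p0 (e, len e)]].
  move=> e; have [phi [phi' H]] := piecewise_linear_interpolation (s10 e) (s12 e) (s2l e)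
    (@rdist_edge_lipschitz e).
  by exists (phi, phi').
exists (fun p => (f p.1).1 p.2), (fun p => (f p.1).2 p.2); split.
- by move=> e; have [] := fP e.
- by move=> e; have [] := fP e.
- by move=> [e x]; have [_ _ ->] := fP e.
- by move=> e; have [_ _ _] := fP e.
have bpE p : p = p0 \/ p = q0 -> (f p.1).1 p.2 = rdist p0 p.
  case: p => e x /= pq; have [_ _ _ _ [_ f1 f2 _]] := fP e.
  have [->//|->//] : x = s1 e \/ x = s2 e.
  rewrite /s1 /s2 /bp.
  by case: pq => <- /=; rewrite eqxx; [case: (leP x); auto|case: (leP _ x); auto].
split.
- by rewrite bpE ?(rdistxx G_connected p0P)//; left.
- by rewrite bpE//; right.
- have endE p v : at_vertex p v -> (f p.1).1 p.2 = rdist p0 p.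
    by case: p => e x; have [_ _ _ _ [f0 _ _ fl]] := fP e => -[[/= -> _]|[/= -> _]].
  move=> p q [v [pv qv]]; rewrite (endE _ _ pv) (endE _ _ qv).
  by apply: rdist_glued (at_vertex_points pv) (at_vertex_points qv) _; exists v.
Qed.

End DistanceProfile.

(** * The cosine of the profile as a test function *)

Section TestFunction.
Context {R : realType} (G : metric_graph R) (e0 : edge G).
Hypothesis G_connected : graph_connected G.
Hypothesis volume_fin : (volume G < +oo)%E.
Local Notation leb := (@lebesgue_measure R).
Local Notation mu := (@graph_measure R G e0).
Local Notation D := (@open_edges R G e0).
Local Notation mD := (@measurable_open_edges R G e0).
Local Notation gip := (ip mu D).
Local Notation gsq := (sq_int mu D).
Variables (p0 q0 : edge G * R) (Phi dPhi : edge G * R -> R) (T : R).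
Hypotheses (p0P : points p0) (q0P : points q0).
Hypothesis mPhi : forall e, measurable_fun [set: measurableTypeR R] (edge_fun Phi e).
Hypothesis mdPhi : forall e, measurable_fun [set: measurableTypeR R] (edge_fun dPhi e).
Hypothesis dPhi1 : forall p, `|dPhi p| <= 1.
Hypothesis chainPhi : forall e, chain_rule 0 (len e) (edge_fun Phi e) (edge_fun dPhi e).
Hypotheses (Phi0 : Phi p0 = 0) (PhiT : Phi q0 = T).
Hypothesis Phi_glued : forall p q, glued p q -> Phi p = Phi q.
Implicit Types (h H : R -> R) (c x y z t : R).

Let mI a b : measurable (`]a, b[%classic : set (measurableTypeR R)).
Proof. exact: measurable_itv. Qed.

Let Phi_edge_lipschitz e x y : 0 <= x <= len e -> 0 <= y <= len e ->
  `|Phi (e, y) - Phi (e, x)| <= `|y - x|.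
Proof.
exact: (chain_rule_lipschitz (mdPhi e) (fun x => dPhi1 (e, x)) (@chainPhi e)).
Qed.

(** This gives continuity with respect to [dist], across vertices as well as along edges. *)
Let Phi_path p q L : points p -> graph_path p q L -> `|Phi q - Phi p| <= L.
Proof.
move=> pp; elim=> [|e x y M px IH ey|q' r M _ IH qr].
- by rewrite subrr normr0.
- have -> : Phi (e, y) - Phi p = (Phi (e, x) - Phi p) + (Phi (e, y) - Phi (e, x)) by ring.
  apply: (le_trans (ler_normD _ _)); apply: (lerD IH).
  exact: Phi_edge_lipschitz (graph_path_points pp px) ey.
- by rewrite -(Phi_glued qr).
Qed.

Let Phi_edge_bound e z : 0 <= z <= len e -> `|edge_fun Phi e z| <= `|Phi (e, 0)| + len e.
Proof.
move=> ze; have := @Phi_edge_lipschitz e 0 z _ ze.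
rewrite lexx (ltW (len_gt0 e)) subr0 => /(_ isT) H.
rewrite /edge_fun -[Phi (e, z)](subrK (Phi (e, 0))) addrC.
apply: (le_trans (ler_normD _ _)); rewrite lerD2l; apply: (le_trans H).
by move: ze => /andP[z0 zl]; rewrite ger0_norm.
Qed.

(** The path from p0 to q0 shows that the ranges of Phi on the edges cover [0, T], and on each edge
    the integral of h (Phi) is at least that of h over the range. *)
Lemma profile_integral_ge h H : 0 <= T -> (forall z : R, is_derive z 1 H (h z)) ->
  continuous h -> (forall z, 0 <= h z) ->
  ((H T - H 0)%:E <= \int[mu]_(p in D) (h (Phi p))%:E)%E.
Proof.
move=> T0 dH ch h0.
(* [X e] consists of a minimum point and a maximum point of Phi on the closed edge. *)
have /choice[X XP] : forall e, exists X : R * R, [/\ 0 <= X.1 <= len e, 0 <= X.2 <= len e &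
    forall z, 0 <= z <= len e -> Phi (e, X.1) <= Phi (e, z) <= Phi (e, X.2)].
  move=> e; have cN : {within `[0, len e], continuous (edge_fun Phi e)}.
    apply/subspace_continuousP => z /=; rewrite in_itv/= => ze.
    apply/cvgrPdist_lt => eps eps0; near=> y.
    have ye : 0 <= y <= len e by near: y; apply: filterS (withinT _ _) => y /=; rewrite in_itv.
    apply: (le_lt_trans (Phi_edge_lipschitz ye ze)).
    by near: y; apply: cvg_within; apply/nbhs_normP; exists eps.
  have [c1 c1i c1P] := EVT_min (ltW (len_gt0 e)) cN.
  have [c2 c2i c2P] := EVT_max (ltW (len_gt0 e)) cN.
  exists (c1, c2); split; [by rewrite in_itv in c1i|by rewrite in_itv in c2i|].
  by move=> z ze; rewrite c1P ?c2P// in_itv.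
pose J e : set (measurableTypeR R) := `[Phi (e, (X e).1), Phi (e, (X e).2)]%classic.
have cover : `]0, T[%classic `<=` \bigcup_e J e.
  move=> t /=; rewrite in_itv/= => /andP[/ltW t0 /ltW tT].
  have [L pL] := connected_graph_path G_connected p0P q0P.
  have [|e [x [y [ex ey /andP[xt ty]]]]] := path_between (t := t) Phi_glued p0P pL.
    by rewrite Phi0 PhiT t0 tT.
  exists e => //; rewrite /J/= in_itv/=; have [_ _ XeP] := XP e.
  have /andP[Hx _] := XeP x ex; have /andP[_ Hy] := XeP y ey.
  by rewrite (le_trans Hx xt) (le_trans ty Hy).
have mh : measurable_fun [set: measurableTypeR R] (EFin \o h).
  by apply/measurable_EFinP; exact: continuous_measurable_fun.
have hi a b : leb.-integrable `]a, b[ (EFin \o h).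
  apply: (@integrableS _ _ _ leb `[a, b]) => //; first exact: subset_itv_oo_cc.
  apply: continuous_compact_integrable; first exact: segment_compact.
  exact: continuous_subspaceT.
have hE a b : a <= b -> (\int[leb]_(x in `]a, b[) (h x)%:E = (H b - H a)%:E)%E.
  move=> ab; rewrite -(Rintegral_derive ab dH ch) /Rintegral fineK//.
  exact: integrable_fin_num (hi a b).
rewrite -hE//.
have mJ e : measurable (J e) by exact: measurable_itv.
have le := @le_integral_cover _ _ _ leb _ _ J _ (mI 0 T) mJ mh
  (fun z => h0 z : (0 <= (h z)%:E)%E) cover.
apply: (le_trans le).
have mhPhi : measurable_fun D (fun p : graph_space e0 => (h (Phi p))%:E).
  apply/measurable_EFinP; apply: measurable_graph => e; apply: measurable_funTS.
  apply: (measurableT_comp (f := h) (g := edge_fun Phi e)); last exact: mPhi.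
  exact: continuous_measurable_fun.
rewrite ge0_integral_graph//; last by move=> p _; rewrite lee_fin.
apply: le_esum => e _; have [X1 X2 XeP] := XP e.
have /andP[X12 _] := XeP _ X2.
rewrite /J integral_itv_bndoo; last exact: measurable_funTS.
rewrite (hE _ _ X12).
have := chain_rule_cover (mPhi e) (mdPhi e) (fun x => dPhi1 (e, x)) (@chainPhi e)
  (@Phi_edge_bound e) dH ch h0 X1 X2.
rewrite -lee_fin => /le_trans; apply.
rewrite /Rintegral fineK//.
have [M MP] := continuous_bounded (- (`|Phi (e, 0)| + len e)) (`|Phi (e, 0)| + len e) ch.
apply: (integrable_fin_num (mI _ _)).
apply: (@integrable_bounded _ _ _ leb _ (mI 0 (len e)) (lebesgue_itvoo_lty _ _) _ M).
  apply: measurable_funTS; apply: measurableT_comp; last exact: mPhi.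
  exact: continuous_measurable_fun.
move=> z /=; rewrite in_itv/= => /andP[/ltW z0 /ltW zl]; apply: MP; rewrite -ler_norml.
by apply: Phi_edge_bound; rewrite z0.
Unshelve. all: by end_near. Qed.

Lemma profile_length_le_volume : 0 <= T -> T <= gvol G.
Proof.
move=> T0.
have := profile_integral_ge T0 (H := id) (h := cst 1) (fun z => is_derive_id _ _)
  (@cst_continuous _ _ _) (fun=> ler01).
rewrite subr0 (_ : (fun p => (cst 1 (Phi p))%:E) = cst 1%E)//.
rewrite integral_cst; last exact: mD.
by rewrite mul1e (gvolE e0 volume_fin) lee_fin.
Qed.

Hypothesis T_gt0 : 0 < T.
Let k := pi / T.
Let f p := cos (k * Phi p).
Let f' p := - k * sin (k * Phi p) * dPhi p.

Let k_gt0 : 0 < k. Proof. by rewrite divr_gt0// pi_gt0. Qed.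

Let daff z : is_derive z 1 (fun z : R => k * z) k.
Proof.
have : is_derive z 1 (fun z : R => k *: (z : R)) (k *: 1) by exact: is_deriveZ.
by rewrite /GRing.scale/= mulr1.
Qed.

Let dcosk z : is_derive z 1 (fun z : R => cos (k * z)) (- k * sin (k * z)).
Proof.
have H := @is_derive1_comp _ (@cos R) (fun z => k * z) z _ _ (is_derive_cos _) (daff z).
by apply: (is_derive_eq H); rewrite mulrC mulrN mulNr.
Qed.

Let dsink z : is_derive z 1 (fun z : R => sin (k * z)) (k * cos (k * z)).
Proof.
have H := @is_derive1_comp _ (@sin R) (fun z => k * z) z _ _ (is_derive_sin _) (daff z).
by apply: (is_derive_eq H); rewrite mulrC.
Qed.

Let ccosk : continuous (fun z : R => cos (k * z)).
Proof. by move=> z; apply/differentiable_continuous/derivable1_diffP; exact: ex_derive. Qed.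

Let csink : continuous (fun z : R => - k * sin (k * z)).
Proof.
move=> z; apply: cvgM; first exact: cvg_cst.
by apply/differentiable_continuous/derivable1_diffP; exact: ex_derive.
Qed.

Let mf e : measurable_fun [set: measurableTypeR R] (edge_fun f e).
Proof.
apply: (measurableT_comp (f := fun z : R => cos (k * z)) (g := edge_fun Phi e)).
  exact: continuous_measurable_fun.
exact: mPhi.
Qed.

Let mf' e : measurable_fun [set: measurableTypeR R] (edge_fun f' e).
Proof.
apply: measurable_funM; last exact: mdPhi.
apply: (measurableT_comp (f := fun z : R => - k * sin (k * z)) (g := edge_fun Phi e)).
  exact: continuous_measurable_fun.
exact: mPhi.
Qed.

Let f_le1 p : `|f p| <= 1. Proof. exact: cos_max. Qed.

Let f'_le p : `|f' p| <= k.
Proof.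
rewrite /f' !normrM normrN (gtr0_norm k_gt0) -[leRHS]mulr1 -mulrA ler_pM2l//.
by rewrite -[leRHS]mulr1; apply: ler_pM => //; exact: sin_max.
Qed.

Let fi : gsq f.
Proof.
apply: (@sq_int_bounded _ _ _ mu D mD (open_edges_lty e0 volume_fin) _ 1) => //.
by apply: measurable_graph => e; apply: measurable_funTS.
Qed.

Let f'i : gsq f'.
Proof.
apply: (@sq_int_bounded _ _ _ mu D mD (open_edges_lty e0 volume_fin) _ k) => //.
by apply: measurable_graph => e; apply: measurable_funTS.
Qed.

Let Hf : H1_graph f f'.
Proof.
apply/(H1_graphP e0); split=> //.
  move=> p pp eps eps0.
  have /cvgrPdist_lt/(_ _ eps0)/nbhs_normP[d /= d0 dP] := @ccosk (Phi p).
  exists d => // q qq /dist_approx[L pL Ld].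
  rewrite distrC; apply: dP => /=; rewrite distrC.
  exact: le_lt_trans (Phi_path pp pL) Ld.
move=> e; apply/H1_intervalP; have fin := lebesgue_itvoo_lty 0 (len e).
have fei : sq_int leb `]0, len e[ (edge_fun f e).
  apply: (sq_int_bounded (mI _ _) fin (M := 1)); first by apply: measurable_funTS; exact: mf.
  by move=> x _; exact: f_le1.
have f'ei : sq_int leb `]0, len e[ (edge_fun f' e).
  apply: (sq_int_bounded (mI _ _) fin (M := k)); first by apply: measurable_funTS; exact: mf'.
  by move=> x _; exact: f'_le.
split=> // eta teta; have [c0 c1] := test_function_continuous teta.
have deta (z : R) : is_derive z 1 eta ((eta^`())%classic z).
  by rewrite derive1E; apply: derivableP; exact: (teta.1 0%N).
have := chainPhi (lexx 0) (ltW (len_gt0 e)) (lexx _) dcosk csink deta c1.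
have [_ [s [t [s0 tl out]]]] := teta.
rewrite (out 0); last by rewrite negb_and -!ltNge s0.
rewrite (out (len e)); last by rewrite negb_and -!ltNge tl orbT.
rewrite !mulr0 subrr => I0.
have i1 := sq_int_mul (mI 0 (len e)) fei (sq_int_continuous 0 (len e) c1).
have i2 := sq_int_mul (mI 0 (len e)) f'ei (sq_int_continuous 0 (len e) c0).
apply/eqP; rewrite -addr_eq0 /ip -(RintegralD (mI 0 (len e)) i1 i2).
by apply/eqP; rewrite -[RHS]I0.
Qed.

(** H is an antiderivative of (cos (k z) - c)^2; its terms with a sine vanish at 0 and at T, because
    k T = pi. *)
Let shifted_energy c : (((1 / 2 + c ^+ 2) * T)%:E <= \int[mu]_(p in D) ((f p - c) ^+ 2)%:E)%E.
Proof.
pose H z : R := (1 / 2 + c ^+ 2) * z +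
  (sin (k * z) * cos (k * z) * (2 * k)^-1 - 2 * c / k * sin (k * z)).
have dH z : is_derive z 1 H ((cos (k * z) - c) ^+ 2).
  have d1 : is_derive z 1 (fun z : R => (1 / 2 + c ^+ 2) * z) (1 / 2 + c ^+ 2).
    have : is_derive z 1 (fun z : R => (1 / 2 + c ^+ 2) *: (z : R)) ((1 / 2 + c ^+ 2) *: 1)
      by exact: is_deriveZ.
    by rewrite /GRing.scale/= mulr1.
  have d2 := is_deriveM (is_deriveM (dsink z) (dcosk z)) (is_derive_cst (2 * k)^-1 z 1).
  have d3 := is_deriveZ (2 * c / k) (dsink z).
  have := is_deriveD d1 (is_deriveB d2 d3); rewrite /GRing.scale/= => d4.
  apply: (is_derive_eq d4); have := cos2Dsin2 (k * z).
  move: (cos (k * z)) (sin (k * z)) => C S CS.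
  have kN0 : k != 0 by rewrite gt_eqF.
  rewrite mulr0.
  have -> : 1 / 2 + c ^+ 2 + ((0 + (2 * k)^-1 * (S * (- k * S) + C * (k * C))) -
    2 * c / k * (k * C)) = 1 / 2 + c ^+ 2 + (C ^+ 2 - S ^+ 2) / 2 - 2 * c * C by field.
  by have -> : S ^+ 2 = 1 - C ^+ 2 by [rewrite -CS addrC addKr]; field.
have ch : continuous (fun z : R => (cos (k * z) - c) ^+ 2).
  have cc : continuous (fun z : R => cos (k * z) - c).
    by move=> z; apply: cvgB; [exact: ccosk|exact: cvg_cst].
  by move=> z; exact: (cvgM (cc z) (cc z)).
have := profile_integral_ge (ltW T_gt0) dH ch (fun z => sqr_ge0 _).
have kT : k * T = pi by rewrite /k divfK// gt_eqF.
have -> : H T - H 0 = (1 / 2 + c ^+ 2) * T.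
  by rewrite /H kT !mulr0 sinpi sin0; ring.
by [].
Qed.

Lemma mean0_test_function : exists g g' : edge G * R -> R,
  [/\ mean0 e0 g g', T / 2 <= gip g g & gip g' g' <= k ^+ 2 * (gvol G - T / 2)].
Proof.
have V0 : 0 < gvol G := gvol_gt0 e0 volume_fin.
have oi := graph_sq_int_cst e0 volume_fin 1.
have one2 : gip (fun=> 1) (cst 1) = gvol G.
  rewrite -[RHS]mul1r -(Rintegral_graph_cst e0 volume_fin).
  by apply: eq_Rintegral => s _; rewrite mulr1.
pose c := gip f (cst 1) / gvol G.
exists (fun p => 1 * f p + (- c) * 1), (fun p => 1 * f' p + (- c) * 0); split.
- split; first exact: (H1_graph_lin e0 _ _ Hf (H1_graph_cst e0 volume_fin 1)).
  rewrite (ip_linl mD _ _ fi oi oi) one2 mul1r /c mulNr divfK ?gt_eqF//.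
  by rewrite subrr.
- have := shifted_energy c.
  have -> : (\int[mu]_(p in D) ((f p - c) ^+ 2)%:E)%E =
      (gip (fun p => 1 * f p + (- c) * 1) (fun p => 1 * f p + (- c) * 1))%:E.
    rewrite -(ipE mD (sq_int_lin mD 1 (- c) fi oi) (sq_int_lin mD 1 (- c) fi oi)).
    by apply: eq_integral => p _; rewrite /cst/= mulr1 mul1r expr2.
  rewrite lee_fin; apply: le_trans.
  by rewrite mulrDl mul1r [_^-1 * _]mulrC lerDl mulr_ge0 ?sqr_ge0// ltW.
have -> : gip (fun p => 1 * f' p + (- c) * 0) (fun p => 1 * f' p + (- c) * 0) = gip f' f'.
  by apply: eq_Rintegral => p _; ring.
(* The shift 0 instead of the mean: this bound enters the energy with a minus sign, through 1 -
   f^2. *)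
have ff : T / 2 <= gip f f.
  have := shifted_energy 0; rewrite expr0n addr0 mul1r mulrC.
  have -> : (\int[mu]_(p in D) ((f p - 0) ^+ 2)%:E)%E = (gip f f)%:E.
    by rewrite -(ipE mD fi fi); apply: eq_integral => p _; rewrite subr0 expr2.
  by rewrite lee_fin.
have ci := sq_int_integrable mD (open_edges_lty e0 volume_fin)
  (graph_sq_int_cst e0 volume_fin (k ^+ 2)).
have ki := integrableZl mD (- k ^+ 2) (sq_int_mul mD fi fi).
apply: (@le_trans _ _ (\int[mu]_(p in D) (cst (k ^+ 2) p + (- k ^+ 2) * (f p * f p)))).
  apply: le_Rintegral.
  - exact: mD.
  - exact: (sq_int_mul mD f'i f'i).
  - exact: (integrableD mD ci ki).
  - move=> p _ /=.
    have -> : k ^+ 2 + - k ^+ 2 * (f p * f p) = k ^+ 2 * sin (k * Phi p) ^+ 2.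
      by rewrite -[X in X + _]mulr1 -(cos2Dsin2 (k * Phi p)) /f; ring.
    have -> : f' p * f' p = k ^+ 2 * sin (k * Phi p) ^+ 2 * dPhi p ^+ 2 by rewrite /f'; ring.
    rewrite ler_piMr ?(mulr_ge0 (sqr_ge0 _) (sqr_ge0 _))//.
    by rewrite -real_normK ?num_real// expr_le1.
rewrite [leLHS](RintegralD mD ci ki) (RintegralZl _ mD (sq_int_mul mD fi fi)).
rewrite (Rintegral_graph_cst e0 volume_fin).
have k2 : 0 <= k ^+ 2 by exact: sqr_ge0.
have := ler_wpM2l k2 ff; rewrite -/(gip f f) mulrBr mulNr; lra.
Qed.

End TestFunction.

(** * The second eigenvalue *)

Section SecondEigenvalue.
Context {R : realType} (G : metric_graph R) (e0 : edge G).
Hypothesis G_connected : graph_connected G.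
Hypothesis volume_fin : (volume G < +oo)%E.
Local Notation mu := (@graph_measure R G e0).
Local Notation D := (@open_edges R G e0).
Local Notation mD := (@measurable_open_edges R G e0).
Local Notation gip := (ip mu D).

(** The image is written 0 * 1 to match the form [nu i * u i p] in [neumann_eigenvalue]. *)
Lemma neumann_laplacian_cst : @neumann_laplacian R G (fun=> 1) (fun=> 0 * 1).
Proof.
apply: (@neumann_laplacian_eigen _ _ e0 0 _ _ (H1_graph_cst e0 volume_fin 1)) => g g' _.
rewrite mul0r /ip (_ : (fun x => 0 * g' x) = fun=> 0); last first.
  by apply/funext => x; rewrite mul0r.
by rewrite (Rintegral_cst mu mD) mul0r.
Qed.

(** A vanishing combination is paired with 1 and then with w, which are orthogonal and of positive
    norm. *)
Lemma mean0_lin_indep w w' : mean0 e0 w w' -> gip w w = 1 ->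
  lin_indep (@points R G) (fun i : 'I_2 => if i == 0 then fun=> 1 else w : edge G * R -> R).
Proof.
move=> [Hw w0] ww c cP; have [_ _ wi w'i] := (H1_graphP e0 _ _).1 Hw.
have oi := graph_sq_int_cst e0 volume_fin 1.
have {}cP p : D p -> c 0 * 1 + c 1 * w p = 0.
  move=> /andP[p0 pl]; rewrite -(cP p); last by rewrite /points/= !ltW.
  by rewrite big_ord_recl big_ord1 /= (_ : lift _ _ = 1)//; exact: val_inj.
have ip0 g : gip (fun p => c 0 * 1 + c 1 * w p) g = 0.
  rewrite /ip (@eq_Rintegral _ _ _ mu D (cst 0)).
    by rewrite (Rintegral_cst mu mD) mul0r.
  by move=> p /[!inE] Dp; rewrite cP// mul0r.
have one1 : gip (cst 1) (cst 1) = gvol G.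
  rewrite -[RHS]mul1r -(Rintegral_graph_cst e0 volume_fin).
  by apply: eq_Rintegral => s _; rewrite mulr1.
have c0 : c 0 = 0.
  have := ip0 (cst 1); rewrite (ip_linl mD _ _ oi wi oi) w0 mulr0 addr0 one1.
  by move=> /eqP; rewrite mulf_eq0 (gt_eqF (gvol_gt0 e0 volume_fin)) orbF => /eqP.
have c1 : c 1 = 0.
  by have := ip0 w; rewrite (ip_linl mD _ _ oi wi wi) c0 mul0r add0r ww mulr1.
by move=> i; case: (unliftP 0 i) => [j ->|->//]; rewrite ord1 -[RHS]c1; congr c; exact: val_inj.
Qed.

(** The constant 1 and the minimizer are independent eigenfunctions with eigenvalues 0 and m, so m
    is admissible in the infimum. The function f only shows that the quotient is defined somewhere;
    m does not depend on two points chosen later. *)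
Lemma second_eigenvalue_le_rayleigh f f' : mean0 e0 f f' -> 0 < gip f f ->
  exists m : R, [/\ 0 <= m, (neumann_eigenvalue G 2 <= m%:E)%E &
    forall g g', mean0 e0 g g' -> m * gip g g <= gip g' g'].
Proof.
move=> Hf ff; have [m [w [w' [Hw ww m0 wm mP]]]] := rayleigh_minimizer G_connected volume_fin Hf ff.
exists m; split=> //; apply: ereal_inf_lbound; exists m => //.
exists (fun i : 'I_2 => if i == 0 then (fun=> 1) else w), (fun i : 'I_2 => if i == 0 then 0 else m).
split.
- move=> i; case: eqP => _; first exact: neumann_laplacian_cst.
  apply: (@neumann_laplacian_eigen _ _ e0 m _ _ Hw.1).
  by apply: (euler_lagrange volume_fin Hw) mP; rewrite ww mulr1.
- by move=> i; case: ifP.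
- exact: (mean0_lin_indep Hw ww).
Qed.

End SecondEigenvalue.

(** * Comparison of distances, volume and the Rayleigh quotient *)

Section Diameter.
Context {R : realType} (G : metric_graph R) (e0 : edge G).
Hypothesis G_connected : graph_connected G.
Hypothesis volume_fin : (volume G < +oo)%E.
Local Notation gip := (ip (@graph_measure R G e0) (@open_edges R G e0)).

Lemma rdist_le_volume p q : points p -> points q -> @rdist R G p q <= gvol G.
Proof.
move=> pp pq; have [Phi [dPhi [m1 m2 b c [P0 PT Pg]]]] := distance_profile G_connected pp pq.
apply: (profile_length_le_volume e0 G_connected volume_fin pp pq m1 m2 b c P0 PT Pg).
exact: rdist_ge0.
Qed.

Lemma diameter_le_volume : (diameter G <= (gvol G)%:E)%E.
Proof.
apply: ge_ereal_sup => _ [p [q [pp pq ->]]].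
by rewrite (rdistE G_connected pp pq) lee_fin rdist_le_volume.
Qed.

(** The inequality m T / 2 <= (pi / T)^2 (|G| - T / 2) cleared of denominators: it then holds for T
    = 0 too, and is polynomial in T, ready for the passage to the supremum. *)
Lemma rayleigh_le_rdist (m : R) p q : 0 <= m ->
  (forall g g', mean0 e0 g g' -> m * gip g g <= gip g' g') ->
  points p -> points q ->
  m * @rdist R G p q ^+ 3 + pi ^+ 2 * rdist p q <= 2 * pi ^+ 2 * gvol G.
Proof.
move=> m0 mP pp pq; have [T0|T0] := eqVneq (rdist p q) 0.
  rewrite T0 expr0n !mulr0 addr0 mulr_ge0//; first by rewrite mulr_ge0// sqr_ge0.
  exact/ltW/(gvol_gt0 e0 volume_fin).
have {}T0 : 0 < rdist p q by rewrite lt0r T0 rdist_ge0.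
have [Phi [dPhi [m1 m2 b c [P0 PT Pg]]]] := distance_profile G_connected pp pq.
have [g [g' [Hg gg g'g']]] :=
  mean0_test_function e0 G_connected volume_fin pp pq m1 m2 b c P0 PT Pg T0.
move: (rdist p q) T0 gg g'g' => T T0 gg g'g' {PT}.
have : m * (T / 2) <= (pi / T) ^+ 2 * (gvol G - T / 2).
  exact: le_trans (ler_wpM2l m0 gg) (le_trans (mP _ _ Hg) g'g').
have T2 : 0 <= 2 * T ^+ 2 by rewrite mulr_ge0// sqr_ge0.
move=> /(ler_wpM2l T2).
have -> : 2 * T ^+ 2 * (m * (T / 2)) = m * T ^+ 3 by field.
have -> : 2 * T ^+ 2 * ((pi / T) ^+ 2 * (gvol G - T / 2)) =
  2 * pi ^+ 2 * gvol G - pi ^+ 2 * T by field; rewrite gt_eqF.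
by rewrite lerBrDr.
Qed.

End Diameter.

(** On [0, d] the left side has Lipschitz constant at most 3 a d^2 + b, because d^3 - t^3 = (d - t)
    (d^2 + d t + t^2). *)
Lemma cubic_le_sup (R : realFieldType) (a b C d : R) : 0 <= a -> 0 < b -> 0 <= d ->
  (forall eps, 0 < eps -> exists t, [/\ 0 <= t, d - eps <= t, t <= d & a * t ^+ 3 + b * t <= C]) ->
  a * d ^+ 3 + b * d <= C.
Proof.
move=> a0 b0 d0 H; apply/ler_addgt0Pr => eps eps0.
have K0 : 0 < a * (3 * d ^+ 2) + b by rewrite ltr_wpDl// !mulr_ge0 ?sqr_ge0.
have [t [t0 dt td tC]] := H _ (divr_gt0 eps0 K0).
have d2 : d ^+ 2 + d * t + t ^+ 2 <= 3 * d ^+ 2 by nra.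
have : (d - t) * (a * (3 * d ^+ 2) + b) <= eps by rewrite -ler_pdivlMr//; lra.
have : 0 <= (d - t) * (a * (3 * d ^+ 2 - (d ^+ 2 + d * t + t ^+ 2))).
  by rewrite !mulr_ge0 ?subr_ge0.
lra.
Qed.

Theorem proposition5p1 (R : realType) (G : metric_graph R) (beta : nat)
    (G_locally_finite : locally_finite G)
    (G_connected : graph_connected G)
    (volume_gt0 : (0 < volume G)%E)
    (volume_fin : (volume G < +oo)%E)
    (diameter_gt0 : (0 < diameter G)%E)
    (G_betti : has_betti_number G beta) :
  let D := fine (diameter G) in
  let V := fine (volume G) in
  (neumann_eigenvalue G 2 <=
     ((pi : R) ^+ 2 / D ^+ 2 * ((4 * V - 3 * D) / D))%:E)%E.
Proof.
cbv zeta; set D := fine (diameter G); set V := fine (volume G).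
(* Positive volume provides the edge that points the measurable space. *)
have [e0 _] : [set: edge G] !=set0.
  apply/set0P/eqP => E0; move: volume_gt0.
  by rewrite /volume E0 esum_set0 ltxx.
have DV := diameter_le_volume e0 G_connected volume_fin.
have DE : diameter G = D%:E.
  by rewrite fineK// ge0_fin_numE ?(ltW diameter_gt0)// (le_lt_trans DV)// ltry.
have D0 : 0 < D by rewrite -lte_fin -DE.
have DleV : D <= V by rewrite -lee_fin -DE.
have near_sup eps : 0 < eps -> exists p q, [/\ @points R G p, points q & D - eps < rdist p q].
  move=> eps0; have : ((D - eps)%:E < diameter G)%E by rewrite DE lte_fin ltrBlDr ltrDl.
  move=> /ereal_sup_gt[_ [p [q [pp pq ->]]]].
  by rewrite (rdistE G_connected pp pq) lte_fin => ?; exists p, q.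
(* The choice eps = D only asks for two points at positive distance; their test function starts the
   minimization. *)
have [p [q [pp pq]]] := near_sup D D0; rewrite subrr => pq0.
have [Phi [dPhi [m1 m2 b c [P0 PT Pg]]]] := distance_profile G_connected pp pq.
have [f [f' [Hf ff _]]] :=
  mean0_test_function e0 G_connected volume_fin pp pq m1 m2 b c P0 PT Pg pq0.
have [|m [m0 mu2 mP]] := second_eigenvalue_le_rayleigh G_connected volume_fin Hf.
  by apply: lt_le_trans ff; rewrite divr_gt0.
apply: (le_trans mu2); rewrite lee_fin.
have pi2 : 0 < (pi : R) ^+ 2 by rewrite exprn_gt0// pi_gt0.
have : m * D ^+ 3 + pi ^+ 2 * D <= 2 * pi ^+ 2 * V.
  apply: (cubic_le_sup m0 pi2 (ltW D0)) => eps /near_sup[x [y [px py xy]]].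
  exists (rdist x y); split; [exact: rdist_ge0|exact: ltW| |].
    rewrite -lee_fin -DE -(rdistE G_connected px py); apply: ereal_sup_ubound.
    by exists x, y.
  exact: (rayleigh_le_rdist G_connected volume_fin m0 mP px py).
have -> : pi ^+ 2 / D ^+ 2 * ((4 * V - 3 * D) / D) = (pi ^+ 2 * (4 * V - 3 * D)) / D ^+ 3.
  by field; rewrite gt_eqF.
rewrite ler_pdivlMr ?exprn_gt0//.
(* At this point m D^3 <= pi^2 (2 V - D), and 4 V - 3 D exceeds 2 V - D by 2 (V - D). *)
have : pi ^+ 2 * D <= pi ^+ 2 * V by rewrite ler_pM2l.
lra.
Qed.
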